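(* Let $G$ be a group. The classical torsion $C_*\mapsto\rho(C_* )$ and the universal $L^2$-torsion $C_*\mapsto\rho_u^{(2)}(C_* )$ induce isomorphisms $$\rho\colon\widetilde K_1^{\mathrm{ch}}(\mathbb ZG)\xrightarrow{\cong}\widetilde K_1(\mathbb ZG),\qquad\rho^{(2)}_u\colon\widetilde K_1^{w,\mathrm{ch}}(\mathbb ZG)\xrightarrow{\cong}\widetilde K_1^w(\mathbb ZG)$$ such that the diagram $$\begin{array}{ccc}\widetilde K_1^{\mathrm{ch}}(\mathbb ZG)&\xrightarrow{\ \zeta\ }&\widetilde K_1^{w,\mathrm{ch}}(\mathbb ZG)\\ \downarrow{\scriptstyle\rho}&&\downarrow{\scriptstyle\rho^{(2)}_u}\\ \widetilde K_1(\mathbb ZG)&\xrightarrow{\ \zeta\ }&\widetilde K_1^w(\mathbb ZG)\end{array}$$ commutes, where the horizontal maps $\zeta$ are the obvious forgetful homomorphisms. The inverses of $\rho$ and $\rho^{(2)}_u$ are given by regarding a homomorphism of finitely generated based free $\mathbb ZG$-modules as a $1$-dimensional finite based free $\mathbb ZG$-chain complex (i.e. concentrated in degrees $1$ and $0$ with the given homomorphism as first differential).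
   Context: Modules are left modules. A finitely generated based free $\mathbb ZG$-module is a finitely generated free $\mathbb ZG$-module $M$ with a finite unordered basis $B$; $\mathbb ZG^n$ carries the standard basis. Put $\Lambda(M)=L^2(G)\otimes_{\mathbb ZG}M$ with the Hilbert space structure for which $\bigoplus_{b\in B}L^2(G)\to\Lambda(M)$ is isometric; a $\mathbb ZG$-map $f$ induces a bounded $G$-equivariant operator $\Lambda(f)$, called a weak isomorphism if it is injective with dense image. A finite based free $\mathbb ZG$-chain complex $C_*$ has finitely generated based free chain modules, with $C_n=0$ for $|n|$ large. $\Lambda(C_* )$ is $L^2$-acyclic if for every $n$ the kernel of its $n$-th differential modulo the closure of the image of the $(n+1)$-st vanishes. A short exact sequence $0\to M_0\xrightarrow iM_1\xrightarrow pM_2\to0$ of finitely generated based free modules with bases $B_k$ is based exact if $i(B_0)\subseteq B_1$ and $p$ maps $B_1\setminus i(B_0)$ bijectively onto $B_2$; for chain complexes this is required in each degree. $K_1^w(\mathbb ZG)$ is the abelian group with generators $[f]$ for endomorphisms $f\colon\mathbb ZG^n\to\mathbb ZG^n$, $n\ge0$, with $\Lambda(f)$ a weak isomorphism, and relations $[f_2\circ f_1]=[f_1]+[f_2]$ and $\left[\begin{pmatrix}f_0&f_1\\0&f_2\end{pmatrix}\right]=[f_0]+[f_2]$ (for $\Lambda(f_0),\Lambda(f_2)$ weak isomorphisms). $\widetilde K_1^w(\mathbb ZG)=K_1^w(\mathbb ZG)/\langle[-\mathrm{id}_{\mathbb ZG}]\rangle$; $K_1(\mathbb ZG)$ and $\widetilde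 K_1(\mathbb ZG)$ are defined in the same way with ''$\Lambda(f)$ weak isomorphism'' replaced by ''$f$ isomorphism''. For $f\colon M\to N$ between finitely generated based free modules with $\Lambda(f)$ a weak isomorphism (resp. $f$ an isomorphism), the ranks agree (if $M\ne 0$ this is automatic), and $[f]:=[b\circ f]$ in $\widetilde K_1^w(\mathbb ZG)$ (resp. $\widetilde K_1(\mathbb ZG)$) for $b\colon N\to M$ induced by any bijection of bases. $C_{\mathrm{odd}}=\bigoplus_nC_{2n+1}$, $C_{\mathrm{ev}}=\bigoplus_nC_{2n}$; $c$ denotes the differential. For a contractible finite based free $C_*$ with chain contraction $\gamma_*$, $\rho(C_* )=[(c+\gamma)_{\mathrm{odd}}\colon C_{\mathrm{odd}}\to C_{\mathrm{ev}}]\in\widetilde K_1(\mathbb ZG)$. A weak chain contraction $(\gamma_*,u_* )$ of $C_*$ is a chain map $u_*\colon C_*\to C_*$ with all $\Lambda(u_n)$ weak isomorphisms together with a chain homotopy $\gamma_*\colon u_*\simeq0_*$ with $\gamma_n\circ u_n=u_{n+1}\circ\gamma_n$. If $\Lambda(C_* )$ is $L^2$-acyclic, a weak chain contraction exists and $\rho^{(2)}_u(C_* )=[(uc+\gamma)_{\mathrm{odd}}]-[u_{\mathrm{odd}}]\in\widetilde K_1^w(\mathbb ZG)$ (independent of the choice). $\widetilde K_1^{w,\mathrm{ch}}(\mathbb ZG)$ is the abelian group with generators $[C_*]$ for basis-preserving isomorphism classes of finite based free $\mathbb ZG$-chain complexes with $\Lambda(C_* )$ $L^2$-acyclic, and relations: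 $[D_*]=[C_*]+[E_*]$ for each based exact sequence $0\to C_*\to D_*\to E_*\to0$ of such complexes; and $[0\to\mathbb ZG\xrightarrow{\mathrm{id}}\mathbb ZG\to0]=[0\to\mathbb ZG\xrightarrow{-\mathrm{id}}\mathbb ZG\to0]=0$ with the nonzero terms in degrees $n+1$ and $n$, for every $n$. $\widetilde K_1^{\mathrm{ch}}(\mathbb ZG)$ is defined analogously with ''$\Lambda(C_* )$ $L^2$-acyclic'' replaced by ''$C_*$ contractible''. *)

(* Defs.v *)
From HB Require Import structures.
From mathcomp Require Import all_boot all_order all_algebra.
From mathcomp Require Import boolp classical_sets functions reals.
From mathcomp Require Import constructive_ereal ereal esum.
From mathcomp Require Import finmap complex freeg.

Set Implicit Arguments.
Unset Strict Implicit.
Unset Printing Implicit Defensive.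

Import Order.TTheory GRing.Theory Num.Theory.

Local Open Scope classical_set_scope.
Local Open Scope ring_scope.

Section FreegLift.
Variables (K : choiceType).

Lemma freeg_scaleU (x y : int) (k : K) : x *: << y *g k >> = << x * y *g k >>.
Proof.
by apply/eqP/freeg_eqP => z; rewrite coeffZ !coeffU mulrA.
Qed.

Variables (V : lmodType int) (f : K -> V).

HB.instance Definition _ := GRing.isZmodMorphism.Build {freeg K} V (fglift f)
  (lift_is_additive f).

Lemma fglift_add (a b : {freeg K}) : fglift f (a + b) = fglift f a + fglift f b.
Proof. exact: raddfD. Qed.

Lemma fglift0 : fglift f (0 : {freeg K}) = 0.
Proof. exact: raddf0. Qed.

End FreegLift.

Section GroupRing.
Variable G : groupType.

(* multinomials' monoid algebras exclude monoids with nontrivial units. *)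
Definition groupRing : Type := {freeg G}.

HB.instance Definition _ := GRing.Zmodule.on groupRing.

Implicit Types a b c : {freeg G}.

Definition gr_one : {freeg G} := << 1%g >>.

Definition gr_mul a b : {freeg G} :=
  \sum_(g <- dom a) \sum_(h <- dom b)
    << coeff g a * coeff h b *g (g * h)%g >>.

Lemma fglift_sumE (V : lmodType int) (f : G -> V) a :
  fglift f a = \sum_(g <- dom a) coeff g a *: f g.
Proof.
rewrite -[in LHS](freeg_sumE a).
rewrite (big_morph (fglift f) (fglift_add f) (fglift0 f)).
by apply: eq_bigr => g _; rewrite liftU.
Qed.

Let mulE a b :
  gr_mul a b = fglift (fun g => fglift (fun h => << (g * h)%g >>) b) a.
Proof.
rewrite fglift_sumE; apply: eq_bigr => g _.
rewrite fglift_sumE scaler_sumr; apply: eq_bigr => h _.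
by rewrite scalerA freeg_scaleU mulr1.
Qed.

Lemma gr_mulDl : left_distributive gr_mul +%R.
Proof. by move=> a b c; rewrite !mulE fglift_add. Qed.

Lemma gr_mulDr : right_distributive gr_mul +%R.
Proof.
move=> c a b; rewrite !mulE !fglift_sumE -big_split; apply: eq_bigr => g _ /=.
by rewrite fglift_add scalerDr.
Qed.

Lemma gr_mul0l : left_zero 0 gr_mul.
Proof. by move=> a; rewrite mulE fglift0. Qed.

Lemma gr_mul0r : right_zero 0 gr_mul.
Proof.
move=> a; rewrite mulE fglift_sumE big1 // => g _.
by rewrite fglift0 scaler0.
Qed.

Lemma gr_mulUU x y (g h : G) :
  gr_mul << x *g g >> << y *g h >> = << x * y *g (g * h)%g >>.
Proof. by rewrite mulE !liftU !freeg_scaleU mulr1. Qed.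

Lemma gr_mul1l : left_id gr_one gr_mul.
Proof.
move=> a; rewrite mulE liftU scale1r fglift_sumE -[RHS]freeg_sumE.
by apply/eq_bigr=> h _; rewrite mul1g freeg_scaleU mulr1.
Qed.

Lemma gr_mul1r : right_id gr_one gr_mul.
Proof.
move=> a; rewrite mulE fglift_sumE -[RHS]freeg_sumE.
by apply/eq_bigr=> h _; rewrite liftU scale1r mulg1 freeg_scaleU mulr1.
Qed.

Lemma gr_mulA : associative gr_mul.
Proof.
have sumE a : a = \sum_(g <- dom a) << coeff g a *g g >>.
  by rewrite freeg_sumE.
suff: forall m : {freeg G} -> {freeg G} -> {freeg G},
    left_distributive m +%R -> right_distributive m +%R ->
    left_zero 0 m -> right_zero 0 m ->
    (forall x y (g h : G),
       m << x *g g >> << y *g h >> = << x * y *g (g * h)%g >>) ->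
    associative m.
  apply.
  - exact: gr_mulDl.
  - exact: gr_mulDr.
  - exact: gr_mul0l.
  - exact: gr_mul0r.
  - exact: gr_mulUU.
move=> m mDl mDr m0l m0r mUU.
have sumL (r : seq G) (F : G -> {freeg G}) c :
    m (\sum_(i <- r) F i) c = \sum_(i <- r) m (F i) c.
  by apply: (big_morph (m^~ c) (fun _ _ => mDl _ _ _) (m0l c)).
have sumR (r : seq G) (F : G -> {freeg G}) c :
    m c (\sum_(i <- r) F i) = \sum_(i <- r) m c (F i).
  by apply: (big_morph (m c) (fun _ _ => mDr _ _ _) (m0r c)).
move=> a b c; rewrite [a]sumE [b]sumE [c]sumE !sumL.
apply: eq_bigr => g _.
rewrite [in LHS]sumR [X in _ = m X _]sumR sumL; apply: eq_bigr => h _.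
by rewrite !sumR; apply: eq_bigr => k _; rewrite !mUU mulrA mulgA.
Qed.

Lemma gr_one_neq0 : gr_one != 0.
Proof. by rewrite freegU_eq0 oner_eq0. Qed.

HB.instance Definition _ := GRing.Zmodule_isNzRing.Build groupRing
  gr_mulA gr_mul1l gr_mul1r gr_mulDl gr_mulDr gr_one_neq0.

End GroupRing.

Section Quotient.
Variables (V : zmodType) (S : set V).

Inductive subgroup_gen : V -> Prop :=
| subgroup_gen_in x : S x -> subgroup_gen x
| subgroup_gen0 : subgroup_gen 0
| subgroup_genB x y :
    subgroup_gen x -> subgroup_gen y -> subgroup_gen (x - y).

Definition in_subgroup_gen : {pred V} := fun v => `[< subgroup_gen v >].

Lemma in_subgroup_gen_closed : zmod_closed in_subgroup_gen.
Proof.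
split; first by apply/asboolP; exact: subgroup_gen0.
by move=> x y /asboolP hx /asboolP hy; apply/asboolP; exact: subgroup_genB.
Qed.

HB.instance Definition _ :=
  GRing.isZmodClosed.Build V in_subgroup_gen in_subgroup_gen_closed.

Definition quotBy : zmodType := Quotient.quot in_subgroup_gen.

Definition toQuot (v : V) : quotBy := (\pi_(Quotient.quot in_subgroup_gen) v)%qT.

End Quotient.

Definition freeAb (X : Type) : zmodType := {freeg {classic X}}.
Definition freeGen (X : Type) (x : X) : freeAb X := << (x : {classic X}) >>.

Section BasedModules.
Variable R : nzRingType.

(* The basis is unordered: it is indexed by an arbitrary finite type. The
   coordinate function is determined by the basis. *)
Record basedMod := BasedMod {
  bm_sort :> lmodType R;
  bm_idx : finType;
  bm_vec : bm_idx -> bm_sort;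
  bm_coord : bm_sort -> bm_idx -> R;
  bm_sumE : forall x, \sum_b bm_coord x b *: bm_vec b = x;
  bm_coordE : forall c b, bm_coord (\sum_b' c b' *: bm_vec b') b = c b }.

Arguments bm_vec : clear implicits.
Arguments bm_coord : clear implicits.

Definition basis (M : basedMod) : set M := range (bm_vec M).

Arguments basis : clear implicits.

Lemma bm_coordP (M : basedMod) a (x y : M) b :
  bm_coord M (a *: x + y) b = a * bm_coord M x b + bm_coord M y b.
Proof.
rewrite -[in LHS](bm_sumE x) -[in LHS](bm_sumE y) scaler_sumr -big_split /=.
under eq_bigr do rewrite scalerA -scalerDl.
exact: (bm_coordE (fun b => a * bm_coord M x b + bm_coord M y b)).
Qed.

Lemma bm_coord_is_linear (M : basedMod) b :
  linear (bm_coord M ^~ b : M -> R^o).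
Proof. by move=> a x y; exact: bm_coordP. Qed.

Section Std.
Variable n : nat.

Lemma std_sumE (x : 'rV[R]_n) : \sum_b x 0 b *: delta_mx 0 b = x.
Proof. by rewrite [RHS]row_sum_delta. Qed.

Lemma std_coordE (c : 'I_n -> R) b :
  (\sum_b' c b' *: (delta_mx 0 b' : 'rV[R]_n)) 0 b = c b.
Proof.
rewrite summxE (bigD1 b) //= big1 ?addr0 => [|i ib]; rewrite !mxE eqxx /=.
  by rewrite eqxx mulr1.
by rewrite eq_sym (negPf ib) mulr0.
Qed.

Definition stdMod : basedMod := @BasedMod 'rV[R]_n 'I_n
  (fun b => delta_mx 0 b) (fun x b => x 0 b) std_sumE std_coordE.

End Std.

Definition basedIso (M N : basedMod) (f : M -> N) : Prop :=
  bijective f /\ f @` basis M = basis N.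

Definition basedExact (M0 M1 M2 : basedMod) (i : M0 -> M1) (p : M1 -> M2) :
    Prop :=
  [/\ injective i, range i = p @^-1` [set 0], range p = setT,
      i @` basis M0 `<=` basis M1
    & set_bij (basis M1 `\` i @` basis M0) (basis M2) p].

Section DirectSum.
Variables (I : finType) (M : I -> basedMod).

Definition dsum_sort : Type := {dffun forall i, M i}.

HB.instance Definition _ := Choice.on dsum_sort.

Implicit Types x y z : dsum_sort.

Definition dsum_zero : dsum_sort := finfun (fun i => 0 : M i).
Definition dsum_opp x : dsum_sort := finfun (fun i => - (x i)).
Definition dsum_add x y : dsum_sort := finfun (fun i => x i + y i).
Definition dsum_scale (a : R) x : dsum_sort := finfun (fun i => a *: x i).

Lemma dsum_addA : associative dsum_add.
Proof. by move=> x y z; apply/ffunP => i; rewrite !ffunE addrA. Qed.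
Lemma dsum_addC : commutative dsum_add.
Proof. by move=> x y; apply/ffunP => i; rewrite !ffunE addrC. Qed.
Lemma dsum_add0 : left_id dsum_zero dsum_add.
Proof. by move=> x; apply/ffunP => i; rewrite !ffunE add0r. Qed.
Lemma dsum_addN : left_inverse dsum_zero dsum_opp dsum_add.
Proof. by move=> x; apply/ffunP => i; rewrite !ffunE addNr. Qed.

HB.instance Definition _ := GRing.isZmodule.Build dsum_sort
  dsum_addA dsum_addC dsum_add0 dsum_addN.

Lemma dsum_scaleA a b x : dsum_scale a (dsum_scale b x) = dsum_scale (a * b) x.
Proof. by apply/ffunP => i; rewrite !ffunE scalerA. Qed.
Lemma dsum_scale1 : left_id 1 dsum_scale.
Proof. by move=> x; apply/ffunP => i; rewrite !ffunE scale1r. Qed.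
Lemma dsum_scaleDr : right_distributive dsum_scale +%R.
Proof. by move=> a x y; apply/ffunP => i; rewrite !ffunE scalerDr. Qed.
Lemma dsum_scaleDl x : {morph dsum_scale^~ x : a b / a + b}.
Proof. by move=> a b; apply/ffunP => i; rewrite !ffunE scalerDl. Qed.

HB.instance Definition _ := GRing.Zmodule_isLmodule.Build R dsum_sort
  dsum_scaleA dsum_scale1 dsum_scaleDr dsum_scaleDl.

Lemma dsumDE x y i : (x + y) i = x i + y i.
Proof. by rewrite ffunE. Qed.
Lemma dsumZE a x i : (a *: x) i = a *: x i.
Proof. by rewrite ffunE. Qed.
Lemma dsum0E i : (0 : dsum_sort) i = 0.
Proof. by rewrite ffunE. Qed.
Lemma dsum_sumE (J : Type) (r : seq J) (F : J -> dsum_sort) i :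
  (\sum_(j <- r) F j) i = \sum_(j <- r) F j i.
Proof.
by elim/big_ind2: _ => [|x1 x2 y1 y2 <- <-|//]; rewrite (dsum0E, dsumDE).
Qed.

Definition dsum_idx : finType := {i : I & bm_idx (M i)}.

Definition dsum_vec (b : dsum_idx) : dsum_sort :=
  finfun (dfwith (fun i => 0 : M i) (bm_vec (M (tag b)) (tagged b))).

Definition dsum_coord x (b : dsum_idx) : R :=
  bm_coord (M (tag b)) (x (tag b)) (tagged b).

Lemma dsum_combE (c : dsum_idx -> R) i :
  (\sum_b c b *: dsum_vec b) i =
  \sum_(b : bm_idx (M i)) c (Tagged (fun i => bm_idx (M i)) b) *: bm_vec (M i) b.
Proof.
rewrite dsum_sumE.
transitivity (\sum_(j : I) \sum_(b : bm_idx (M j))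
   (c (Tagged (fun i => bm_idx (M i)) b) *:
     dsum_vec (Tagged (fun i => bm_idx (M i)) b)) i).
  rewrite (@sig_big_dep _ _ _ _ (fun j => bm_idx (M j)) xpredT (fun _ => xpredT)
    (fun j b => (c (Tagged (fun i => bm_idx (M i)) b) *:
     dsum_vec (Tagged (fun i => bm_idx (M i)) b)) i)) /=.
  by apply: eq_bigr => -[j b].
rewrite (bigD1 i) //= [X in _ + X]big1 ?addr0 => [|j ji].
  by apply: eq_bigr => b _; rewrite dsumZE ffunE dfwith_in.
by apply: big1 => b _; rewrite dsumZE ffunE dfwith_out ?scaler0.
Qed.

Lemma dsum_bm_sumE x : \sum_b dsum_coord x b *: dsum_vec b = x.
Proof. by apply/ffunP => i; rewrite dsum_combE; exact: (bm_sumE (x i)). Qed.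

Lemma dsum_bm_coordE c b : dsum_coord (\sum_b' c b' *: dsum_vec b') b = c b.
Proof.
rewrite /dsum_coord dsum_combE; case: b => i b /=.
exact: (bm_coordE (fun b => c (Tagged (fun i => bm_idx (M i)) b))).
Qed.

Definition dsum : basedMod := BasedMod dsum_bm_sumE dsum_bm_coordE.

End DirectSum.

Definition dsum_mx (I J : finType) (M : I -> basedMod) (N : J -> basedMod)
    (f : forall i j, M i -> N j) (x : dsum M) : dsum N :=
  finfun (fun j => \sum_i f i j (x i)).

Definition dsum_diag (I : finType) (M N : I -> basedMod)
    (f : forall i, M i -> N i) (x : dsum M) : dsum N :=
  finfun (fun i => f i (x i)).

(* The differential is a family of maps between all pairs of degrees which
   vanishes unless the degree drops by one: this avoids transports along
   equalities between degrees. *)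
Record chainCpx := ChainCpx {
  cc_mod :> int -> basedMod;
  cc_d : forall i j, {linear cc_mod i -> cc_mod j};
  cc_bound : nat;
  cc_shape : forall i j, i != j + 1 -> forall x, cc_d i j x = 0;
  cc_dd : forall i j k x, cc_d j k (cc_d i j x) = 0;
  cc_bounded : forall n : int, (cc_bound < `|n|)%N ->
    forall x : cc_mod n, x = 0 }.

Arguments cc_d : clear implicits.

Definition isChainMap (C D : chainCpx) (f : forall n, C n -> D n) : Prop :=
  forall i j x, f j (cc_d C i j x) = cc_d D i j (f i x).

Definition basedCpxIso (C D : chainCpx) : Prop :=
  exists f : forall n, {linear C n -> D n},
    isChainMap f /\ forall n, basedIso (f n).

Definition basedCpxExact (C D E : chainCpx) : Prop :=
  exists (i : forall n, {linear C n -> D n}) (p : forall n, {linear D n -> E n}),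
    [/\ isChainMap i, isChainMap p & forall n, basedExact (i n) (p n)].

Definition isNullHtpy (C : chainCpx) (h : forall i j, C i -> C j)
    (u : forall n, C n -> C n) : Prop :=
  (forall i j, j != i + 1 -> forall x, h i j x = 0) /\
  (forall n x,
     cc_d C (n + 1) n (h n (n + 1) x) + h (n - 1) n (cc_d C n (n - 1) x) = u n x).

Definition isContraction (C : chainCpx) (h : forall i j, {linear C i -> C j}) :=
  isNullHtpy h (fun n x => x).

Definition contractible (C : chainCpx) : Prop :=
  exists h : forall i j, {linear C i -> C j}, isContraction h.

(* C_(2k) and C_(2k+1) vanish for all k outside [- cc_bound C, cc_bound C], so
   that the direct sums below run over all the even, resp. odd, degrees. *)
Definition cc_range (C : chainCpx) : finType := 'I_(cc_bound C).*2.+1.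
Definition cc_deg (C : chainCpx) (k : cc_range C) : int :=
  (k : nat)%:Z - (cc_bound C)%:Z.
Definition ev_deg (C : chainCpx) (k : cc_range C) : int := 2 * cc_deg k.
Definition odd_deg (C : chainCpx) (k : cc_range C) : int := 2 * cc_deg k + 1.

Definition evPart (C : chainCpx) : basedMod :=
  dsum (fun k : cc_range C => C (ev_deg k)).
Definition oddPart (C : chainCpx) : basedMod :=
  dsum (fun k : cc_range C => C (odd_deg k)).

Definition oddToEv (C : chainCpx) (f : forall i j, C i -> C j) :
    oddPart C -> evPart C :=
  dsum_mx (M := fun k : cc_range C => C (odd_deg k))
    (N := fun l : cc_range C => C (ev_deg l))
    (fun k l => f (odd_deg k) (ev_deg l)).

Definition oddToOdd (C : chainCpx) (u : forall n, C n -> C n) :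
    oddPart C -> oddPart C :=
  dsum_diag (M := fun k : cc_range C => C (odd_deg k))
    (N := fun k : cc_range C => C (odd_deg k))
    (fun k => u (odd_deg k)).

(* [C] is M -f-> N in degrees n + 1 and n, up to basis-preserving isomorphism. *)
Definition isTwoTerm (n : int) (M N : basedMod) (f : M -> N) (C : chainCpx) :
    Prop :=
  exists (a : {linear C (n + 1) -> M}) (b : {linear C n -> N}),
    [/\ basedIso a, basedIso b,
        forall x, f (a x) = b (cc_d C (n + 1) n x)
      & forall m, m != n + 1 -> m != n -> forall x : C m, x = 0].

(* [P] is either "isomorphism" or "weak isomorphism". *)
Section K1.
Variable P : forall M N : basedMod, (M -> N) -> Prop.

Record k1_gen := K1Gen {
  k1_rank : nat;
  k1_map : {linear stdMod k1_rank -> stdMod k1_rank};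
  k1_mapP : P k1_map }.

Definition k1_comp_rel : set (freeAb k1_gen) :=
  [set v | exists (n : nat) (f1 f2 f : {linear stdMod n -> stdMod n})
      (h1 : P f1) (h2 : P f2) (h : P f),
    f =1 f2 \o f1 /\
    v = freeGen (K1Gen h) - (freeGen (K1Gen h1) + freeGen (K1Gen h2))].

(* The block matrix (f0 f1; 0 f2) acts on columns of module elements. *)
Definition k1_block_rel : set (freeAb k1_gen) :=
  [set v | exists (m n : nat) (f0 : {linear stdMod m -> stdMod m})
      (f1 : {linear stdMod n -> stdMod m}) (f2 : {linear stdMod n -> stdMod n})
      (f : {linear stdMod (m + n) -> stdMod (m + n)})
      (h0 : P f0) (h2 : P f2) (h : P f),
    (forall (x : 'rV[R]_m) (y : 'rV[R]_n),
       f (row_mx x y) = row_mx (f0 x + f1 y) (f2 y)) /\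
    v = freeGen (K1Gen h) - (freeGen (K1Gen h0) + freeGen (K1Gen h2))].

Definition K1 : zmodType := quotBy (k1_comp_rel `|` k1_block_rel).
Definition k1_class (g : k1_gen) : K1 := toQuot _ (freeGen g).

Definition k1_minus_id : set K1 :=
  [set x | exists (f : {linear stdMod 1 -> stdMod 1}) (h : P f),
     f =1 -%R /\ x = k1_class (K1Gen h)].

Definition K1t : zmodType := quotBy k1_minus_id.
Definition k1t_class (g : k1_gen) : K1t := toQuot _ (k1_class g).

(* The set of the classes [b \o f] for all the bijections b of bases, where
   endomorphisms of M are identified with endomorphisms of R^n by a
   bijection of bases. *)
Definition k1_value (M N : basedMod) (f : M -> N) : set K1t :=
  [set x | exists (n : nat) (a : {linear stdMod n -> M})
      (b : {linear N -> stdMod n}) (g : {linear stdMod n -> stdMod n}) (h : P g),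
    [/\ basedIso a, basedIso b, g =1 b \o f \o a & x = k1t_class (K1Gen h)]].

End K1.

(* A small skeleton of the finite based free complexes: the complexes with
   chain modules R^n form a type which is small enough to index the generators
   of an abelian group, and they meet every basis-preserving isomorphism
   class. *)
Record stdCpx := StdCpx {
  sc_rank : int -> nat;
  sc_d : forall i j, {linear stdMod (sc_rank i) -> stdMod (sc_rank j)};
  sc_bound : nat;
  sc_shape : forall i j, i != j + 1 -> forall x, sc_d i j x = 0;
  sc_dd : forall i j k x, sc_d j k (sc_d i j x) = 0;
  sc_bounded : forall n : int, (sc_bound < `|n|)%N ->
    forall x : stdMod (sc_rank n), x = 0 }.

Definition cpx_of_std (S : stdCpx) : chainCpx :=
  @ChainCpx (fun n => stdMod (sc_rank S n)) (sc_d S) (sc_bound S)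
    (@sc_shape S) (@sc_dd S) (@sc_bounded S).
Coercion cpx_of_std : stdCpx >-> chainCpx.

(* [Q] is either "contractible" or "L^2-acyclic". *)
Section KCh.
Variable Q : chainCpx -> Prop.

Record kch_gen := KChGen { kch_cpx :> stdCpx; kch_cpxP : Q kch_cpx }.

Definition kch_iso_rel : set (freeAb kch_gen) :=
  [set v | exists C D : kch_gen,
     basedCpxIso C D /\ v = freeGen C - freeGen D].

Definition kch_exact_rel : set (freeAb kch_gen) :=
  [set v | exists C D E : kch_gen,
     basedCpxExact C D E /\ v = freeGen D - (freeGen C + freeGen E)].

Definition kch_elem_rel : set (freeAb kch_gen) :=
  [set v | exists (n : int) (C : kch_gen),
     (isTwoTerm n (fun x : stdMod 1 => x) C \/
      isTwoTerm n (fun x : stdMod 1 => - x) C) /\ v = freeGen C].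

Definition KCh : zmodType :=
  quotBy (kch_iso_rel `|` kch_exact_rel `|` kch_elem_rel).
Definition kch_class (C : kch_gen) : KCh := toQuot _ (freeGen C).

Definition kch_value (C : chainCpx) : set KCh :=
  [set x | exists S : kch_gen, basedCpxIso S C /\ x = kch_class S].

Definition kch_onedim (M N : basedMod) (f : M -> N) : set KCh :=
  [set x | exists S : kch_gen, isTwoTerm 0 f S /\ x = kch_class S].

End KCh.

End BasedModules.

Arguments stdMod : clear implicits.
Arguments basis {R} M _.
Arguments k1_value {R} P [M N] f _.
Arguments kch_value {R} Q C _.
Arguments kch_onedim {R} Q [M N] f _.

Section L2.
Variables (R : realType) (G : groupType).
Local Notation ZG := (groupRing G).
Local Notation based := (basedMod ZG).
Local Notation complexes := (chainCpx ZG).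

Definition l2sqnorm (x : G -> R[i]) : \bar R :=
  (\esum_(g in [set: G]) (complex.Re (x g) ^+ 2 + complex.Im (x g) ^+ 2)%:E)%E.

Definition l2 : set (G -> R[i]) := [set x | (l2sqnorm x < +oo)%E].

(* The right action on L^2(G) extending the right multiplication of ZG on
   itself. *)
Definition l2act (x : G -> R[i]) (a : ZG) : G -> R[i] :=
  fun h => \sum_(g <- dom a) (coeff g a)%:~R * x (h * g^-1)%g.

(* The elements of L^2(G) (x) M are written in the orthogonal decomposition
   into copies of L^2(G) indexed by the basis of M. *)
Definition Lambda (M : based) : set (bm_idx M -> G -> R[i]) :=
  [set x | forall b, l2 (x b)].

Arguments Lambda : clear implicits.

Definition Lambda_sqnorm (M : based) (x : bm_idx M -> G -> R[i]) : \bar R :=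
  (\sum_b l2sqnorm (x b))%E.

Definition Lambda_map (M N : based) (f : M -> N)
    (x : bm_idx M -> G -> R[i]) : bm_idx N -> G -> R[i] :=
  fun c h => \sum_b l2act (x b) (bm_coord (f (bm_vec b)) c) h.

(* The closure for the Hilbert space norm; pointwise-convergence closures of
   function spaces would be too large. *)
Definition Lambda_closure (M : based) (A : set (bm_idx M -> G -> R[i])) :
    set (bm_idx M -> G -> R[i]) :=
  [set x | Lambda M x /\ forall e : R, 0 < e ->
     exists2 y, A y & (Lambda_sqnorm (fun b g => (x b g - y b g)%R) < e%:E)%E].

Definition weakIso (M N : based) (f : M -> N) : Prop :=
  set_inj (Lambda M) (Lambda_map f) /\
  Lambda_closure (Lambda_map f @` Lambda M) = Lambda N.

Definition l2acyclic (C : complexes) : Prop :=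
  forall n : int,
    Lambda (C n) `&` [set x | Lambda_map (cc_d C n (n - 1)) x = fun _ _ => 0]
    `<=` Lambda_closure (Lambda_map (cc_d C (n + 1) n) @` Lambda (C (n + 1))).

Definition isWeakContraction (C : complexes)
    (h : forall i j, {linear C i -> C j}) (u : forall n, {linear C n -> C n}) :
    Prop :=
  [/\ isChainMap u, forall n, weakIso (u n), isNullHtpy h u
    & forall i j x, h i j (u i x) = u j (h i j x)].

End L2.

Arguments Lambda R {G} M _.
Arguments l2acyclic R {G} C.
Arguments weakIso R {G} [M N] f.

Definition isIso (R : nzRingType) (M N : basedMod R) (f : M -> N) : Prop :=
  bijective f.

Section Torsion.
Variables (R : realType) (G : groupType).

Definition K1tZ := K1t (@isIso (groupRing G)).
Definition K1wtZ := K1t (@weakIso R G).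
Definition K1chZ := KCh (@contractible (groupRing G)).
Definition K1wchZ := KCh (@l2acyclic R G).

(* The torsion depends a priori on choices: these are the sets of all its
   values. *)
Definition rho_value (C : chainCpx (groupRing G)) : set K1tZ :=
  [set t | exists h : forall i j, {linear C i -> C j},
     isContraction h /\
     k1_value (@isIso _) (oddToEv (fun i j x => cc_d C i j x + h i j x)) t].

Definition rho2_value (C : chainCpx (groupRing G)) : set K1wtZ :=
  [set t | exists (h : forall i j, {linear C i -> C j})
      (u : forall n, {linear C n -> C n}) (t1 t2 : K1wtZ),
     [/\ isWeakContraction R h u,
         k1_value (@weakIso R G)
           (oddToEv (fun i j x => u j (cc_d C i j x) + h i j x)) t1,
         k1_value (@weakIso R G) (oddToOdd u) t2
       & t = t1 - t2]].

End Torsion.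

(* Main.v *)
Require Import Defs.
From HB Require Import structures.
From mathcomp Require Import all_boot all_order all_algebra all_fingroup.
From mathcomp Require Import boolp classical_sets functions cardinality fsbigop reals.
From mathcomp Require Import constructive_ereal ereal topology normedtype sequences esum.
From mathcomp Require Import finmap complex freeg zify ring lra.
Set Implicit Arguments.
Unset Strict Implicit.
Unset Printing Implicit Defensive.
Import Order.TTheory GRing.Theory Num.Theory numFieldNormedType.Exports.
Local Open Scope classical_set_scope.
Local Open Scope ring_scope.

(* The torsion of a complex depends only on the matrix c of its total differential, which has degree
   -1 and square 0.  Both "contractible" and "L^2-acyclic" mean that there is d of degree 1 with
   d^2 = 0 such that (c + d)^2 is invertible, resp. a weak isomorphism; in the L^2 case one takes
   for d the adjoint matrix c^*, and (c + d)^2 is the Laplacian.  With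
   v = (c + d)^2 the torsion is [(vc + d)_odd] - [v_odd], and two choices of d differ by unipotent
   triangular factors.  Every class of complexes is a sum of classes of 1-dimensional ones: c + d
   changes the degree by 1 or -1 only, so regrading folds the complex into two adjacent degrees
   without changing its class.  Since the torsion of the complex of f is [f], both maps are
   isomorphisms.

   The only analytic input is that an injective matrix over ZG has at least as many columns as rows,
   and that the adjoint of a square injective one is injective.  Instead of the von Neumann
   dimension this uses the regularised equations A^* A k + s^2 k = A^* e_j: as s tends to 0 the
   solutions give sum_j <A k_j, e_j> = sum_i <x_i, e_i>, where x_i tends weakly to e_i, while
   |A k_j - e_j|^2 <= 1 - <A k_j, e_j>. *)

(** * Matrices of based maps *)

(** Two closure properties stand in for inverses: if $ab$ and $ba$ lie in the class then so does
    $a$, which shows that the odd part of $uc+\gamma$ has a class at all; and every $a$ has a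
    partner $b$ with $ab$ and $ba$ in the class, which contracts the complex of $a$. Contractions of
    square zero are singled out because exactly for them the sum of differential and contraction has
    a square of degree 0, and this is what survives regrading. The inverse of the torsion is defined
    on generators; that it respects composition is read off a mapping cone in three degrees. Entries
    in $\mathbb ZG$ have integer coefficients, so matrices act separately on real and imaginary
    parts, and the analysis is done with real functions. Closures are handled by nearest points and
    inner products, without extending the ring of operators. *)

Section Mat.
Variable R : nzRingType.

(** Indexed by arbitrary types instead of ordinals, so that blocks over a sum type and renamings of
    basis elements involve no casts. *)
Definition mat (I J : Type) : Type := I -> J -> R.
HB.instance Definition _ (I J : Type) := GRing.Zmodule.copy (mat I J) (I -> J -> R).

Implicit Types I J K L : finType.

(* Matrices act on row vectors, so [lmx (g \o f) = lmx f ** lmx g]. *)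
Definition mmul I J K (a : mat I J) (b : mat J K) : mat I K :=
  fun i k => \sum_j a i j * b j k.

Definition mone I : mat I I := fun i j => (i == j)%:R.

Arguments mone : clear implicits.

(** Serves two purposes: [inl] and [inr] extract blocks, bijections rename basis elements. *)
Definition mre (I J I' J' : Type) (f : I' -> I) (g : J' -> J) (a : mat I J) : mat I' J' :=
  fun i j => a (f i) (g j).

Local Notation "a ** b" := (mmul a b) (at level 40, left associativity).

Lemma matP (I J : Type) (a b : mat I J) : (forall i j, a i j = b i j) -> a = b.
Proof. by move=> e; apply/funext => i; apply/funext => j. Qed.

Lemma matDE (I J : Type) (a b : mat I J) i j : (a + b) i j = a i j + b i j.
Proof. by []. Qed.

Lemma matNE (I J : Type) (a : mat I J) i j : (- a) i j = - a i j.
Proof. by []. Qed.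

Lemma mat0E (I J : Type) i j : (0 : mat I J) i j = 0.
Proof. by []. Qed.

Definition matE := (matDE, matNE, mat0E).

Lemma mmulE I J K (a : mat I J) (b : mat J K) i k :
  (a ** b) i k = \sum_j a i j * b j k.
Proof. by []. Qed.

Lemma mmulA I J K L (a : mat I J) (b : mat J K) (c : mat K L) :
  a ** (b ** c) = a ** b ** c.
Proof.
apply: matP => i l; rewrite !mmulE.
under eq_bigr do rewrite mmulE mulr_sumr.
rewrite exchange_big /=; apply: eq_bigr => k _; rewrite mmulE mulr_suml.
by apply: eq_bigr => j _; rewrite mulrA.
Qed.

Lemma mmulDl I J K (a b : mat I J) (c : mat J K) : (a + b) ** c = a ** c + b ** c.
Proof.
apply: matP => i k; rewrite matDE !mmulE -big_split /=.
by apply: eq_bigr => j _; rewrite matDE mulrDl.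
Qed.

Lemma mmulDr I J K (c : mat I J) (a b : mat J K) : c ** (a + b) = c ** a + c ** b.
Proof.
apply: matP => i k; rewrite matDE !mmulE -big_split /=.
by apply: eq_bigr => j _; rewrite matDE mulrDr.
Qed.

Lemma mmulNl I J K (a : mat I J) (c : mat J K) : (- a) ** c = - (a ** c).
Proof.
apply: matP => i k; rewrite matNE !mmulE -sumrN.
by apply: eq_bigr => j _; rewrite matNE mulNr.
Qed.

Lemma mmulNr I J K (c : mat I J) (a : mat J K) : c ** (- a) = - (c ** a).
Proof.
apply: matP => i k; rewrite matNE !mmulE -sumrN.
by apply: eq_bigr => j _; rewrite matNE mulrN.
Qed.

Lemma mmul0l I J K (c : mat J K) : (0 : mat I J) ** c = 0.
Proof. by apply: matP => i k; rewrite mmulE big1 // => j _; rewrite mat0E mul0r. Qed.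

Lemma mmul0r I J K (c : mat I J) : c ** (0 : mat J K) = 0.
Proof. by apply: matP => i k; rewrite mmulE big1 // => j _; rewrite mat0E mulr0. Qed.

Lemma mmul1l I J (a : mat I J) : mone I ** a = a.
Proof.
apply: matP => i j; rewrite mmulE (bigD1 i) //= big1 ?addr0 /mone ?eqxx ?mul1r //.
by move=> k ki; rewrite eq_sym (negPf ki) mul0r.
Qed.

Lemma mmul1r I J (a : mat I J) : a ** mone J = a.
Proof.
apply: matP => i j; rewrite mmulE (bigD1 j) //= big1 ?addr0 /mone ?eqxx ?mulr1 //.
by move=> k ki; rewrite (negPf ki) mulr0.
Qed.

Definition mmulE0 := (mmul0l, mmul0r, mmul1l, mmul1r, mmulNl, mmulNr).

Lemma mre_mmul I J K I' J' K' (f : I' -> I) (g : J' -> J) (h : K' -> K)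
    (a : mat I J) (b : mat J K) : bijective g ->
  mre f g a ** mre g h b = mre f h (a ** b).
Proof.
move=> bg; apply: matP => i k; rewrite /mre !mmulE.
by rewrite [RHS](reindex g) //=; apply: onW_bij.
Qed.

Lemma mre_id (I J : Type) (a : mat I J) : mre id id a = a.
Proof. by []. Qed.

Lemma mre_one I I' (f : I' -> I) : injective f -> mre f f (mone I) = mone I'.
Proof. by move=> fi; apply: matP => i j; rewrite /mre /mone (inj_eq fi). Qed.

Lemma mreD (I J I' J' : Type) (f : I' -> I) (g : J' -> J) (a b : mat I J) :
  mre f g (a + b) = mre f g a + mre f g b.
Proof. by []. Qed.

Definition mblk (I1 I2 J1 J2 : Type) (a : mat I1 J1) (b : mat I1 J2) (c : mat I2 J1)
    (d : mat I2 J2) : mat (I1 + I2) (J1 + J2) := fun i j =>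
  match i, j with
  | inl i, inl j => a i j | inl i, inr j => b i j
  | inr i, inl j => c i j | inr i, inr j => d i j end.

Lemma mblk_mmul I1 I2 J1 J2 K1 K2
  (a : mat I1 J1) (b : mat I1 J2) (c : mat I2 J1) (d : mat I2 J2)
  (a' : mat J1 K1) (b' : mat J1 K2) (c' : mat J2 K1) (d' : mat J2 K2) :
  mblk a b c d ** mblk a' b' c' d' =
  mblk (a ** a' + b ** c') (a ** b' + b ** d') (c ** a' + d ** c') (c ** b' + d ** d').
Proof. by apply: matP => -[i|i] [j|j]; rewrite mmulE big_sumType. Qed.

Lemma mblkD (I1 I2 J1 J2 : Type)
  (a : mat I1 J1) (b : mat I1 J2) (c : mat I2 J1) (d : mat I2 J2)
  (a' : mat I1 J1) (b' : mat I1 J2) (c' : mat I2 J1) (d' : mat I2 J2) :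
  mblk a b c d + mblk a' b' c' d' = mblk (a + a') (b + b') (c + c') (d + d').
Proof. by apply: matP => -[i|i] [j|j]. Qed.

Lemma mblkE (I1 I2 J1 J2 : Type) (a : mat (I1 + I2) (J1 + J2)) :
  a = mblk (mre inl inl a) (mre inl inr a) (mre inr inl a) (mre inr inr a).
Proof. by apply: matP => -[i|i] [j|j]. Qed.

Lemma mone_sum I J : mone (I + J)%type = mblk (mone I) 0 0 (mone J).
Proof. by apply: matP => -[i|i] [j|j]. Qed.

Lemma mblk_inj (I1 I2 J1 J2 : Type)
  (a : mat I1 J1) (b : mat I1 J2) (c : mat I2 J1) (d : mat I2 J2)
  (a' : mat I1 J1) (b' : mat I1 J2) (c' : mat I2 J1) (d' : mat I2 J2) :
  mblk a b c d = mblk a' b' c' d' -> [/\ a = a', b = b', c = c' & d = d'].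
Proof.
move=> e; split; apply: matP => i j.
- exact: (congr1 (fun m : mat _ _ => m (inl i) (inl j)) e).
- exact: (congr1 (fun m : mat _ _ => m (inl i) (inr j)) e).
- exact: (congr1 (fun m : mat _ _ => m (inr i) (inl j)) e).
- exact: (congr1 (fun m : mat _ _ => m (inr i) (inr j)) e).
Qed.

End Mat.
Arguments mone {R} I.
Notation "a ** b" := (mmul a b) (at level 40, left associativity) : ring_scope.

(** * Coordinates, matrices of linear maps, bijections of bases *)

Section Coordinates.
Variable R : nzRingType.
Implicit Types M N L : basedMod R.

Lemma bm_coord_inj M (x y : M) : (forall b, bm_coord x b = bm_coord y b) -> x = y.
Proof.
move=> e; rewrite -[x]bm_sumE -[y]bm_sumE; apply: eq_bigr => b _.
by rewrite e.
Qed.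

Lemma bm_coord_vec M (b b' : bm_idx M) : bm_coord (bm_vec b) b' = (b == b')%:R.
Proof.
have -> : bm_vec b = \sum_b' (b == b')%:R *: bm_vec b'.
  rewrite (bigD1 b) //= eqxx scale1r big1 ?addr0 // => c cb.
  by rewrite eq_sym (negPf cb) scale0r.
by rewrite (bm_coordE (fun b' => (b == b')%:R)).
Qed.

Lemma bm_vec_inj M : injective (@bm_vec R M).
Proof.
move=> b b' /(congr1 (fun x => bm_coord x b')); rewrite !bm_coord_vec eqxx.
by case: eqP => // _ /esym /eqP; rewrite oner_eq0.
Qed.

Lemma bm_coord_lin M (I : finType) (a : I -> R) (x : I -> M) b :
  bm_coord (\sum_i a i *: x i) b = \sum_i a i * bm_coord (x i) b.
Proof.
have add (u v : M) : bm_coord (u + v) b = bm_coord u b + bm_coord v b.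
  by rewrite -[u]scale1r bm_coordP mul1r scale1r.
have z : bm_coord (0 : M) b = 0.
  by apply: (addrI (bm_coord (0 : M) b)); rewrite -add !addr0.
rewrite (big_morph (fun x : M => bm_coord x b) add z).
by apply: eq_bigr => i _; rewrite -[a i *: x i]addr0 bm_coordP z addr0.
Qed.

Lemma bm_coord0 M b : bm_coord (0 : M) b = 0.
Proof.
have := bm_coord_lin (fun i : void => 0) (fun i : void => 0 : M) b.
by rewrite !big_pred0.
Qed.

Lemma bm_coordD M (x y : M) b : bm_coord (x + y) b = bm_coord x b + bm_coord y b.
Proof. by rewrite -[x]scale1r bm_coordP mul1r scale1r. Qed.

Definition lmx M N (f : M -> N) : mat R (bm_idx M) (bm_idx N) :=
  fun b c => bm_coord (f (bm_vec b)) c.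

Lemma coord_lin M N (f : {linear M -> N}) x c :
  bm_coord (f x) c = \sum_b bm_coord x b * lmx f b c.
Proof.
rewrite -[in LHS](bm_sumE x) linear_sum.
under eq_bigr do rewrite linearZ.
exact: bm_coord_lin.
Qed.

Definition mx_map M N (a : mat R (bm_idx M) (bm_idx N)) (x : M) : N :=
  \sum_c (\sum_b bm_coord x b * a b c) *: bm_vec c.

Lemma mx_map_linear M N (a : mat R (bm_idx M) (bm_idx N)) : linear (mx_map a).
Proof.
move=> k x y; rewrite /mx_map scaler_sumr -big_split; apply: eq_bigr => c _ /=.
rewrite scalerA -scalerDl; congr (_ *: _).
rewrite mulr_sumr -big_split; apply: eq_bigr => b _ /=.
by rewrite bm_coordP mulrDl mulrA.
Qed.

HB.instance Definition _ M N (a : mat R (bm_idx M) (bm_idx N)) :=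
  GRing.isLinear.Build R M N _ (mx_map a) (mx_map_linear a).

Lemma coord_mx_map M N (a : mat R (bm_idx M) (bm_idx N)) x c :
  bm_coord (mx_map a x) c = \sum_b bm_coord x b * a b c.
Proof. exact: (bm_coordE (fun c => \sum_b bm_coord x b * a b c)). Qed.

Lemma lmx_mx_map M N (a : mat R (bm_idx M) (bm_idx N)) : lmx (mx_map a) = a.
Proof.
apply: matP => b c; rewrite /lmx coord_mx_map.
under eq_bigr do rewrite bm_coord_vec.
exact: (congr1 (fun m : mat _ _ _ => m b c) (mmul1l a)).
Qed.

Lemma lmx_comp M N L (f : {linear M -> N}) (g : {linear N -> L}) :
  lmx (g \o f) = lmx f ** lmx g.
Proof. by apply: matP => b c; rewrite /lmx /= coord_lin. Qed.

Lemma lmx_id M : lmx (fun x : M => x) = mone (bm_idx M).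
Proof. by apply: matP => b c; rewrite /lmx bm_coord_vec. Qed.

Lemma lmx_inj M N (f g : {linear M -> N}) : lmx f = lmx g -> f =1 g.
Proof.
move=> e x; apply: bm_coord_inj => c; rewrite !coord_lin.
by rewrite e.
Qed.

Lemma mx_map_comp M N L (a : mat R (bm_idx M) (bm_idx N))
    (b : mat R (bm_idx N) (bm_idx L)) x :
  mx_map b (mx_map a x) = mx_map (a ** b) x.
Proof.
apply: bm_coord_inj => c; rewrite coord_mx_map.
under eq_bigr do rewrite coord_mx_map.
rewrite coord_mx_map -(mmulE (fun _ : unit => bm_coord x) _ tt).
rewrite mmulA !mmulE; apply: eq_bigr => i _.
by rewrite mmulE.
Qed.

Lemma mx_map1 M x : mx_map (mone (bm_idx M)) x = x :> M.
Proof.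
apply: bm_coord_inj => c; rewrite coord_mx_map.
exact: (congr1 (fun m : mat R unit (bm_idx M) => m tt c) (mmul1r (fun _ => bm_coord x))).
Qed.

Lemma mx_map_vec M N (a : mat R (bm_idx M) (bm_idx N)) b :
  mx_map a (bm_vec b) = \sum_c a b c *: bm_vec c.
Proof.
apply: eq_bigr => c _; congr (_ *: _).
by rewrite -coord_mx_map -/(lmx _ _ _) lmx_mx_map.
Qed.

Definition idxmx (I J : finType) (s : I -> J) : mat R I J := fun i j => (s i == j)%:R.

Lemma mx_map_idx M N (s : bm_idx M -> bm_idx N) b :
  mx_map (idxmx s) (bm_vec b) = bm_vec (s b).
Proof.
rewrite mx_map_vec (bigD1 (s b)) //= /idxmx eqxx scale1r big1 ?addr0 // => c cs.
by rewrite eq_sym (negPf cs) scale0r.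
Qed.

Lemma idxmx_mmul (I J K : finType) (s : I -> J) (a : mat R J K) :
  idxmx s ** a = mre s id a.
Proof.
apply: matP => i k; rewrite mmulE (bigD1 (s i)) //= /idxmx eqxx mul1r big1 ?addr0 // => c cs.
by rewrite eq_sym (negPf cs) mul0r.
Qed.

(** Column $s(j)$ of $bP_s$ is column $j$ of $b$; the form as an equivalence avoids naming the
    inverse of [s]. *)
Lemma mre_idxmx (I J K : finType) (s : J -> K) (a : mat R I K) (b : mat R I J) :
  bijective s -> (b ** idxmx s = a) <-> (b = mre id s a).
Proof.
move=> bs; split=> [<-|->].
  apply: matP => i j; rewrite /mre mmulE (bigD1 j) //= /idxmx eqxx mulr1 big1 ?addr0 // => k kj.
  by rewrite (inj_eq (bij_inj bs)) (negPf kj) mulr0.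
case: bs => t st ts; apply: matP => i k.
rewrite mmulE (bigD1 (t k)) //= /idxmx /mre ts eqxx mulr1 big1 ?addr0 // => j jk.
by case: eqP => [e|_]; [rewrite -e st eqxx in jk | rewrite mulr0].
Qed.

Lemma basedIso_idx M N (f : {linear M -> N}) : basedIso f ->
  exists2 s : bm_idx M -> bm_idx N, bijective s & forall b, f (bm_vec b) = bm_vec (s b).
Proof.
case=> bf /seteqP[im1 im2].
have h b : exists c, f (bm_vec b) = bm_vec c.
  by have [|c _ <-] := im1 (f (bm_vec b)); [exists (bm_vec b) => //; exists b | exists c].
have [s fs] := choice h; exists s => //.
have k c : exists b, s b = c.
  have [|x [b _ <-] e] := im2 (bm_vec c); first by exists c.
  by exists b; apply: (@bm_vec_inj N); rewrite -fs.
have [t st] := choice k; exists t => // b.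
by apply: (@bm_vec_inj M); apply: (bij_inj bf); rewrite !fs st.
Qed.

Lemma idx_basedIso M N (f : {linear M -> N}) (s : bm_idx M -> bm_idx N) :
  bijective s -> (forall b, f (bm_vec b) = bm_vec (s b)) -> basedIso f.
Proof.
move=> [t st ts] fs; split.
  exists (mx_map (idxmx t)) => x.
    rewrite -{2}[x](mx_map1 x).
    have -> : f x = mx_map (idxmx s) x.
      apply: lmx_inj; apply: matP => b c.
      by rewrite lmx_mx_map /lmx fs bm_coord_vec.
    rewrite mx_map_comp idxmx_mmul; congr (mx_map _ x).
    by apply: matP => b c; rewrite /mre /idxmx st.
  have -> : forall y, f y = mx_map (idxmx s) y.
    apply: lmx_inj; apply: matP => b c.
    by rewrite lmx_mx_map /lmx fs bm_coord_vec.
  rewrite -[RHS]mx_map1 mx_map_comp idxmx_mmul; congr (mx_map _ x).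
  by apply: matP => b c; rewrite /mre /idxmx ts.
apply/seteqP; split=> [_ [_ [b _ <-] <-]|_ [c _ <-]].
  by exists (s b).
by exists (bm_vec (t c)); [exists (t c)|rewrite fs ts].
Qed.

End Coordinates.
Arguments idxmx R {I J} s _ _.

Local Notation "a ** b" := (mmul a b) (at level 40, left associativity).

(** * Classes of matrices in K_1 *)

Section Presentations.

Lemma toQuotD (V : zmodType) (S : set V) : {morph @toQuot V S : x y / x + y}.
Proof. by move=> x y; exact: Quotient.pi_add. Qed.

Lemma toQuotB (V : zmodType) (S : set V) : {morph @toQuot V S : x y / x - y}.
Proof.
move=> x y; rewrite toQuotD; congr (_ + _).
exact: Quotient.pi_opp.
Qed.

Lemma toQuot_eq (V : zmodType) (S : set V) x y :
  (toQuot S x == toQuot S y) = (x - y \in in_subgroup_gen S).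
Proof. by rewrite /toQuot -Quotient.idealrBE. Qed.

Lemma toQuot_rel (V : zmodType) (S : set V) x y : S (x - y) -> toQuot S x = toQuot S y.
Proof.
by move=> h; apply/eqP; rewrite toQuot_eq; apply/asboolP; apply: subgroup_gen_in.
Qed.

Lemma toQuot0 (V : zmodType) (S : set V) : toQuot S 0 = 0.
Proof. by rewrite -(subrr (0 : V)) toQuotB subrr. Qed.

Lemma toQuot_surj (V : zmodType) (S : set V) (q : quotBy S) : exists v, q = toQuot S v.
Proof. by exists (generic_quotient.repr (q : Quotient.quot (in_subgroup_gen S))); rewrite /toQuot reprK. Qed.

Lemma quot_lift (V W : zmodType) (S : set V) (phi : {additive V -> W}) :
  (forall s, S s -> phi s = 0) ->
  exists psi : {additive quotBy S -> W}, forall v, psi (toQuot S v) = phi v.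
Proof.
move=> h.
have hS v : subgroup_gen S v -> phi v = 0.
  by elim=> [s /h //||x y _ hx _ hy]; rewrite ?raddf0 // raddfB hx hy subrr.
pose f (q : quotBy S) := phi (generic_quotient.repr (q : Quotient.quot (in_subgroup_gen S))).
have fE v : f (toQuot S v) = phi v.
  apply/eqP; rewrite -subr_eq0 /f -raddfB; apply/eqP; apply: hS.
  have : toQuot S (generic_quotient.repr (toQuot S v : Quotient.quot (in_subgroup_gen S))) == toQuot S v by rewrite /toQuot reprK.
  by rewrite toQuot_eq => /asboolP.
have fB : zmod_morphism f.
  move=> x y; have [u ->] := toQuot_surj x; have [v ->] := toQuot_surj y.
  by rewrite -toQuotB !fE raddfB.
pose F : {additive quotBy S -> W} := HB.pack f (GRing.isZmodMorphism.Build _ _ f fB).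
by exists F.
Qed.

Lemma free_lift (X : Type) (W : zmodType) (f : X -> W) :
  exists phi : {additive freeAb X -> W}, forall x, phi (freeGen x) = f x.
Proof.
pose g : {classic X} -> zmodule W := f.
pose phi (v : freeAb X) : W := fglift g v.
have phiB : zmod_morphism phi by exact: (lift_is_additive g).
pose F : {additive freeAb X -> W} := HB.pack phi (GRing.isZmodMorphism.Build _ _ phi phiB).
exists F => x; rewrite /= /phi /freeGen liftU.
exact: (scale1r (g x)).

Qed.

Lemma free_ind (X : Type) (p : freeAb X -> Prop) : p 0 ->
  (forall v w, p v -> p w -> p (v - w)) -> (forall x, p (freeGen x)) -> forall v, p v.
Proof.
move=> p0 pB pX.
have pN v : p v -> p (- v) by move=> pv; rewrite -[- v]add0r; apply: pB.
have pD v w : p v -> p w -> p (v + w).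
  by move=> pv pw; rewrite -[w]opprK; apply: pB => //; apply: pN.
have pn n v : p v -> p (v *+ n).
  by move=> pv; elim: n => [|n ih]; rewrite ?mulr0n // mulrS; apply: pD.
move=> v; rewrite -(freeg_sumE v); apply: (big_ind p) => // x _.
have -> : << coeff x v *g x >> = (freeGen x) *~ (coeff x v).
  by rewrite /freeGen; apply/eqP/freeg_eqP => z; rewrite -scaler_int coeffZ !coeffU mul1r intz.
by case: (coeff x v) => n; rewrite ?NegzE ?mulrNz; [|apply: pN]; apply: (pn _ _ (pX x)).
Qed.

End Presentations.

(* The properties shared by the invertible matrices and the matrices of weak isomorphisms: the
   theorem is proved once for an arbitrary such class. *)
Record good_class (R : nzRingType) (Pm : forall I J : finType, mat R I J -> Prop) : Prop := {
  gc_card : forall (I J : finType) (a : mat R I J), Pm I J a -> #|I| = #|J|;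
  gc_one : forall I : finType, Pm I I (mone I);
  gc_mul : forall (I J K : finType) (a : mat R I J) (b : mat R J K),
    Pm _ _ a -> Pm _ _ b -> Pm _ _ (a ** b);
  gc_re : forall (I J I' J' : finType) (f : I' -> I) (g : J' -> J) (a : mat R I J),
    bijective f -> bijective g -> Pm _ _ a -> Pm _ _ (mre f g a);
  gc_blk : forall (I J I' J' : finType) (a : mat R I I') (b : mat R J J') (x : mat R J I'),
    Pm _ _ a -> Pm _ _ b -> Pm (I + J)%type (I' + J')%type (mblk a 0 x b);
  gc_diag : forall (I J : finType) (a : mat R I I) (b : mat R J J),
    Pm (I + J)%type (I + J)%type (mblk a 0 0 b) -> Pm _ _ a /\ Pm _ _ b;
  gc_sq : forall (I J : finType) (a : mat R I J) (b : mat R J I),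
    Pm _ _ (a ** b) -> Pm _ _ (b ** a) -> Pm _ _ a;
  gc_dual : forall (I J : finType) (a : mat R I J), Pm _ _ a ->
    exists b : mat R J I, Pm _ _ (a ** b) /\ Pm _ _ (b ** a) }.

Section GoodClass.
Variables (R : nzRingType) (Pm : forall I J : finType, mat R I J -> Prop).
Hypothesis gc : good_class Pm.

Lemma gc_re_inv (I J I' J' : finType) (f : I' -> I) (g : J' -> J) (a : mat R I J) :
  bijective f -> bijective g -> Pm (mre f g a) -> Pm a.
Proof.
move=> [f' ff f'f] [g' gg g'g] h.
have -> : a = mre f' g' (mre f g a) by apply: matP => i j; rewrite /mre f'f g'g.
by apply: (gc_re gc) => //; [exists f | exists g].
Qed.

(** Since $(-1)(-1)=1$ lies in the class, [gc_sq] with both factors $-1$ applies. *)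
Lemma gc_opp (I : finType) : Pm (- mone I : mat R I I).
Proof.
by apply: (gc_sq gc (b := - mone I)); rewrite mmulNl mmulNr mmul1l opprK; apply: (gc_one gc).
Qed.

End GoodClass.

Section K1.
Variables (R : nzRingType).
Variable P : forall M N : basedMod R, (M -> N) -> Prop.
Variable Pm : forall I J : finType, mat R I J -> Prop.
Hypothesis gc : good_class Pm.
Hypothesis PE : forall (M N : basedMod R) (f : {linear M -> N}), P f <-> Pm (lmx f).

Local Notation K := (K1t P).
Local Notation smap n a := (@mx_map R (stdMod R n) (stdMod R n) a).

Lemma P_mx n (a : mat R 'I_n 'I_n) : Pm a -> P (smap n a).
Proof. by move=> h; apply: (proj2 (PE _)); rewrite lmx_mx_map. Qed.

(** Totalised by 0 outside [Pm], so that matrix identities can be rewritten inside it without the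
    membership proof that [K1Gen] demands. *)
Definition ordclass n (a : mat R 'I_n 'I_n) : K :=
  match pselect (Pm a) with
  | left h => k1t_class (K1Gen (P_mx h)) | right _ => 0 end.

Lemma ordclassE n (a : mat R 'I_n 'I_n) (h : P (smap n a)) : ordclass a = k1t_class (K1Gen h).
Proof.
rewrite /ordclass; case: pselect => [h'|[]]; last by move/PE: h; rewrite lmx_mx_map.
by congr (k1t_class (K1Gen _)); apply: Prop_irrelevance.
Qed.

Lemma k1_class_mul n (f1 f2 f : {linear stdMod R n -> stdMod R n})
   (h1 : P f1) (h2 : P f2) (h : P f) : f =1 f2 \o f1 ->
   k1t_class (K1Gen h) = k1t_class (K1Gen h1) + k1t_class (K1Gen h2).
Proof.
move=> e; rewrite /k1t_class -toQuotD; congr (toQuot _ _).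
rewrite /k1_class -toQuotD; apply: toQuot_rel; left.
by exists n, f1, f2, f, h1, h2, h.
Qed.

(** Linear maps that agree pointwise may still be different records, hence different generators. The
    relation for the composite of [g] with the identity, whose class is 0, identifies them. *)
Lemma k1_class_eq n (f g : {linear stdMod R n -> stdMod R n}) (hf : P f) (hg : P g) :
  f =1 g -> k1t_class (K1Gen hf) = k1t_class (K1Gen hg).
Proof.
move=> e.
have h1 : P (smap n (mone 'I_n)) by apply: P_mx; apply: (gc_one gc).
have e1 : k1t_class (K1Gen h1) = 0.
  apply: (addrI (k1t_class (K1Gen h1))); rewrite addr0.
  by rewrite -(k1_class_mul h1 h1 h1) // => x /=; rewrite !mx_map1.
rewrite (k1_class_mul hg h1 hf) ?e1 ?addr0 // => x.
by rewrite /= mx_map1 e.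
Qed.

Lemma ordclass_class (g : k1_gen P) : k1t_class g = ordclass (lmx (k1_map g)).
Proof.
case: g => n f h /=.
have h' : P (smap n (lmx f)) by apply: P_mx; exact: (proj1 (PE _) h).
rewrite (ordclassE h'); apply: k1_class_eq; apply: lmx_inj.
by rewrite lmx_mx_map.
Qed.

Lemma ordclass_mul n (a b : mat R 'I_n 'I_n) : Pm a -> Pm b -> ordclass (a ** b) = ordclass a + ordclass b.
Proof.
move=> ha hb; have hab := gc_mul gc ha hb.
rewrite (ordclassE (P_mx ha)) (ordclassE (P_mx hb)) (ordclassE (P_mx hab)).
by apply: k1_class_mul => x; rewrite /= mx_map_comp.
Qed.

Lemma ordclass_one n : ordclass (mone 'I_n) = 0.
Proof.
have h := gc_one gc 'I_n.
by apply: (addrI (ordclass (mone 'I_n))); rewrite addr0 -ordclass_mul ?mmul1l.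
Qed.

Lemma ordclass_opp1 : ordclass (- mone 'I_1) = 0.
Proof.
have h := P_mx (gc_opp gc 'I_1).
rewrite (ordclassE h) -(toQuot0 (@k1_minus_id R P)); apply: toQuot_rel; rewrite subr0.
exists (smap 1 (- mone 'I_1)), h; split=> // x.
apply: (@bm_coord_inj R (stdMod R 1)) => c; rewrite coord_mx_map.
transitivity (- (x 0 c)); last by rewrite /= !mxE.
rewrite big_ord1 !ord1 /= matNE /mone eqxx mulrN mulr1.
by [].
Qed.

Lemma split_bij m n : bijective (@fintype.split m n).
Proof. by exists (@unsplit m n); [exact: splitK | exact: unsplitK]. Qed.

(** Because matrices act on rows, the upper right entry $f_1$ of the block relation sits at the
    lower left here. *)
Lemma ordclass_blk m n (a : mat R 'I_m 'I_m) (b : mat R 'I_n 'I_n) x :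
  Pm a -> Pm b ->
  ordclass (mre (@fintype.split m n) (@fintype.split m n) (mblk a 0 x b)) = ordclass a + ordclass b.
Proof.
move=> ha hb.
have hab := gc_re gc (split_bij m n) (split_bij m n) (gc_blk gc x ha hb).
rewrite (ordclassE (P_mx ha)) (ordclassE (P_mx hb)) (ordclassE (P_mx hab)).
rewrite /k1t_class -toQuotD; congr (toQuot _ _).
rewrite /k1_class -toQuotD; apply: toQuot_rel; right.
exists m, n, (smap m a), (@mx_map R (stdMod R n) (stdMod R m) x), (smap n b).
exists (smap (m + n) (mre (@fintype.split m n) (@fintype.split m n) (mblk a 0 x b))).
exists (P_mx ha), (P_mx hb), (P_mx hab); split=> // u v.
have E k l (p : mat R 'I_k 'I_l) (w : 'rV[R]_k) c :
    (@mx_map R (stdMod R k) (stdMod R l) p w : 'rV_l) 0 c = \sum_b w 0 b * p b c.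
  exact: (@coord_mx_map R (stdMod R k) (stdMod R l)).
apply/rowP => c; rewrite E big_split_ord /=.
under eq_bigr do rewrite row_mxEl /mre (unsplitK (inl _)).
under [X in _ + X]eq_bigr do rewrite row_mxEr /mre (unsplitK (inr _)).
rewrite mxE; case: fintype.split => c' /=; rewrite ?mxE !E //.
by rewrite big1 ?add0r // => i _; rewrite mulr0.
Qed.

Definition pm n (s : 'S_n) : mat R 'I_n 'I_n := idxmx R s.

Lemma Pm_idx (I J : finType) (s : I -> J) : bijective s -> Pm (idxmx R s).
Proof.
move=> bs; suff -> : idxmx R s = mre s id (mone J).
  by apply: (gc_re gc) => //; [exists id | exact: (gc_one gc)].
by rewrite -idxmx_mmul mmul1r.
Qed.

Lemma perm_bij n (s : 'S_n) : bijective s.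
Proof. by exists (s^-1)%g => i; rewrite ?permK ?permKV. Qed.

Lemma pmM n (s t : 'S_n) : pm (s * t)%g = pm s ** pm t.
Proof. by rewrite /pm idxmx_mmul; apply: matP => i j; rewrite /mre /idxmx permM. Qed.

Lemma ordclass_pmM n (s t : 'S_n) : ordclass (pm (s * t)%g) = ordclass (pm s) + ordclass (pm t).
Proof. by rewrite pmM ordclass_mul //; apply: Pm_idx; apply: perm_bij. Qed.

Lemma pm1 n : pm (1%g : 'S_n) = mone _.
Proof. by apply: matP => i j; rewrite /pm /idxmx perm1. Qed.

Lemma ordclass_pmJ n (s t : 'S_n) : ordclass (pm (s ^ t)%g) = ordclass (pm s).
Proof.
rewrite /conjg !ordclass_pmM addrCA.
by rewrite -ordclass_pmM mulVg pm1 ordclass_one addr0.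
Qed.

(** The swap is a product of three elementary matrices and $\mathrm{diag}(-1,1)$; the class of the
    last factor vanishes in the quotient by $[-\mathrm{id}]$. *)
Lemma ordclass_swap2 : ordclass (mre (@fintype.split 1 1) (@fintype.split 1 1)
   (mblk 0 (mone _) (mone _) 0)) = 0.
Proof.
set sp := @fintype.split 1 1; have bsp : bijective sp := split_bij 1 1.
pose e : mat R 'I_1 'I_1 := mone _.
have h1 : Pm e := gc_one gc _.
have hN : Pm (- e) := gc_opp gc _.
pose w := mblk 0 e e 0; pose l x := mblk e 0 x e; pose u x := mblk e x 0 e.
have Pw : Pm w.
  apply: (gc_sq gc (b := w)); rewrite /w mblk_mmul !mmulE0 !addr0 !add0r;
  by rewrite -[mblk _ _ _ _]mone_sum; apply: (gc_one gc).
have kM a b : Pm a -> Pm b -> ordclass (mre sp sp (a ** b)) = ordclass (mre sp sp a) + ordclass (mre sp sp b).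
  by move=> ha hb; rewrite -(mre_mmul _ _ _ _ bsp) ordclass_mul //; apply: (gc_re gc).
have Pl x : Pm (l x) by apply: (gc_blk gc).
have kl x : ordclass (mre sp sp (l x)) = 0 by rewrite ordclass_blk // ordclass_one addr0.
have kww : ordclass (mre sp sp w) + ordclass (mre sp sp w) = 0.
  rewrite -kM // /w mblk_mmul !mmulE0 !addr0 !add0r -mone_sum mre_one ?ordclass_one //.
  exact: bij_inj.
(* The block relation gives the class of lower triangular matrices only. Conjugation by the swap
   yields the upper ones, and the two copies of $[w]$ cancel by [kww]. *)
have ue x : u x = w ** l x ** w.
  by rewrite /u /w /l !mblk_mmul !mmulE0 !addr0 !add0r.
have Pu x : Pm (u x) by rewrite ue; do 2! apply: (gc_mul gc) => //.
have ku x : ordclass (mre sp sp (u x)) = 0.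
  rewrite ue kM ?kM // ?kl ?addr0 //; exact: (gc_mul gc).
have -> : mblk 0 (mone _) (mone _) 0 = u e ** l (- e) ** u e ** mblk (- e) 0 0 e.
  by rewrite /u /l /e !mblk_mmul !(mmulE0, addr0, add0r, subrr, addNr, oppr0, opprK).
have Pd : Pm (mblk (- e) 0 0 e) by apply: (gc_blk gc).
rewrite kM ?kM ?ku ?kl //; try by do ?apply: (gc_mul gc).
by rewrite !addr0 add0r ordclass_blk // ordclass_one ordclass_opp1 addr0.
Qed.

(** A permutation is a product of transpositions. The class is invariant under conjugation, so each
    transposition may be moved to the first two indices, where its matrix is the swap plus an
    identity block. *)
Lemma ordclass_pm n (s : 'S_n) : ordclass (pm s) = 0.
Proof.
have [ts -> /allP dts] := prod_tpermP s.
elim: ts dts => [|[i j] ts ih] dts; first by rewrite big_nil pm1 ordclass_one.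
rewrite big_cons ordclass_pmM ih ?addr0; last by move=> t tts; apply: dts; rewrite inE tts orbT.
have /= ij := dts (i, j) (mem_head _ _).
move: i j ij {s ts ih dts}; case: n => [[]//|[|n]] i j ij.
  by move: ij; rewrite /dpair /= !ord1.
pose o0 : 'I_(1 + (1 + n)) := lshift _ ord0.
pose o1 : 'I_(1 + (1 + n)) := rshift 1 (lshift n ord0).
have o01 : o0 != o1 by [].
rewrite -(ordclass_pmJ _ (tperm i o0)) tpermJ tpermL.
set j' := tperm i o0 j.
have j'0 : j' != o0.
  by rewrite /j' -(inj_eq (@perm_inj _ (tperm i o0))) tpermK tpermR eq_sym.
rewrite -(ordclass_pmJ _ (tperm j' o1)) tpermJ tpermL tpermD //.
set sp2 := @fintype.split 1 1; set sp := @fintype.split (1 + 1) n.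
have -> : pm (tperm o0 o1) = mre sp sp (mblk (mre sp2 sp2 (mblk 0 (mone _) (mone _) 0)) 0 0 (mone _)).
  apply: matP => p q; rewrite /pm /idxmx /mre /sp /sp2.
  have key (r : 'I_(1 + (1 + n))) : r = o0 \/ r = o1 \/ exists k : 'I_n, r = rshift 2 k :> nat.
    case: r => -[|[|r]] lr; first by left; apply: val_inj.
      by right; left; apply: val_inj.
    have lr' : (r < n)%N by [].
    by right; right; exists (Ordinal lr').
  have s0 : fintype.split (m := 2) (n := n) o0 = inl (lshift 1 (ord0 : 'I_1)).
    by rewrite -[RHS](unsplitK (inl _)); congr fintype.split; apply: val_inj.
  have s1 : fintype.split (m := 2) (n := n) o1 = inl (rshift 1 (ord0 : 'I_1)).
    by rewrite -[RHS](unsplitK (inl _)); congr fintype.split; apply: val_inj.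
  have s2 (r : 'I_(1 + (1 + n))) (k : 'I_n) : r = rshift 2 k :> nat ->
      fintype.split (m := 2) (n := n) r = inr k.
    by move=> e; rewrite -[RHS](unsplitK (inr _)); congr fintype.split; apply: val_inj.
  have t0 (r : 'I_(1 + (1 + n))) (k : 'I_n) : r = rshift 2 k :> nat ->
      (o0 != r) /\ (o1 != r).
    by move=> e; split; apply/eqP => /(congr1 val) /=; rewrite e.
  have [->|[->|[k ek]]] := key p; have [->|[->|[l el]]] := key q;
    rewrite ?s0 ?s1 ?(s2 _ _ ek) ?(s2 _ _ el) /= ?tpermL ?tpermR ?(unsplitK (inl _)) ?(unsplitK (inr _)) /= ?eqxx //.
  - by rewrite (negPf (t0 _ _ el).2).
  - by rewrite (negPf (t0 _ _ el).1).
  - by rewrite tpermD ?(t0 _ _ ek).1 ?(t0 _ _ ek).2 // eq_sym (negPf (t0 _ _ ek).1).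
  - by rewrite tpermD ?(t0 _ _ ek).1 ?(t0 _ _ ek).2 // eq_sym (negPf (t0 _ _ ek).2).
  - rewrite tpermD ?(t0 _ _ ek).1 ?(t0 _ _ ek).2 // /mone.
    by congr (_%:R); congr nat_of_bool; rewrite -!val_eqE /= ek el.
have Psw : Pm (mre sp2 sp2 (mblk 0 (mone _) (mone _) 0) : mat R 'I_2 'I_2).
  apply: (gc_re gc); try exact: split_bij.
  apply: (gc_sq gc (b := mblk 0 (mone _) (mone _) 0)); rewrite mblk_mmul !mmulE0 !addr0 !add0r;
    by rewrite -[mblk _ _ _ _]mone_sum; apply: (gc_one gc).
apply: etrans (ordclass_blk _ Psw (gc_one gc _)) _.
by rewrite ordclass_swap2 ordclass_one addr0.
Qed.

End K1.

Lemma inj_surj_bij (A B : Type) (f : A -> B) :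
  injective f -> (forall y, exists x, f x = y) -> bijective f.
Proof.
by move=> fi /choice[g gE]; exists g => // x; apply: fi; rewrite gE.
Qed.

Section SubSplit.
Variables (I : finType) (p : pred I).
Definition sub_split (x : {i | p i} + {i | ~~ p i}) : I :=
  match x with inl i => val i | inr i => val i end.

Lemma sub_split_bij : bijective sub_split.
Proof.
apply: inj_surj_bij => [[[i hi]|[i hi]] [[j hj]|[j hj]]|i] /=.
- by move=> e; congr inl; apply: val_inj.
- by move=> e; case/negP: (hj); rewrite -e.
- by move=> e; case/negP: (hi); rewrite e.
- by move=> e; congr inr; apply: val_inj.
- case: (boolP (p i)) => h; first by exists (inl (exist _ i h)).
  by exists (inr (exist _ i h)).
Qed.
End SubSplit.

(** * Classes of matrices between arbitrary finite index sets *)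

Section Kap.
Variables (R : nzRingType).
Variable P : forall M N : basedMod R, (M -> N) -> Prop.
Variable Pm : forall I J : finType, mat R I J -> Prop.
Hypothesis gc : good_class Pm.
Hypothesis PE : forall (M N : basedMod R) (f : {linear M -> N}), P f <-> Pm (lmx f).

Local Notation K := (K1t P).
Local Notation ordclass := (ordclass PE).

(** Reindexing multiplies by permutation matrices, whose classes vanish. *)
Lemma ordclass_re n (s t : 'I_n -> 'I_n) (a : mat R 'I_n 'I_n) : bijective s -> bijective t ->
  Pm a -> ordclass (mre s t a) = ordclass a.
Proof.
move=> bs bt ha.
have kidx (r : 'I_n -> 'I_n) : bijective r -> ordclass (idxmx R r) = 0.
  move=> br; rewrite -(ordclass_pm gc PE (perm (bij_inj br))); congr ordclass.
  by apply: matP => i j; rewrite /pm /idxmx permE.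
have h : mre s t a ** idxmx R t = idxmx R s ** a.
  by apply/(mre_idxmx _ _ bt); rewrite idxmx_mmul.
have : ordclass (mre s t a ** idxmx R t) = ordclass (idxmx R s ** a) by rewrite h.
rewrite !(ordclass_mul gc PE) ?kidx ?addr0 ?add0r //; try exact: Pm_idx.
exact: gc_re.
Qed.

(* The class of a matrix between arbitrary index sets; the junk value [0] of [xget] is never used for
   matrices in [Pm]. *)
Definition mxclass (I J : finType) (a : mat R I J) : K :=
  xget 0 [set x | exists n (f : 'I_n -> I) (g : 'I_n -> J),
    [/\ bijective f, bijective g & x = ordclass (mre f g a)]].

Lemma mxclass_eq n (I J : finType) (a : mat R I J) (f : 'I_n -> I) (g : 'I_n -> J) :
  Pm a -> bijective f -> bijective g -> mxclass a = ordclass (mre f g a).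
Proof.
move=> ha bf bg; rewrite /mxclass; set S := [set x | _].
have [] : S (xget 0 S) by apply: xgetPex; exists (ordclass (mre f g a)), n, f, g.
move=> n' [f' [g' [bf' bg' ->]]].
have nn : n' = n.
  by rewrite -[n']card_ord -[n]card_ord (bij_eq_card bf') (bij_eq_card bf).
subst n'; case: bf => fi ff fif; case: bg => gi gg gig.
have -> : mre f' g' a = mre (fi \o f') (gi \o g') (mre f g a).
  by apply: matP => i j; rewrite /mre /= fif gig.
rewrite ordclass_re //.
- by apply: bij_comp => //; exists f.
- by apply: bij_comp => //; exists g.
- by apply: gc_re => //; [exists fi | exists gi].
Qed.

Lemma bij_ord (I J : finType) : #|I| = #|J| -> exists f : 'I_#|I| -> J, bijective f.
Proof.
move=> e; exists (fun i => enum_val (cast_ord e i)).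
exists (fun j => cast_ord (esym e) (enum_rank j)) => x.
  by rewrite enum_valK cast_ordK.
by rewrite cast_ordKV enum_rankK.
Qed.

Lemma mxclass_ord n (a : mat R 'I_n 'I_n) : Pm a -> mxclass a = ordclass a.
Proof. by move=> ha; rewrite (mxclass_eq (f := id) (g := id)) //; exists id. Qed.

Lemma mxclass_re (I J I' J' : finType) (f : I' -> I) (g : J' -> J) (a : mat R I J) :
  bijective f -> bijective g -> Pm a -> mxclass (mre f g a) = mxclass a.
Proof.
move=> bf bg ha.
have e := gc_card gc ha; have [k bk] := bij_ord e.
have [h bh] := @bij_ord I I erefl.
case: (bf) (bg) => fi ff fif [gi gg gig].
rewrite (mxclass_eq ha bh bk) (@mxclass_eq _ _ _ _ (fi \o h) (gi \o k)); first last.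
- by apply: bij_comp => //; exists g.
- by apply: bij_comp => //; exists f.
- exact: gc_re.
by congr ordclass; apply: matP => i j; rewrite /mre /= fif gig.
Qed.

Lemma mxclass_mul (I J L : finType) (a : mat R I J) (b : mat R J L) : Pm a -> Pm b ->
  mxclass (a ** b) = mxclass a + mxclass b.
Proof.
move=> ha hb.
have e := gc_card gc ha; have [k bk] := bij_ord e.
have e' := gc_card gc hb; have [l bl] := bij_ord (etrans e e').
have [h bh] := @bij_ord I I erefl.
rewrite (mxclass_eq ha bh bk) (mxclass_eq hb bk bl) (mxclass_eq (gc_mul gc ha hb) bh bl).
by rewrite -(mre_mmul _ _ _ _ bk) ordclass_mul //; apply: gc_re.
Qed.

Lemma mxclass_one (I : finType) : mxclass (mone I) = 0.
Proof.
have h := gc_one gc I.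
by apply: (addrI (mxclass (mone I))); rewrite addr0 -mxclass_mul ?mmul1l.
Qed.

Lemma sum_bij (I J I' J' : Type) (f : I -> I') (g : J -> J') : bijective f -> bijective g ->
  bijective (fun x : I + J => match x with inl i => inl (f i) | inr j => inr (g j) end : I' + J').
Proof.
move=> [fi ff fif] [gi gg gig].
exists (fun x : I' + J' => match x with inl i => inl (fi i) | inr j => inr (gi j) end).
  by case=> x; rewrite ?ff ?gg.
by case=> x; rewrite ?fif ?gig.
Qed.

Lemma mxclass_blk (I I' J J' : finType) (a : mat R I I') (b : mat R J J') (x : mat R J I') :
  Pm a -> Pm b -> mxclass (mblk a 0 x b) = mxclass a + mxclass b.
Proof.
move=> ha hb.
have [k bk] := bij_ord (gc_card gc ha); have [l bl] := bij_ord (gc_card gc hb).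
have [h bh] := @bij_ord I I erefl; have [m bm] := @bij_ord J J erefl.
rewrite (mxclass_eq ha bh bk) (mxclass_eq hb bm bl) -(@ordclass_blk _ _ _ gc PE _ _ _ _ (mre m k x)) //; try exact: gc_re.
rewrite -(mxclass_re (sum_bij bh bm) (sum_bij bk bl)); last exact: gc_blk.
rewrite -(mxclass_re (split_bij _ _) (split_bij _ _)); last first.
  by apply: gc_re => //; try exact: sum_bij; apply: gc_blk.
have -> : mre (fun x => match x with inl i => inl (h i) | inr j => inr (m j) end)
    (fun x => match x with inl i => inl (k i) | inr j => inr (l j) end) (mblk a 0 x b) =
    mblk (mre h k a) 0 (mre m k x) (mre m l b).
  by apply: matP => -[i|i] [j|j].
rewrite mxclass_ord //; apply: gc_re => //; try exact: split_bij.
by apply: gc_blk => //; apply: gc_re.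
Qed.

Lemma mxclass_opp1 : mxclass (- mone unit) = 0.
Proof.
have b1 : bijective (fun _ : 'I_1 => tt).
  by apply: inj_surj_bij => [x y _|[]]; [rewrite [x]ord1 [y]ord1 | exists ord0].
rewrite (mxclass_eq (gc_opp gc _) b1 b1) -(ordclass_opp1 gc PE); congr ordclass.
by apply: matP => i j; rewrite /mre !matNE !ord1.
Qed.

Lemma mxclass_opp (I : finType) : mxclass (- mone I) = 0.
Proof.
suff H n : mxclass (- mone 'I_n) = 0.
  have [h bh] := @bij_ord I I erefl.
  rewrite -(mxclass_re bh bh (gc_opp gc _)) -[RHS](H #|I|); congr mxclass.
  by apply: matP => i j; rewrite /mre !matNE /mone (bij_eq bh).
elim: n => [|n ih].
  rewrite -[RHS](mxclass_one 'I_0); congr mxclass.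
  by apply: matP => -[].
have bs := split_bij 1 n.
have [h bh] : exists h : unit -> 'I_1, bijective h.
  exists (fun _ => ord0); apply: inj_surj_bij => [[] []|x] //.
  by exists tt; rewrite [x]ord1.
have h1 := gc_opp gc 'I_1; have hn := gc_opp gc 'I_n.
have <- : mre (@fintype.split 1 n) (@fintype.split 1 n) (mblk (- mone _) 0 0 (- mone _)) =
   - mone 'I_n.+1 :> mat R _ _.
  apply: matP => i j; rewrite /mre !matNE /mone -(bij_eq bs).
  by case: (fintype.split i) => i'; case: (fintype.split j) => j' /=; rewrite ?matE ?oppr0.
rewrite mxclass_re //; last exact: gc_blk.
rewrite mxclass_blk // ih addr0 -(mxclass_re bh bh h1) -mxclass_opp1; congr mxclass.
by apply: matP => -[] []; rewrite /mre !matNE /mone !eqxx.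
Qed.

(** The basis bijections [a] and [b] of a value only reindex the matrix of [f], so all choices give
    one class; an enumeration of the bases provides an actual choice. *)
Lemma k1_valueP (M N : basedMod R) (f : {linear M -> N}) : P f ->
  k1_value P f = [set mxclass (lmx f)].
Proof.
move=> hf; have hm := (proj1 (PE f)) hf.
have E n (a : {linear stdMod R n -> M}) (b : {linear N -> stdMod R n})
    (g : {linear stdMod R n -> stdMod R n}) (h : P g) :
    basedIso a -> basedIso b -> g =1 b \o f \o a -> mxclass (lmx f) = k1t_class (K1Gen h).
  move=> /basedIso_idx[s bs sE] /basedIso_idx[t bt tE] e.
  have [ti tt1 tt2] := bt; have bti : bijective ti by exists t.
  rewrite (ordclass_class gc PE) /= (mxclass_eq hm bs bti); congr ordclass.
  apply: matP => i j; rewrite /mre /lmx e /= sE.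
  have bE (y : N) : @bm_coord R (stdMod R n) (b y) j = \sum_c bm_coord y c * idxmx R t c j.
    rewrite (coord_lin b); apply: eq_bigr => c _; congr (_ * _).
    by rewrite /lmx tE bm_coord_vec.
  rewrite -[RHS]/(@bm_coord R (stdMod R n) (b (f (bm_vec (s i)))) j) bE.
  rewrite (bigD1 (ti j)) //= /idxmx tt2 eqxx mulr1 big1 ?addr0 // => k kj.
  by case: eqP => [ek|_]; [rewrite -ek tt1 eqxx in kj | rewrite mulr0].
apply/seteqP; split=> x /=.
  by case=> n [a [b [g [h [ha hb e ->]]]]]; rewrite (E n a b g h).
move=> ->.
have [k [ki kk1 kk2]] := bij_ord (gc_card gc hm).
have [h bh] := @bij_ord (bm_idx M) (bm_idx M) erefl.
pose n := #|bm_idx M|.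
pose a : {linear stdMod R n -> M} := @mx_map R (stdMod R n) M (idxmx R h).
pose b : {linear N -> stdMod R n} := @mx_map R N (stdMod R n) (idxmx R ki).
pose g : {linear stdMod R n -> stdMod R n} := b \o f \o a.
have hb : basedIso b.
  apply: (@idx_basedIso _ _ (stdMod R n) _ ki); first by exists k.
  by move=> c; apply: (@mx_map_idx _ N (stdMod R n)).
have ha : basedIso a.
  apply: (@idx_basedIso _ (stdMod R n) _ _ h) => //.
  by move=> c; apply: (@mx_map_idx _ (stdMod R n) M).
have hg : P g.
  apply: (proj2 (PE g)).
  have -> : lmx g = lmx a ** (lmx f ** lmx b).
    rewrite -lmx_comp.
    exact: (lmx_comp a (b \o f)).
  rewrite !lmx_mx_map; apply: (gc_mul gc); first exact: (Pm_idx gc bh).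
  by apply: (gc_mul gc) => //; apply: (Pm_idx gc); exists k.
by exists n, a, b, g, hg; split=> //; rewrite (E n a b g hg).
Qed.

Definition gr (I : Type) (T : eqType) (deg : I -> T) (a : mat R I I) : mat R I I :=
  fun i j => if deg i == deg j then a i j else 0.

(** Induction by splitting off the indices of top degree: no entry leads from them to a lower
    degree, so the block to their right vanishes. The diagonal blocks are shared with [gr deg a],
    whose membership descends to them by [gc_diag]. *)
Lemma tri_mxclass (I : finType) (deg : I -> int) (a : mat R I I) :
  (forall i j, a i j != 0 -> deg i <= deg j) -> Pm (gr deg a) ->
  Pm a /\ mxclass a = mxclass (gr deg a).
Proof.
have [n] := ubnP #|I|; elim: n I deg a => // n ih I deg a /ltnSE In tri.
have [i0 _|I0] := pickP I; last first.
  suff -> : gr deg a = a by [].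
  by apply: matP => i; have := I0 i.
have [m _ mmax] : exists2 m, true & forall i, deg i <= deg m.
  by case: (@arg_maxP _ _ _ i0 xpredT deg erefl) => m _ h; exists m => // i; apply: h.
pose p := [pred i | deg i == deg m].
have bs := sub_split_bij p; set s := sub_split (p := p) in bs *.
have ea : mre s s a = mblk (mre (s \o inl) (s \o inl) a) 0 (mre (s \o inr) (s \o inl) a)
    (mre (s \o inr) (s \o inr) a).
  apply: matP => -[[i hi]|[i hi]] [[j hj]|[j hj]] //; rewrite /mre /= /s /=.
  have /= /eqP di := hi; have /= dj := hj.
  apply/eqP; apply: contraT => /tri; rewrite di.
  by rewrite leNgt lt_neqAle dj mmax.
have eg : mre s s (gr deg a) = mblk (mre (s \o inl) (s \o inl) a) 0 0
    (gr (deg \o s \o inr) (mre (s \o inr) (s \o inr) a)).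
  apply: matP => -[[i hi]|[i hi]] [[j hj]|[j hj]] //; rewrite /mre /gr /= /s /=.
  - by have /= /eqP -> := hi; have /= /eqP -> := hj; rewrite eqxx.
  - by have /= /eqP -> := hi; have /= dj := hj; rewrite eq_sym (negPf dj).
  - by have /= di := hi; have /= /eqP -> := hj; rewrite (negPf di).
move=> hg; have := gc_re gc bs bs hg; rewrite eg => /(gc_diag gc)[h1 h2].
have cL : (#|{: {i | ~~ p i}}| < n)%N.
  rewrite card_sig; apply: leq_trans In; rewrite -(cardC p) -add1n leq_add2r.
  by apply/card_gt0P; exists m; rewrite inE eqxx.
have [|h3 e3] := ih _ (deg \o s \o inr) (mre (s \o inr) (s \o inr) a) cL _ h2.
  by move=> i j; apply: tri.
have h4 : Pm (mre s s a) by rewrite ea; apply: gc_blk.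
have h5 := gc_re_inv gc bs bs h4; split=> //.
rewrite -(mxclass_re bs bs h5) -(mxclass_re bs bs hg) ea eg mxclass_blk // mxclass_blk //.
by rewrite e3.
Qed.

End Kap.

(** * Torsion of a complex given by its total differential *)

Section Homog.
Variable R : nzRingType.
Implicit Types I J K : finType.

Definition homog (I : Type) (k : int) (deg : I -> int) (a : mat R I I) :=
  forall i j, a i j != 0 -> deg j = deg i + k.

Definition upward (I : Type) (deg : I -> int) (a : mat R I I) :=
  forall i j, a i j != 0 -> deg i <= deg j.

Lemma mmul_neq0 I J K (a : mat R I J) (b : mat R J K) i k :
  (a ** b) i k != 0 -> exists j, a i j != 0 /\ b j k != 0.
Proof.
move=> h; apply: contrapT => /forallNP n; case/eqP: h.
rewrite mmulE big1 // => j _; have [->|aj] := eqVneq (a i j) 0; first by rewrite mul0r.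
by have [->|bj] := eqVneq (b j k) 0; [rewrite mulr0 | case: (n j)].
Qed.

Lemma add_neq0 (x y : R) : x + y != 0 -> x != 0 \/ y != 0.
Proof. by have [->|] := eqVneq x 0; [rewrite add0r; right | left]. Qed.

Lemma homog_mul I k l (deg : I -> int) (a b : mat R I I) :
  homog k deg a -> homog l deg b -> homog (k + l) deg (a ** b).
Proof. by move=> ha hb i j /mmul_neq0[m [/ha e /hb ->]]; rewrite e addrA. Qed.

Lemma homog_add I k (deg : I -> int) (a b : mat R I I) :
  homog k deg a -> homog k deg b -> homog k deg (a + b).
Proof. by move=> ha hb i j; rewrite matDE => /add_neq0[/ha|/hb]. Qed.

Lemma homog_one I (deg : I -> int) : homog 0 deg (mone I).
Proof. by move=> i j; rewrite /mone; case: (eqVneq i j) => [->|]; rewrite ?addr0 // eqxx. Qed.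

Lemma homog_re (I I' : Type) k (deg : I -> int) (f : I' -> I) (a : mat R I I) :
  homog k deg a -> homog k (deg \o f) (mre f f a).
Proof. by move=> h i j /h. Qed.

Lemma upward_homog (I : Type) k (deg : I -> int) (a : mat R I I) :
  0 <= k -> homog k deg a -> upward deg a.
Proof. by move=> k0 h i j /h ->; rewrite lerDl. Qed.

Lemma upwardD (I : Type) (deg : I -> int) (a b : mat R I I) :
  upward deg a -> upward deg b -> upward deg (a + b).
Proof. by move=> ha hb i j; rewrite matDE => /add_neq0[/ha|/hb]. Qed.

Lemma grD (I : Type) (deg : I -> int) (a b : mat R I I) :
  gr deg (a + b) = gr deg a + gr deg b.
Proof. by apply: matP => i j; rewrite /gr !matDE; case: eqP; rewrite ?addr0. Qed.

Lemma gr_homog0 (I : Type) (deg : I -> int) (a : mat R I I) : homog 0 deg a -> gr deg a = a.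
Proof.
move=> h; apply: matP => i j; rewrite /gr; case: eqP => // d.
by apply/esym/eqP; apply: contraT => /h; rewrite addr0 => /esym.
Qed.

Lemma gr_homogn (I : Type) k (deg : I -> int) (a : mat R I I) :
  k != 0 -> homog k deg a -> gr deg a = 0.
Proof.
move=> k0 h; apply: matP => i j; rewrite /gr; case: eqP => // d.
apply/eqP; apply: contraT => /h; rewrite -d => /eqP.
by rewrite -subr_eq0 opprD addNKr oppr_eq0 (negPf k0).
Qed.

Definition cpx I (deg : I -> int) (c : mat R I I) := homog (-1) deg c /\ c ** c = 0.

Definition parity (I1 I2 : Type) (deg : I1 + I2 -> int) :=
  (forall i, (deg (inl i) %% 2)%Z = 1) /\ (forall i, (deg (inr i) %% 2)%Z = 0).

Lemma parity_even (I1 I2 : Type) k (deg : I1 + I2 -> int) a : parity deg -> (k %% 2)%Z = 0 ->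
  homog k deg a -> a = mblk (mre inl inl a) 0 0 (mre inr inr a).
Proof.
move=> [p1 p2] k2 h; apply: matP => -[i|i] [j|j] //=; apply/eqP; apply: contraT => /h.
  by have := p1 i; have := p2 j; lia.
by have := p2 i; have := p1 j; lia.
Qed.

Lemma parity_odd (I1 I2 : Type) k (deg : I1 + I2 -> int) a : parity deg -> (k %% 2)%Z = 1 ->
  homog k deg a -> a = mblk 0 (mre inl inr a) (mre inr inl a) 0.
Proof.
move=> [p1 p2] k2 h; apply: matP => -[i|i] [j|j] //=; apply/eqP; apply: contraT => /h.
  by have := p1 i; have := p1 j; lia.
by have := p2 i; have := p2 j; lia.
Qed.

End Homog.

Section Torsion.
Variables (R : nzRingType).
Variable P : forall M N : basedMod R, (M -> N) -> Prop.
Variable Pm : forall I J : finType, mat R I J -> Prop.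
Hypothesis gc : good_class Pm.
Hypothesis PE : forall (M N : basedMod R) (f : {linear M -> N}), P f <-> Pm (lmx f).

Local Notation K := (K1t P).
Local Notation mxclass := (mxclass PE).
Implicit Types I J : finType.

Definition wcontr I (deg : I -> int) (c g u : mat R I I) :=
  [/\ homog 1 deg g, c ** g + g ** c = u, u ** g = g ** u & Pm u].

Lemma wcontr_homog I (deg : I -> int) c g u :
  cpx deg c -> wcontr deg c g u -> homog 0 deg u.
Proof.
move=> [hc _] [hg <- _ _]; apply: homog_add.
  exact: (homog_mul (k := -1) (l := 1)).
exact: (homog_mul (k := 1) (l := -1)).
Qed.

(** Both products equal $cgc$, because $cc=0$. *)
Lemma wcontr_comm I (deg : I -> int) c g u :
  cpx deg c -> wcontr deg c g u -> u ** c = c ** u.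
Proof.
move=> [hc cc] [hg <- _ _].
by rewrite mmulDl mmulDr -[g ** c ** c]mmulA cc mmul0r addr0 [c ** (c ** g)]mmulA cc mmul0l add0r mmulA.
Qed.

(* Common form of contractibility and of L^2-acyclicity for a complex given by the matrix [c] of its
   total differential and the degrees of the basis elements. *)
Definition sqcontr I (deg : I -> int) (c : mat R I I) :=
  cpx deg c /\ exists d, [/\ homog 1 deg d, d ** d = 0 & Pm ((c + d) ** (c + d))].

Lemma sq_sum I (c d : mat R I I) : c ** c = 0 -> d ** d = 0 ->
  (c + d) ** (c + d) = c ** d + d ** c.
Proof. by move=> cc dd; rewrite mmulDl !mmulDr cc dd add0r addr0. Qed.

(** When $dd=0$, the square $(c+d)^2$ is $v=cd+dc$, and $vd$ and $dv$ both equal $dcd$. *)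
Lemma sqcontr_wcontr I (deg : I -> int) c : sqcontr deg c <->
  cpx deg c /\ exists d v, wcontr deg c d v /\ d ** d = 0.
Proof.
split=> -[hc].
  move=> [d [hd dd h]]; split=> //; exists d, (c ** d + d ** c); split=> //.
  have e := sq_sum hc.2 dd; rewrite e in h.
  split; [exact: hd | by [] | | exact: h].
  by rewrite mmulDl mmulDr -[c ** d ** d]mmulA dd mmul0r add0r [d ** (d ** c)]mmulA dd mmul0l addr0 mmulA.
move=> [d [v [[hd e _ h] dd]]]; split=> //; exists d; split=> //.
by rewrite sq_sum // ?e //; exact: hc.2.
Qed.

Section Split.
Variables (I1 I2 : finType) (deg : I1 + I2 -> int).
Hypothesis par : parity deg.
Local Notation B := (I1 + I2)%type.
Local Notation oo a := (mre (@inl I1 I2) (@inl I1 I2) a).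
Local Notation ee a := (mre (@inr I1 I2) (@inr I1 I2) a).
Local Notation oe a := (mre (@inl I1 I2) (@inr I1 I2) a).
Local Notation eo a := (mre (@inr I1 I2) (@inl I1 I2) a).
Implicit Types a b : mat R B B.

Definition evn a := a = mblk (oo a) 0 0 (ee a).
Definition odd_ a := a = mblk 0 (oe a) (eo a) 0.

Lemma evn_mul a b : evn a -> oo (a ** b) = oo a ** oo b /\ oe (a ** b) = oo a ** oe b.
Proof.
move=> ha; have := mblk_mmul (oo a) 0 0 (ee a) (oo b) (oe b) (eo b) (ee b).
by rewrite -ha -mblkE => ->; rewrite !mmul0l !addr0.
Qed.

Lemma evn_mul2 a b : evn a -> ee (a ** b) = ee a ** ee b.
Proof.
move=> ha; have := mblk_mmul (oo a) 0 0 (ee a) (oo b) (oe b) (eo b) (ee b).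
by rewrite -ha -mblkE => ->; rewrite !mmul0l !add0r.
Qed.

Lemma odd_mul a b : odd_ a -> [/\ oo (a ** b) = oe a ** eo b, oe (a ** b) = oe a ** ee b
  & ee (a ** b) = eo a ** oe b].
Proof.
move=> ha; have := mblk_mmul 0 (oe a) (eo a) 0 (oo b) (oe b) (eo b) (ee b).
by rewrite -ha -mblkE => ->; rewrite !mmul0l !addr0 !add0r.
Qed.

Lemma evn_diag a : evn a -> Pm a -> Pm (oo a) /\ Pm (ee a).
Proof. by move=> e; rewrite {1}e => /(gc_diag gc). Qed.

Lemma evn_homog k a : (k %% 2)%Z = 0 -> homog k deg a -> evn a.
Proof. exact: parity_even. Qed.

Lemma odd_homog k a : (k %% 2)%Z = 1 -> homog k deg a -> odd_ a.
Proof. exact: parity_odd. Qed.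

Lemma odd_add a b : odd_ a -> odd_ b -> odd_ (a + b).
Proof. by rewrite /odd_ => ha hb; rewrite {1}ha {1}hb mblkD !addr0. Qed.

Lemma evn_add a b : evn a -> evn b -> evn (a + b).
Proof. by rewrite /evn => ha hb; rewrite {1}ha {1}hb mblkD !addr0. Qed.

(** On rows, [c ** u] is the matrix of the composite $uc$, so this is
    $[(uc+\gamma)_{\mathrm{odd}}]-[u_{\mathrm{odd}}]$. *)
Definition torsionval c g u : K := mxclass (oe (c ** u + g)) - mxclass (oo u).

Variables (c : mat R B B).
Hypothesis hc : cpx deg c.

(** With $T=cu+g$ one finds $T^2=u^2+g^2$, which is triangular for the degree with graded part
    $u^2$. So the two products of the parity-changing blocks of $T$ lie in the class, and [gc_sq]
    gives the blocks themselves. Comparing classes in $Tu=uT$ shows that $u$ has the same class in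
    odd and in even degrees. *)
Lemma wcontr_facts g u : wcontr deg c g u ->
  [/\ Pm (oe (c ** u + g)), Pm (oo u), Pm (ee u) & mxclass (ee u) = mxclass (oo u)].
Proof.
move=> h; have [hg e ug Pu] := h; have u0 := wcontr_homog hc h; have uc := wcontr_comm hc h.
have cc := hc.2.
have eu : evn u by apply: evn_homog u0.
have [Po Pe] := evn_diag eu Pu.
set T := c ** u + g.
have oT : odd_ T.
  apply: odd_add; last exact: odd_homog hg.
  by apply: (@odd_homog (-1 + 0)) => //; apply: homog_mul => //; exact: hc.1.
have TT : T ** T = u ** u + g ** g.
  rewrite /T mmulDl !mmulDr.
  have -> : c ** u ** (c ** u) = 0.
    by rewrite -[c ** u ** _]mmulA [u ** (c ** u)]mmulA uc -[c ** u ** u]mmulA mmulA cc mmul0l.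
  have -> : c ** u ** g = c ** g ** u by rewrite -[c ** u ** g]mmulA ug mmulA.
  by rewrite [g ** (c ** u)]mmulA add0r addrA -mmulDl e.
have [PTT _] : Pm (T ** T) /\ mxclass (T ** T) = mxclass (gr deg (T ** T)).
  have h0 : homog 0 deg (u ** u) by exact: (homog_mul u0 u0).
  have h2 : homog 2 deg (g ** g) by exact: (homog_mul hg hg).
  apply: tri_mxclass => //.
    by rewrite TT; apply: upwardD; [exact: upward_homog h0|exact: upward_homog h2].
  by rewrite TT grD gr_homog0 // (gr_homogn _ h2) // addr0; apply: (gc_mul gc).
have eTT : evn (T ** T).
  rewrite TT; apply: evn_add; first by apply: (@evn_homog (0 + 0)) => //; exact: homog_mul.
  by apply: (@evn_homog (1 + 1)) => //; exact: homog_mul.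
have [P1 P2] := evn_diag eTT PTT.
have [o1 _ e1] := odd_mul T oT; rewrite o1 e1 in P1 P2.
have PT := gc_sq gc P1 P2.
split=> //.
have TU : T ** u = u ** T by rewrite /T mmulDl mmulDr ug mmulA uc.
have [_ + _] := odd_mul u oT; have [_ +] := evn_mul T eu.
rewrite TU => -> /esym h3.
apply: (addrI (mxclass (oe T))); rewrite -!mxclass_mul // h3 mxclass_mul // addrC.
by [].
Qed.

(* In the localisation with u and v invertible, put g' = u^-1 g and d' = v^-1 d, two contractions
   of c with d'd' = 0; then (c + g') and (c + d') differ by unipotent triangular factors.
   The identity [key] clears the denominators. *)
Lemma torsionval_indep g u d v : wcontr deg c g u -> wcontr deg c d v -> d ** d = 0 ->
  torsionval c g u = torsionval c d v.
Proof.
move=> hu hv dd.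
have [PT Po Pe kk] := wcontr_facts hu; have [PT' Po' Pe' kk'] := wcontr_facts hv.
have [hg e ug Pu] := hu; have u0 := wcontr_homog hc hu; have uc := wcontr_comm hc hu.
have [hd e' vd Pv] := hv; have v0 := wcontr_homog hc hv; have vc := wcontr_comm hc hv.
have cc := hc.2.
have eu : evn u by apply: evn_homog u0.
have ev : evn v by apply: evn_homog v0.
set T := c ** u + g; set T' := c ** v + d.
have oT : odd_ T.
  apply: odd_add; last exact: odd_homog hg.
  by apply: (@odd_homog (-1 + 0)) => //; apply: homog_mul => //; exact: hc.1.
(* With denominators the identity [key] reads $(c+g')(1+g'd')=(1+g'd'+g'g'd'c)(c+d')$. Both
   correction factors are 1 plus a term of degree 2. *)
set A := u ** v + g ** d.
set A' := u ** u ** v + (u ** g ** d + g ** g ** d ** c).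
have key : T ** (A ** v) = A' ** T'.
  have gdc : g ** d ** c = g ** v - g ** c ** d.
    by rewrite -e' mmulDr !mmulA addrAC subrr add0r.
  have gc' : c ** g = u - g ** c by rewrite -e addrK.
  rewrite /T /A /A' /T' !(mmulDl, mmulDr) !mmulA.
  have -> : c ** u ** u ** v ** v = u ** u ** v ** c ** v.
    have -> : c ** u ** u = u ** u ** c by rewrite -uc -mmulA -uc mmulA.
    by rewrite -[u ** u ** c ** v]mmulA -vc mmulA.
  have -> : c ** u ** g ** d ** v = u ** u ** d ** v - u ** g ** c ** d ** v.
    by rewrite -uc -[u ** c ** g]mmulA gc' mmulDr mmulNr mmulA !mmulDl !mmulNl.
  have -> : g ** g ** d ** v = g ** g ** v ** d.
    by rewrite -[g ** g ** d ** v]mmulA -vd mmulA.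
  have -> : u ** u ** v ** d = u ** u ** d ** v.
    by rewrite -[u ** u ** v ** d]mmulA vd mmulA.
  have -> : u ** g ** d ** c ** v = u ** g ** v ** v - u ** g ** c ** d ** v.
    by rewrite -[u ** g ** d]mmulA -[u ** (g ** d) ** c]mmulA gdc mmulDr mmulNr !mmulA
      !mmulDl !mmulNl.
  have -> : u ** g ** d ** d = 0 by rewrite -[u ** g ** d ** d]mmulA dd mmul0r.
  have -> : g ** g ** d ** c ** c ** v = 0.
    by rewrite -[g ** g ** d ** c ** c]mmulA cc mmul0r mmul0l.
  have -> : g ** g ** d ** c ** d = g ** g ** v ** d.
    rewrite -[g ** g ** d]mmulA -[g ** (g ** d) ** c]mmulA gdc mmulDr mmulNr !mmulA.
    by rewrite mmulDl mmulNl -[g ** g ** c ** d ** d]mmulA dd mmul0r subr0.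
  by rewrite -ug !addr0 !add0r -!addrA; congr (_ + (_ + _)); rewrite addrCA.
have h0 : homog 0 deg (u ** v) by exact: (homog_mul u0 v0).
have h2 : homog 2 deg (g ** d) by exact: (homog_mul hg hd).
have h0' : homog 0 deg (u ** u ** v) by exact: (homog_mul (homog_mul u0 u0) v0).
have h2' : homog 2 deg (u ** g ** d + g ** g ** d ** c).
  apply: homog_add; first exact: (homog_mul (homog_mul u0 hg) hd).
  exact: (homog_mul (homog_mul (homog_mul hg hg) hd) hc.1).
have eA : evn A by apply: evn_add; [exact: evn_homog h0 | exact: evn_homog h2].
have eA' : evn A' by apply: evn_add; [exact: evn_homog h0' | exact: evn_homog h2'].
(* A matrix of degree 0 plus one of degree 2 is triangular for the degree, so its odd and even
   blocks have the classes of those of its degree 0 part. *)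
have tri (a b : mat R B B) : homog 0 deg a -> homog 2 deg b -> Pm a ->
  [/\ Pm (oo (a + b)), Pm (ee (a + b)), mxclass (oo (a + b)) = mxclass (oo a) &
      mxclass (ee (a + b)) = mxclass (ee a)].
  move=> ha hb Pa.
  have ea : evn a by apply: evn_homog ha.
  have [Pa1 Pa2] := evn_diag ea Pa.
  have up : upward deg (a + b) by apply: upwardD; [exact: upward_homog ha|exact: upward_homog hb].
  have ge : gr deg (a + b) = a by rewrite grD gr_homog0 // (gr_homogn _ hb) // addr0.
  have [|Q1 k1] := @tri_mxclass _ _ _ gc PE _ (deg \o inl) (oo (a + b)) (fun i j => up _ _).
    by rewrite -[gr _ _]/(oo (gr deg (a + b))) ge.
  have [|Q2 k2] := @tri_mxclass _ _ _ gc PE _ (deg \o inr) (ee (a + b)) (fun i j => up _ _).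
    by rewrite -[gr _ _]/(ee (gr deg (a + b))) ge.
  split=> //; rewrite ?k1 ?k2.
    by rewrite -[gr _ _]/(oo (gr deg (a + b))) ge.
  by rewrite -[gr _ _]/(ee (gr deg (a + b))) ge.
have [_ PA _ kA] := tri _ _ h0 h2 (gc_mul gc Pu Pv).
have [PA' _ kA' _] := tri _ _ h0' h2' (gc_mul gc (gc_mul gc Pu Pu) Pv).
have [_ E1 _] := odd_mul (A ** v) oT; have [_ E2] := evn_mul T' eA'.
have E : mxclass (oe T ** (ee A ** ee v)) = mxclass (oo A' ** oe T').
  by rewrite -E2 -key E1 evn_mul2.
have PAv := gc_mul gc PA Pe'; have PA'T := gc_mul gc PA' PT'.
rewrite !mxclass_mul // kA kA' evn_mul2 // mxclass_mul // (evn_mul _ _).1 in E; last first.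
  by apply: (@evn_homog (0 + 0)) => //; exact: homog_mul.
rewrite (evn_mul _ eu).1 !mxclass_mul // in E; last exact: (gc_mul gc).
rewrite kk kk' in E; rewrite /torsionval -/T -/T'.
move: (mxclass (oe T)) (mxclass (oe T')) (mxclass (oo u)) (mxclass (oo v)) E => a b x y E.
have {}E1 : a + y = b + x.
  apply: (addIr (x + y)); rewrite -addrA [y + _]addrC E.
  by rewrite [LHS]addrC -!addrA.
by rewrite -(addrK y a) E1 addrAC addrK.
Qed.

End Split.
End Torsion.

(** * Complexes and their total differentials *)

Section Pres.
Variable R : nzRingType.
Implicit Types C D E : chainCpx R.

(** The union of the bases runs over all integers and is not finite by its form. It is presented by
    a finite type [B] through [isEnum], and [B] stays free so that each construction can use the sum
    type that suits it. *)
Definition Tot C : Type := {n : int & bm_idx (C n)}.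
Definition tot C n (i : bm_idx (C n)) : Tot C := Tagged (fun n => bm_idx (C n)) i.

Definition isEnum C (B : finType) (e : B -> Tot C) (ei : Tot C -> B) := cancel e ei /\ cancel ei e.

Section Enum.
Variables (C : chainCpx R) (B : finType) (e : B -> Tot C) (ei : Tot C -> B).
Hypothesis en : isEnum e ei.

Definition edeg (b : B) : int := tag (e b).

Definition fmat (f : forall i j, C i -> C j) : mat R B B := fun b b' =>
  lmx (f (tag (e b)) (tag (e b'))) (tagged (e b)) (tagged (e b')).

Definition cmat := fmat (fun i j x => cc_d C i j x).

Definition fam (a : mat R B B) i j : {linear C i -> C j} :=
  mx_map (fun x y => a (ei (tot x)) (ei (tot y))).

Lemma lmx_fam a i j x y : lmx (fam a i j) x y = a (ei (tot x)) (ei (tot y)).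
Proof. by rewrite lmx_mx_map. Qed.

Lemma fmatE f i j (x : bm_idx (C i)) (y : bm_idx (C j)) :
  fmat f (ei (tot x)) (ei (tot y)) = lmx (f i j) x y.
Proof. by rewrite /fmat !en.2. Qed.

Lemma fmat_fam a : fmat (fam a) = a.
Proof.
apply: matP => b b'; rewrite /fmat lmx_fam.
rewrite -[in RHS](en.1 b) -[in RHS](en.1 b').
by case: (e b) (e b') => [i x] [j y].
Qed.

Lemma edegE n (i : bm_idx (C n)) : edeg (ei (tot i)) = n.
Proof. by rewrite /edeg en.2. Qed.

Lemma enum_elim (Q : B -> Prop) :
  (forall n (i : bm_idx (C n)), Q (ei (tot i))) -> forall b, Q b.
Proof. by move=> h b; rewrite -(en.1 b); case: (e b) => n i; exact: h. Qed.

Lemma sum_deg (V : zmodType) n (F : B -> V) :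
  \sum_(b | edeg b == n) F b = \sum_(i : bm_idx (C n)) F (ei (tot i)).
Proof.
pose h (i : bm_idx (C n)) : B := ei (tot i).
have hi : injective h.
  move=> i j /(congr1 e); rewrite /h !en.2 => /eqP.
  by rewrite -tag_eqE /tag_eq eqxx /= tagged_asE => /eqP.
transitivity (\sum_(b in imset h (mem (@predT (bm_idx (C n))))) F b).
  apply: eq_bigl => b; apply/eqP/imsetP => [|[i _ ->]]; last exact: edegE.
  by elim/enum_elim: b => m i; rewrite edegE => mn; subst m; exists i.
by rewrite big_imset //= => i j _ _; exact: hi.
Qed.

Lemma fmat_homog k (f : forall i j, C i -> C j) :
  (forall i j, j != i + k -> forall x, f i j x = 0) -> homog k edeg (fmat f).
Proof.
move=> h b b'; elim/enum_elim: b => i x; elim/enum_elim: b' => j y.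
rewrite fmatE !edegE; have [//|ij] := eqVneq j (i + k).
by rewrite /lmx h // bm_coord0 eqxx.
Qed.

(** Only basis elements of degree $i+k$ contribute, so the matrix product is the composite through
    that single chain module. *)
Lemma fmat_mul k (f g : forall i j, {linear C i -> C j}) i l (x : bm_idx (C i)) (y : bm_idx (C l)) :
  (forall i j, j != i + k -> forall x, f i j x = 0) ->
  (fmat f ** fmat g) (ei (tot x)) (ei (tot y)) =
  bm_coord (g (i + k) l (f i (i + k) (bm_vec x))) y.
Proof.
move=> h; rewrite mmulE coord_lin (bigID (fun b => edeg b == i + k)) /=.
rewrite [X in _ + X]big1 ?addr0 => [|b bk].
  rewrite sum_deg; apply: eq_bigr => j _.
  by rewrite !fmatE.
have [->|/(fmat_homog h)] := eqVneq (fmat f (ei (tot x)) b) 0; first by rewrite mul0r.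
by rewrite edegE => /eqP; rewrite (negPf bk).
Qed.

Lemma d_shape i j : j != i + (-1) -> forall x, cc_d C i j x = 0.
Proof. by move=> h; apply: cc_shape; apply: contra h => /eqP ->; rewrite addrK. Qed.

Lemma enum_cpx : cpx edeg cmat.
Proof.
split; first exact: (fmat_homog d_shape).
apply: matP => b b'; elim/enum_elim: b => i x; elim/enum_elim: b' => l y.
by rewrite (fmat_mul (k := -1)) ?cc_dd ?bm_coord0 //; exact: d_shape.
Qed.

Lemma linear_ext (M N : basedMod R) (f g : {linear M -> N}) :
  (forall b, f (bm_vec b) = g (bm_vec b)) -> f =1 g.
Proof. by move=> h; apply: lmx_inj; apply: matP => b c; rewrite /lmx h. Qed.

Lemma nullHtpy_mat (h : forall i j, {linear C i -> C j}) (u : forall n, {linear C n -> C n}) :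
  isNullHtpy h u <->
  homog 1 edeg (fmat h) /\
  (forall n (x y : bm_idx (C n)),
    (cmat ** fmat h + fmat h ** cmat) (ei (tot x)) (ei (tot y)) = lmx (u n) x y).
Proof.
have E (h1 : forall i j, j != i + 1 -> forall x, h i j x = 0) n x y :
    (cmat ** fmat h + fmat h ** cmat) (ei (tot x)) (ei (tot y)) =
    bm_coord (cc_d C (n + 1) n (h n (n + 1) (bm_vec x)) + h (n - 1) n (cc_d C n (n - 1) (bm_vec x))) y.
  rewrite matDE (fmat_mul (k := -1) (f := cc_d C) h) ?(fmat_mul (k := 1) (f := h) (cc_d C)) //.
    by rewrite bm_coordD addrC.
  exact: d_shape.
split=> [[h1 h2]|[h1 h2]].
  split; first exact: (fmat_homog h1).
  by move=> n x y; rewrite E // h2.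
have h1' i j : j != i + 1 -> forall x, h i j x = 0.
  move=> ij x; apply: bm_coord_inj => c; rewrite bm_coord0 coord_lin big1 // => b _.
  have [->|] := eqVneq (lmx (h i j) b c) 0; first by rewrite mulr0.
  have := h1 (ei (tot b)) (ei (tot c)); rewrite fmatE !edegE => h3 /h3 /eqP.
  by rewrite (negPf ij).
split=> // n x.
have := @linear_ext _ _ ((cc_d C (n + 1) n \o h n (n + 1)) \+ (h (n - 1) n \o cc_d C n (n - 1))) (u n).
apply=> b; apply: bm_coord_inj => c.
by apply: etrans (h2 n b c); rewrite E.
Qed.

End Enum.

(** The enumeration in which [oddToEv] of a family is the upper right block of its total matrix. *)
Definition pe C (b : bm_idx (oddPart C) + bm_idx (evPart C)) : Tot C :=
  match b with inl b => tot (tagged b) | inr b => tot (tagged b) end.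

Lemma pe_parity C : parity (edeg (@pe C)).
Proof. by split=> -[k b] /=; rewrite /edeg /= /odd_deg /ev_deg; lia. Qed.

Lemma bij_isEnum C (B : finType) (e : B -> Tot C) : bijective e -> exists ei, isEnum e ei.
Proof. by case=> ei h1 h2; exists ei. Qed.

Lemma pe_bij C : bijective (@pe C).
Proof.
have degI : injective (@cc_deg R C).
  by move=> k l; rewrite /cc_deg => h; apply: val_inj => /=; lia.
have [p1 p2] := pe_parity C.
apply: inj_surj_bij.
  move=> [b|b] [b'|b'] h.
  - congr inl; case: b b' h => k b [k' b'] /= h.
    have kk : k = k'.
      by apply: degI; have := congr1 (@tag _ _) h; rewrite /= /odd_deg; lia.
    subst k'; congr existT; move: h => /eqP.
    by rewrite -tag_eqE /tag_eq eqxx /= tagged_asE => /eqP.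
  - by have := p1 b; have := p2 b'; rewrite /edeg h => ->.
  - by have := p2 b; have := p1 b'; rewrite /edeg h => ->.
  - congr inr; case: b b' h => k b [k' b'] /= h.
    have kk : k = k'.
      by apply: degI; have := congr1 (@tag _ _) h; rewrite /= /ev_deg; lia.
    subst k'; congr existT; move: h => /eqP.
    by rewrite -tag_eqE /tag_eq eqxx /= tagged_asE => /eqP.
move=> [n i].
(* A basis vector has a coordinate equal to 1, so a vanishing module has an empty basis. Hence $|n|$
   is within the bound, and $n$ div 2 falls in the range of the direct sums. *)
have nb : (`|n| <= cc_bound C)%N.
  rewrite leqNgt; apply/negP => nb; have := bm_coord_vec i i.
  rewrite (cc_bounded nb (bm_vec i)) bm_coord0 eqxx => /esym/eqP; by rewrite oner_eq0.
have [k kE] : exists k : cc_range C, cc_deg k = (n %/ 2)%Z.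
  have mlt : (absz ((n %/ 2)%Z + (cc_bound C)%:Z)%R < (cc_bound C).*2.+1)%N by lia.
  by exists (Ordinal mlt); rewrite /cc_deg /=; lia.
have [n1|n0] := eqVneq (n %% 2)%Z 1.
  have nE : odd_deg k = n by rewrite /odd_deg kE; lia.
  by subst n; exists (inl (existT _ k i)).
have nE : ev_deg k = n by rewrite /ev_deg kE; lia.
by subst n; exists (inr (existT _ k i)).
Qed.

End Pres.

(** * Based exact sequences as partitions of bases *)

Section BasedExact.
Variable R : nzRingType.
Variables M0 M1 M2 : basedMod R.
Variables (i : {linear M0 -> M1}) (p : {linear M1 -> M2}).

(** Reduces based exactness to a bijection of index sets: [s] includes the basis of the submodule
    and [r] lifts that of the quotient. Total differentials of extensions become block triangular
    along it. *)
Definition idxExact (s : bm_idx M0 -> bm_idx M1) (r : bm_idx M2 -> bm_idx M1) :=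
  [/\ forall b, i (bm_vec b) = bm_vec (s b), forall b, p (bm_vec (s b)) = 0,
      forall b, p (bm_vec (r b)) = bm_vec b &
      bijective (fun x => match x with inl b => s b | inr b => r b end)].

Section FromIdx.
Variables (s : bm_idx M0 -> bm_idx M1) (r : bm_idx M2 -> bm_idx M1).
Hypothesis sr : idxExact s r.

Let f := fun x => match x with inl b => s b | inr b => r b end.

Lemma idx_inl : injective s.
Proof. by have [_ _ _ /bij_inj fi] := sr => x y /(fi (inl x) (inl y))[]. Qed.

Lemma idx_inr : injective r.
Proof. by have [_ _ _ /bij_inj fi] := sr => x y /(fi (inr x) (inr y))[]. Qed.

Lemma idx_neq x y : s x != r y.
Proof. by have [_ _ _ /bij_inj fi] := sr; apply/eqP => /(fi (inl x) (inr y)). Qed.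

Lemma idx_cover y : (exists x, y = s x) \/ (exists z, y = r z).
Proof. by have [_ _ _ [g _ gK]] := sr; rewrite -(gK y); case: (g y) => x; [left|right]; exists x. Qed.

Lemma coord_i x b : bm_coord (i x) (s b) = bm_coord x b.
Proof.
have [h _ _ _] := sr; rewrite coord_lin (bigD1 b) //= /lmx h bm_coord_vec eqxx mulr1.
rewrite big1 ?addr0 // => c cb; rewrite h bm_coord_vec (inj_eq idx_inl) (negPf cb).
by rewrite mulr0.
Qed.

Lemma coord_i0 x b : bm_coord (i x) (r b) = 0.
Proof.
have [h _ _ _] := sr; rewrite coord_lin big1 // => c _.
by rewrite /lmx h bm_coord_vec (negPf (idx_neq _ _)) mulr0.
Qed.

Lemma coord_p y b : bm_coord (p y) b = bm_coord y (r b).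
Proof.
have [_ h0 h1 _] := sr; rewrite coord_lin (bigD1 (r b)) //= /lmx h1 bm_coord_vec eqxx mulr1.
rewrite big1 ?addr0 // => c cb; have [[x ->]|[z zE]] := idx_cover c.
  by rewrite h0 bm_coord0 mulr0.
rewrite zE h1 bm_coord_vec; case: eqP => [e|]; last by rewrite mulr0.
by rewrite zE e eqxx in cb.
Qed.

Lemma idx_basedExact : basedExact i p.
Proof.
have [h h0 h1 _] := sr; split.
- by move=> x y e; apply: bm_coord_inj => b; rewrite -!coord_i e.
- apply/seteqP; split=> [_ [x _ <-]|y /= py0].
    by apply: bm_coord_inj => b; rewrite coord_p coord_i0 bm_coord0.
  exists (\sum_b bm_coord y (s b) *: bm_vec b) => //.
  apply: bm_coord_inj => c; have [[x ->]|[z ->]] := idx_cover c.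
    by rewrite coord_i (bm_coordE (fun b => bm_coord y (s b))).
  by rewrite coord_i0 -coord_p py0 bm_coord0.
- apply/seteqP; split=> // z _; exists (\sum_b bm_coord z b *: bm_vec (r b)) => //.
  rewrite linear_sum -[RHS]bm_sumE; apply: eq_bigr => b _.
  by rewrite linearZ h1.
- by move=> _ [_ [b _ <-] <-]; exists (s b).
have nr b : ~ [set i x | x in Defs.basis M0] (bm_vec (r b)).
  by move=> [_ [x _ <-]]; rewrite h => /bm_vec_inj e; have := idx_neq x b; rewrite e eqxx.
split.
- move=> _ [[c _ <-] n]; have [[x e]|[z ->]] := idx_cover c; last by rewrite /= h1; exists z.
  by case: n; exists (bm_vec x); [exists x | rewrite h e].
- have key c : ~ [set i x | x in Defs.basis M0] (bm_vec c) -> exists z, c = r z.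
    move=> n; have [[x e]|[z ->]] := idx_cover c; last by exists z.
    by case: n; exists (bm_vec x); [exists x | rewrite h e].
  move=> u v /set_mem[[c _ <-] /key[z ->]] /set_mem[[c' _ <-] /key[z' ->]].
  by rewrite !h1 => /bm_vec_inj ->.
- by move=> _ [z _ <-]; exists (bm_vec (r z)); [split; [exists (r z)|exact: nr] | exact: h1].
Qed.

End FromIdx.

Lemma basedExact_idx : basedExact i p -> exists s r, idxExact s r.
Proof.
move=> [ii ri rp ib [pf ps pi]].
have /choice[s sE] : forall b, exists c, i (bm_vec b) = bm_vec c.
  move=> b; have [|c _ <-] := ib (i (bm_vec b)); last by exists c.
  by exists (bm_vec b) => //; exists b.
have /choice[r rE] : forall b, exists c, p (bm_vec c) = bm_vec b /\
    ~ [set i x | x in Defs.basis M0] (bm_vec c).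
  move=> b; have [|_ [[c _ <-] n] e] := pi (bm_vec b); first by exists b.
  by exists c.
have p0 b : p (bm_vec (s b)) = 0.
  by have : range i (bm_vec (s b)); [exists (bm_vec b) => //|rewrite ri].
exists s, r; split=> //; first by move=> b; case: (rE b).
have ms b : [set i x | x in Defs.basis M0] (bm_vec (s b)).
  by exists (bm_vec b); [exists b|].
apply: inj_surj_bij => [[x|x] [y|y] e|y].
- by congr inl; apply: (@bm_vec_inj _ M0); apply: ii; rewrite !sE e.
- by have [_ []] := rE y; rewrite -e.
- by have [_ []] := rE x; rewrite e.
- by congr inr; apply: (@bm_vec_inj _ M2); rewrite -(rE x).1 -(rE y).1 e.
have [[_ [x _ <-] e]|n] := pselect ([set i x | x in Defs.basis M0] (bm_vec y)).
  by exists (inl x); apply: (@bm_vec_inj _ M1); rewrite -sE.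
have [|z _ e] := pf (bm_vec y); first by split=> //; exists y.
exists (inr z); apply: (@bm_vec_inj _ M1); apply: ps.
- by apply: mem_set; split; [exists (r z) | exact: (rE z).2].
- by apply: mem_set; split=> //; exists y.
- by rewrite (rE z).1 e.
Qed.

End BasedExact.

(** * Based complexes as graded matrices of square zero *)

Section EnumIso.
Variable R : nzRingType.
Implicit Types C D E : chainCpx R.

Lemma tot_inj C n : injective (@tot R C n).
Proof.
move=> x y /eqP; rewrite -tag_eqE /tag_eq eqxx /= tagged_asE.
by move/eqP.
Qed.

(** Together with [iso_enum]: the degrees and the matrix of one enumeration determine a complex up
    to basis-preserving isomorphism. *)
Lemma enum_iso C D (B : finType) (e : B -> Tot C) (e' : B -> Tot D) :
  bijective e -> bijective e' -> edeg e =1 edeg e' -> cmat e = cmat e' ->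
  basedCpxIso C D.
Proof.
move=> /bij_isEnum[ei en] /bij_isEnum[ei' en'] ed ec.
have S n : exists s : bm_idx (C n) -> bm_idx (D n), forall x, ei' (tot (s x)) = ei (tot x).
  suff /choice[s h] : forall x : bm_idx (C n), exists y : bm_idx (D n), ei' (tot y) = ei (tot x).
    by exists s.
  move=> x; have := edegE en x; rewrite ed /edeg.
  case E: (e' _) => [m y] /= mn; subst m; exists y.
  by rewrite -[RHS]en'.1 E.
pose s n := projT1 (cid (S n)).
have sE n x : ei' (tot (s n x)) = ei (tot x) := projT2 (cid (S n)) x.
exists (fun n => mx_map (idxmx R (s n))); split; last first.
  move=> n; apply: (idx_basedIso (s := s n)); last by move=> b; rewrite /= mx_map_idx.
  apply: inj_surj_bij => [x y|y].
    by move/(congr1 (fun z => ei' (tot z))); rewrite !sE => /(can_inj en.2)/tot_inj.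
  have := edegE en' y; rewrite -ed /edeg.
  case E: (e _) => [m x] /= mn; subst m; exists x.
  by apply: (@tot_inj D n); apply: (can_inj en'.2); rewrite sE -[RHS]en.1 E.
move=> i j x.
have := @linear_ext _ _ _ (mx_map (idxmx R (s j)) \o cc_d C i j) (cc_d D i j \o mx_map (idxmx R (s i))).
apply=> b; apply: bm_coord_inj => c /=; rewrite mx_map_idx coord_mx_map.
rewrite -[RHS]/(lmx (cc_d D i j) (s i b) c) -(fmatE en' (fun i j x => cc_d D i j x)).
have [t ts] : exists t, c = s j t.
  have := edegE en' c; rewrite -ed /edeg.
  case E: (e _) => [m t] /= mn; subst m; exists t.
  by apply/esym; apply: (@tot_inj D j); apply: (can_inj en'.2); rewrite sE -[RHS]en.1 E.
rewrite ts !sE -/(cmat e') -ec /cmat (fmatE en) (bigD1 t) //= /idxmx eqxx mulr1 big1 ?addr0 // => t' tt'.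
case: eqP => [h|]; last by rewrite mulr0.
have : t' = t by apply: (@tot_inj C j); apply: (can_inj en.2); rewrite -!sE h.
by move/eqP; rewrite (negPf tt').
Qed.

Lemma iso_enum C D (B : finType) (e : B -> Tot C) : bijective e -> basedCpxIso C D ->
  exists e' : B -> Tot D, [/\ bijective e', edeg e =1 edeg e' & cmat e = cmat e'].
Proof.
move=> be [f [fc fi]].
have S n : exists s : bm_idx (C n) -> bm_idx (D n), bijective s /\
    forall b, f n (bm_vec b) = bm_vec (s b).
  by have [s] := basedIso_idx (fi n); exists s.
pose s n := projT1 (cid (S n)).
have sb n : bijective (s n) := (projT2 (cid (S n))).1.
have sE n b : f n (bm_vec b) = bm_vec (s n b) := (projT2 (cid (S n))).2 b.
exists (fun b => tot (s _ (tagged (e b)))); split=> //.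
  apply: (@bij_comp _ _ _ (fun t : Tot C => tot (s _ (tagged t)) : Tot D)) => //.
  apply: inj_surj_bij => [[n x] [m y] h|[n y]].
    have mn : n = m := congr1 (@tag _ _) h; subst m.
    by move: h => /tot_inj /(bij_inj (sb n)) /= ->.
  by have [g _ sg] := sb n; exists (tot (g y)); rewrite /tot /= sg.
apply: matP => b b'; rewrite /cmat /fmat /lmx /=.
move: (e b) (e b') => [i x] [j y] /=.
rewrite -sE -fc [RHS]coord_lin (bigD1 y) //= /lmx sE bm_coord_vec eqxx mulr1 big1 ?addr0 // => z zy.
by rewrite sE bm_coord_vec (inj_eq (bij_inj (sb j))) (negPf zy) mulr0.
Qed.

Definition sumdeg (B1 B2 : Type) (d1 : B1 -> int) (d2 : B2 -> int) (b : B1 + B2) :=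
  match b with inl b => d1 b | inr b => d2 b end.

(** The zero block expresses that $C$ is a subcomplex; [k] collects what the differential sends from
    lifts of the basis of $E$ into $C$. *)
Lemma exact_enum C D E (B1 B2 : finType) (e1 : B1 -> Tot C) (e2 : B2 -> Tot E) :
  bijective e1 -> bijective e2 -> basedCpxExact C D E ->
  exists (e : B1 + B2 -> Tot D) k,
    [/\ bijective e, edeg e =1 sumdeg (edeg e1) (edeg e2) &
        cmat e = mblk (cmat e1) 0 k (cmat e2)].
Proof.
move=> b1 b2 [i [p [ic pc ex]]].
have S n := basedExact_idx (ex n).
pose s n := projT1 (cid (S n)).
have S' n : exists r, idxExact (i n) (p n) (s n) r := projT2 (cid (S n)).
pose r n := projT1 (cid (S' n)).
have sr n : idxExact (i n) (p n) (s n) (r n) := projT2 (cid (S' n)).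
pose e (b : B1 + B2) : Tot D := match b with
  inl b => tot (s _ (tagged (e1 b))) | inr b => tot (r _ (tagged (e2 b))) end.
exists e, (fun b b' => cmat e (inr b) (inl b')); split.
- apply: inj_surj_bij => [[b|b] [b'|b']|[n y]] /=.
  + move=> h; congr inl; apply: (bij_inj b1); move: h.
    case: (e1 b) (e1 b') => [n x] [m x'] /= h.
    have mn : n = m := congr1 (@tag _ _) h; subst m.
    by move: h => /tot_inj /(idx_inl (sr n)) /= ->.
  + case: (e1 b) (e2 b') => [n x] [m x'] /= h.
    have mn : n = m := congr1 (@tag _ _) h; subst m.
    by move/tot_inj: h => /eqP; rewrite (negPf (idx_neq (sr n) _ _)).
  + case: (e2 b) (e1 b') => [n x] [m x'] /= h.
    have mn : n = m := congr1 (@tag _ _) h; subst m.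
    by move/tot_inj: h => /eqP; rewrite eq_sym (negPf (idx_neq (sr n) _ _)).
  + move=> h; congr inr; apply: (bij_inj b2); move: h.
    case: (e2 b) (e2 b') => [n x] [m x'] /= h.
    have mn : n = m := congr1 (@tag _ _) h; subst m.
    by move: h => /tot_inj /(idx_inr (sr n)) /= ->.
  + have [[x ->]|[z ->]] := idx_cover (sr n) y.
      by have [g _ gK] := b1; exists (inl (g (tot x))); rewrite /= gK.
    by have [g _ gK] := b2; exists (inr (g (tot z))); rewrite /= gK.
- by case.
apply: matP => -[b|b] [b'|b'] //=; rewrite /cmat /fmat /lmx /=.
- move: (e1 b) (e1 b') => [m x] [n x'] /=; have [iE _ _ _] := sr m.
  by rewrite -iE -ic (coord_i (sr n)).
- move: (e1 b) (e2 b') => [m x] [n x'] /=; have [iE _ _ _] := sr m.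
  by rewrite -iE -ic (coord_i0 (sr n)).
- move: (e2 b) (e2 b') => [m x] [n x'] /=; have [_ _ pE _] := sr m.
  by rewrite -(coord_p (sr n)) pc pE.
Qed.

Lemma enum_exact C D E (B1 B2 : finType) (e1 : B1 -> Tot C) (e2 : B2 -> Tot E)
    (e : B1 + B2 -> Tot D) k :
  bijective e1 -> bijective e2 -> bijective e ->
  edeg e =1 sumdeg (edeg e1) (edeg e2) -> cmat e = mblk (cmat e1) 0 k (cmat e2) ->
  basedCpxExact C D E.
Proof.
move=> /bij_isEnum[g1 en1] /bij_isEnum[g2 en2] /bij_isEnum[g en] ed ec.
have S n : exists s : bm_idx (C n) -> bm_idx (D n), forall x, g (tot (s x)) = inl (g1 (tot x)).
  suff /choice[s h] : forall x : bm_idx (C n), exists y : bm_idx (D n), g (tot y) = inl (g1 (tot x)).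
    by exists s.
  move=> x; have := edegE en1 x; rewrite -[edeg e1 _]/(sumdeg (edeg e1) (edeg e2) (inl _)) -ed /edeg.
  case E1: (e _) => [m y] /= mn; subst m; exists y.
  by rewrite -[RHS]en.1 E1.
pose s n := projT1 (cid (S n)).
have sE n x : g (tot (s n x)) = inl (g1 (tot x)) := projT2 (cid (S n)) x.
have T n : exists r : bm_idx (E n) -> bm_idx (D n), forall x, g (tot (r x)) = inr (g2 (tot x)).
  suff /choice[r h] : forall x : bm_idx (E n), exists y : bm_idx (D n), g (tot y) = inr (g2 (tot x)).
    by exists r.
  move=> x; have := edegE en2 x; rewrite -[edeg e2 _]/(sumdeg (edeg e1) (edeg e2) (inr _)) -ed /edeg.
  case E1: (e _) => [m y] /= mn; subst m; exists y.
  by rewrite -[RHS]en.1 E1.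
pose r n := projT1 (cid (T n)).
have rE n x : g (tot (r n x)) = inr (g2 (tot x)) := projT2 (cid (T n)) x.
have cov n y : (exists x, y = s n x) \/ (exists z, y = r n z).
  have := edegE en y; rewrite ed; case E1: (g (tot y)) => [b|b] /=; rewrite /edeg.
    case E2: (e1 b) => [m x] /= mn; subst m; left; exists x.
    by apply: (@tot_inj D n); apply: (can_inj en.2); rewrite sE E1 -(en1.1 b) E2.
  case E2: (e2 b) => [m x] /= mn; subst m; right; exists x.
  by apply: (@tot_inj D n); apply: (can_inj en.2); rewrite rE E1 -(en2.1 b) E2.
pose i n : {linear C n -> D n} := mx_map (idxmx R (s n)).
pose p n : {linear D n -> E n} := mx_map (fun y z => (y == r n z)%:R).
have sr n : idxExact (i n) (p n) (s n) (r n).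
  have sr0 x z : s n x != r n z.
    by apply/eqP => /(congr1 (fun t => g (tot t))); rewrite sE rE.
  have ri : injective (r n).
    by move=> x y /(congr1 (fun t => g (tot t))); rewrite !rE => -[/(can_inj en2.2)/tot_inj].
  split=> [b|b|b|].
  - by rewrite /= mx_map_idx.
  - by rewrite /= mx_map_vec big1 // => c _; rewrite (negPf (sr0 _ _)) scale0r.
  - rewrite /= mx_map_vec (bigD1 b) //= eqxx scale1r big1 ?addr0 // => c cb.
    by rewrite (inj_eq ri) eq_sym (negPf cb) scale0r.
  apply: inj_surj_bij => [[x|x] [y|y]|y] /=.
  - by move/(congr1 (fun t => g (tot t))); rewrite !sE => -[/(can_inj en1.2)/tot_inj ->].
  - by move/eqP; rewrite (negPf (sr0 _ _)).
  - by move/esym/eqP; rewrite (negPf (sr0 _ _)).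
  - by move=> /ri ->.
  by have [[x ->]|[z ->]] := cov n y; [exists (inl x) | exists (inr z)].
have dE m n x y : lmx (cc_d D m n) x y = cmat e (g (tot x)) (g (tot y)) by rewrite /cmat fmatE.
exists i, p; split; last by move=> n; exact: (idx_basedExact (sr n)).
- move=> m n x.
  have := @linear_ext _ _ _ (i n \o cc_d C m n) (cc_d D m n \o i m); apply=> b.
  have [iE _ _ _] := sr m.
  apply: bm_coord_inj => c; rewrite /= iE -[RHS]/(lmx (cc_d D m n) (s m b) c) dE sE ec.
  have [[y ->]|[z ->]] := cov n c.
    by rewrite (coord_i (sr n)) sE /= /cmat (fmatE en1).
  by rewrite (coord_i0 (sr n)) rE.
- move=> m n x.
  have := @linear_ext _ _ _ (p n \o cc_d D m n) (cc_d E m n \o p m); apply=> b.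
  have [_ p0 p1 _] := sr m.
  apply: bm_coord_inj => c; rewrite /= (coord_p (sr n)) -[LHS]/(lmx (cc_d D m n) b (r n c)) dE rE.
  have [[y ->]|[z ->]] := cov m b.
    by rewrite p0 linear0 bm_coord0 sE ec.
  by rewrite p1 rE ec /= /cmat (fmatE en2).
Qed.

Lemma enum_entry C (B : finType) (e : B -> Tot C) b b' n m x y :
  e b = @tot R C n x -> e b' = @tot R C m y -> cmat e b b' = lmx (cc_d C n m) x y.
Proof. by move=> h h'; rewrite /cmat /fmat h h'. Qed.

Lemma two_term_enum C n (M N : basedMod R) (f : {linear M -> N}) : isTwoTerm n f C <->
  exists e : bm_idx M + bm_idx N -> Tot C, [/\ bijective e,
    edeg e =1 sumdeg (fun _ => n + 1) (fun _ => n) & cmat e = mblk 0 (lmx f) 0 0].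
Proof.
have n1 : n + 1 != n by rewrite -subr_eq0 addrAC subrr add0r.
split.
  move=> [a [b [/basedIso_idx[s [si sK siK] sE] /basedIso_idx[t [ti tK tiK] tE] ab C0]]].
  pose e (x : bm_idx M + bm_idx N) : Tot C := match x with inl x => tot (si x) | inr x => tot (ti x) end.
  have be : bijective e.
    apply: inj_surj_bij => [[x|x] [y|y] h|[m x]].
    - by move: h => /tot_inj /(can_inj siK) ->.
    - by have /eqP := congr1 (@tag _ _) h; rewrite (negPf n1).
    - by have /esym/eqP := congr1 (@tag _ _) h; rewrite (negPf n1).
    - by move: h => /tot_inj /(can_inj tiK) ->.
    have [mn|mn1] := eqVneq m (n + 1).
      by subst m; exists (inl (s x)); rewrite /= sK.
    have [mn|mn] := eqVneq m n.
      by subst m; exists (inr (t x)); rewrite /= tK.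
    have /eqP := bm_coord_vec x x.
    by rewrite (C0 m mn1 mn (bm_vec x)) bm_coord0 eqxx eq_sym oner_eq0.
  have [ei en] := bij_isEnum be.
  exists e; split=> //; first by case.
  have [h _] := enum_cpx en.
  apply: matP => b1 b2; have [c0|/h] := eqVneq (cmat e b1 b2) 0; last first.
    move: b1 b2 => [x|x] [y|y]; rewrite /edeg /= => hd; try (by lia).
    rewrite (@enum_entry _ _ e _ _ _ _ (si x) (ti y)) // /lmx.
    have bE z c : bm_coord (b z) (t c) = bm_coord z c.
      rewrite coord_lin (bigD1 c) //= /lmx tE bm_coord_vec eqxx mulr1 big1 ?addr0 // => d dc.
      by rewrite tE bm_coord_vec (inj_eq (can_inj tK)) (negPf dc) mulr0.
    by rewrite -bE -ab sE tiK siK.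
  rewrite c0; move: b1 b2 c0 => [x|x] [y|y] //.
  rewrite (@enum_entry _ _ e _ _ _ _ (si x) (ti y)) // /lmx.
  have bE z c : bm_coord (b z) (t c) = bm_coord z c.
    rewrite coord_lin (bigD1 c) //= /lmx tE bm_coord_vec eqxx mulr1 big1 ?addr0 // => d dc.
    by rewrite tE bm_coord_vec (inj_eq (can_inj tK)) (negPf dc) mulr0.
  by rewrite -bE -ab sE tiK siK.
move=> [e [be ed ec]]; have [ei en] := bij_isEnum be.
have S : forall x : bm_idx (C (n + 1)), exists m, ei (tot x) = inl m.
  move=> x; have := edegE en x; rewrite ed; case: (ei (tot x)) => [m|m] /=; first by exists m.
  by move=> h; rewrite -h eqxx in n1.
have T : forall x : bm_idx (C n), exists m, ei (tot x) = inr m.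
  move=> x; have := edegE en x; rewrite ed; case: (ei (tot x)) => [m|m] /=; last by exists m.
  by move=> h; rewrite h eqxx in n1.
have [s sE] := choice S; have [t tE] := choice T.
have bs : bijective s.
  apply: inj_surj_bij => [x y|m].
    by move=> h; apply: (@tot_inj C (n + 1)); apply: (can_inj en.2); rewrite !sE h.
  have := ed (inl m); rewrite /edeg; case E1: (e _) => [k x] /= ordclass; subst k; exists x.
  by have := sE x; rewrite -[tot x]E1 en.1 => -[].
have bt : bijective t.
  apply: inj_surj_bij => [x y|m].
    by move=> h; apply: (@tot_inj C n); apply: (can_inj en.2); rewrite !tE h.
  have := ed (inr m); rewrite /edeg; case E1: (e _) => [k x] /= ordclass; subst k; exists x.
  by have := tE x; rewrite -[tot x]E1 en.1 => -[].
exists (mx_map (idxmx R s)), (mx_map (idxmx R t)); split.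
- by apply: (idx_basedIso bs) => b; rewrite /= mx_map_idx.
- by apply: (idx_basedIso bt) => b; rewrite /= mx_map_idx.
- have := @linear_ext _ _ _ (f \o mx_map (idxmx R s)) (mx_map (idxmx R t) \o cc_d C (n + 1) n).
  apply=> b; apply: bm_coord_inj => c; rewrite /= mx_map_idx coord_mx_map.
  have [u tu ut] := bt.
  rewrite -[LHS]/(lmx f (s b) c) (bigD1 (u c)) //= /idxmx ut eqxx mulr1 big1 ?addr0.
    rewrite -[RHS]/(lmx (cc_d C (n + 1) n) b (u c)) -(fmatE en (fun i j x => cc_d C i j x)).
    by rewrite -/(cmat e) ec sE tE ut.
  by move=> d du; case: eqP => [h|]; rewrite ?mulr0 //; rewrite -h tu eqxx in du.
move=> m m1 m2 x; apply: bm_coord_inj => c.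
have := edegE en c; rewrite ed; case: (ei _) => [y|y] /= h.
  by rewrite h eqxx in m1.
by rewrite h eqxx in m2.
Qed.

Section Std.
Variables (B : finType) (deg : B -> int) (c : mat R B B).
Hypothesis hc : cpx deg c.

Let Bn (n : int) : finType := {b : B | deg b == n}.
Let rk (n : int) : nat := #|Bn n|.
Let bo n (p : 'I_(rk n)) : B := val (enum_val p).

Let sd i j : {linear stdMod R (rk i) -> stdMod R (rk j)} :=
  @mx_map R (stdMod R (rk i)) (stdMod R (rk j)) (fun p q => c (bo p) (bo q)).

Let deg_bo n (p : 'I_(rk n)) : deg (bo p) = n.
Proof. by rewrite /bo; case: (enum_val p) => b /= /eqP. Qed.

Let sd_shape i j : i != j + 1 -> forall x, sd i j x = 0.
Proof.
move=> ij; apply: (@linear_ext _ (stdMod R (rk i)) (stdMod R (rk j)) (sd i j) \0) => b.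
rewrite /sd /= (@mx_map_vec _ (stdMod R (rk i)) (stdMod R (rk j))) big1 // => q _.
have [->|/hc.1] := eqVneq (c (bo b) (bo q)) 0; first by rewrite scale0r.
by rewrite !deg_bo => h; rewrite h subrK eqxx in ij.
Qed.

Let sum_bo n (F : B -> R) : \sum_(b | deg b == n) F b = \sum_(p < rk n) F (bo p).
Proof.
transitivity (\sum_(b in imset (@bo n) (mem (@predT 'I_(rk n)))) F b).
  apply: eq_bigl => b; apply/idP/imsetP => [h|[p _ ->]]; last by rewrite deg_bo.
  by exists (enum_rank (exist (fun b' => deg b' == n) b h : Bn n)); rewrite // /bo enum_rankK.
by rewrite big_imset //= => p q _ _ /val_inj/enum_val_inj.
Qed.

Let sd_dd i j k x : sd j k (sd i j x) = 0.
Proof.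
have [ij|ij] := eqVneq i (j + 1); last by rewrite [sd i j x]sd_shape // linear0.
rewrite /sd [LHS](@mx_map_comp _ (stdMod R _) (stdMod R _) (stdMod R _)).
suff -> : (fun (p : 'I_(rk i)) (q : 'I_(rk j)) => c (bo p) (bo q)) **
    (fun (p : 'I_(rk j)) (q : 'I_(rk k)) => c (bo p) (bo q)) = 0 :> mat R _ _.
  apply: (@bm_coord_inj _ (stdMod R _)) => q; rewrite (@coord_mx_map _ (stdMod R _) (stdMod R _)).
  by rewrite bm_coord0 big1 // => p _; rewrite mat0E mulr0.
apply: matP => p q; rewrite mmulE -(sum_bo j (fun b => c (bo p) b * c b (bo q))).
have E := congr1 (fun m : mat R B B => m (bo p) (bo q)) hc.2.
rewrite mmulE mat0E in E; rewrite mat0E -[RHS]E.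
rewrite [RHS](bigID (fun b => deg b == j)) /= [X in _ + X]big1 ?addr0 // => b bj.
have [->|/hc.1] := eqVneq (c (bo p) b) 0; first by rewrite mul0r.
by rewrite deg_bo => h; case/eqP: bj; rewrite h ij addrK.
Qed.

Let bd : nat := \max_b `|deg b|%N.

Let sd_bounded n : (bd < `|n|)%N -> forall x : stdMod R (rk n), x = 0.
Proof.
move=> nb x; apply: (@bm_coord_inj _ (stdMod R _)) => p.
suff : (`|n| <= bd)%N by rewrite leqNgt nb.
by rewrite -(deg_bo p) (leq_bigmax (bo p)).
Qed.

(** Brings every graded matrix of square zero into the small skeleton that indexes the generators,
    so that classes can be attached to matrices. *)
Lemma std_enum : exists (S : stdCpx R) (e : B -> Tot S),
  [/\ bijective e, edeg e =1 deg & cmat e = c].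
Proof.
pose S : stdCpx R := StdCpx sd_shape sd_dd sd_bounded.
pose e (b : B) : Tot S :=
  @tot R S (deg b) (enum_rank (exist (fun b' => deg b' == deg b) b (eqxx _) : Bn (deg b))).
have boE b : bo (enum_rank (exist (fun b' => deg b' == deg b) b (eqxx _) : Bn (deg b))) = b.
  by rewrite /bo enum_rankK.
exists S, e; split=> //.
  apply: inj_surj_bij => [x y h|[n p]].
    have : bo (tagged (e x)) = bo (tagged (e y)) by rewrite h.
    by rewrite /e /= !boE.
  have hp := deg_bo p; exists (bo p); rewrite /e.
  (* Stated for independent degrees: the degree occurs in the types of both points, and only a free
     [m'] can be substituted. *)
  have key (m m' : int) (h : deg (bo p) == m) (mp : 'I_(rk m')) : m = m' -> bo mp = bo p ->
      @tot R S m (enum_rank (exist (fun b' => deg b' == m) (bo p) h : Bn m)) = @tot R S m' mp.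
    move=> mm hm; subst m'; congr existT; rewrite -[RHS]enum_valK; congr enum_rank.
    by apply: val_inj; rewrite /= -hm.
  exact: key.
apply: matP => b b'; rewrite (@enum_entry _ _ e _ _ _ _ _ _ erefl erefl).
have E i j : lmx (cc_d S i j) = fun p q => c (bo p) (bo q).
  exact: (@lmx_mx_map _ (stdMod R _) (stdMod R _)).
by rewrite E !boE.
Qed.

End Std.

End EnumIso.

(** * The torsion isomorphism for a class of matrices *)

Section Sqz.
Variables (R : nzRingType) (Pm : forall I J : finType, mat R I J -> Prop).
Hypothesis gc : good_class Pm.
Local Notation sqcontr := (sqcontr Pm).

Lemma cpx_re (B B' : finType) (deg : B -> int) (c : mat R B B) (f : B' -> B) :
  bijective f -> cpx deg c -> cpx (deg \o f) (mre f f c).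
Proof.
move=> bf [hc cc]; split; first exact: homog_re.
by rewrite (mre_mmul f f c c bf) cc.
Qed.

Lemma wcontr_re (B B' : finType) (deg : B -> int) (c g u : mat R B B) (f : B' -> B) :
  bijective f -> wcontr Pm deg c g u -> wcontr Pm (deg \o f) (mre f f c) (mre f f g) (mre f f u).
Proof.
move=> bf [hg e ug Pu]; split.
- exact: homog_re.
- by rewrite (mre_mmul f f c g bf) (mre_mmul f f g c bf) -e.
- by rewrite (mre_mmul f f u g bf) (mre_mmul f f g u bf) ug.
- exact: (gc_re gc).
Qed.

Lemma homog_diag (B1 B2 : Type) k (d1 : B1 -> int) (d2 : B2 -> int) (a : mat R B1 B1) (b : mat R B2 B2) :
  homog k d1 a -> homog k d2 b -> homog k (sumdeg d1 d2) (mblk a 0 0 b).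
Proof. by move=> ha hb [i|i] [j|j] /=; rewrite ?mat0E ?eqxx //; [apply: ha | apply: hb]. Qed.

(* The lower left block makes the two contractions into a contraction of the extension only up to
   a triangular map, which is why contractions by weak isomorphisms are convenient here. *)
Lemma sqcontr_blk (B1 B2 : finType) (d1 : B1 -> int) (d2 : B2 -> int) c1 c2 k g1 g2 :
  cpx (sumdeg d1 d2) (mblk c1 0 k c2) ->
  homog 1 d1 g1 -> g1 ** g1 = 0 -> homog 1 d2 g2 -> g2 ** g2 = 0 ->
  Pm ((c1 + g1) ** (c1 + g1)) -> Pm ((c2 + g2) ** (c2 + g2)) ->
  let c := mblk c1 0 k c2 in let g := mblk g1 0 0 g2 in
  exists y, [/\ homog 1 (sumdeg d1 d2) g, g ** g = 0,
    (c + g) ** (c + g) = mblk ((c1 + g1) ** (c1 + g1)) 0 y ((c2 + g2) ** (c2 + g2)) &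
    Pm ((c + g) ** (c + g))].
Proof.
move=> hc h1 gg1 h2 gg2 P1 P2 c g.
have e : (c + g) ** (c + g) = mblk ((c1 + g1) ** (c1 + g1)) 0
    (k ** (c1 + g1) + (c2 + g2) ** k) ((c2 + g2) ** (c2 + g2)).
  by rewrite /c /g mblkD !addr0 mblk_mmul !mmulE0 !addr0 !add0r.
exists (k ** (c1 + g1) + (c2 + g2) ** k); split=> //.
- exact: homog_diag.
- rewrite /g mblk_mmul gg1 gg2 !mmulE0 !addr0.
  by apply: matP => -[i|i] [j|j].
- by rewrite e; apply: (gc_blk gc).
Qed.

Lemma sqcontr_ext (B1 B2 : finType) (d1 : B1 -> int) (d2 : B2 -> int) c1 c2 k :
  cpx (sumdeg d1 d2) (mblk c1 0 k c2) -> sqcontr d1 c1 -> sqcontr d2 c2 ->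
  sqcontr (sumdeg d1 d2) (mblk c1 0 k c2).
Proof.
move=> hc [_ [g1 [h1 gg1 P1]]] [_ [g2 [h2 gg2 P2]]]; split=> //.
have [y [hg gg _ Pg]] := sqcontr_blk hc h1 gg1 h2 gg2 P1 P2.
by exists (mblk g1 0 0 g2).
Qed.

Definition twodeg (I J : Type) (n : int) : I + J -> int := sumdeg (fun _ => n + 1) (fun _ => n).
Arguments twodeg : clear implicits.

Lemma cpx_two (I J : finType) n (a : mat R I J) : cpx (twodeg I J n) (mblk 0 a 0 0).
Proof.
split; first by move=> [i|i] [j|j] /=; rewrite ?mat0E ?eqxx // addrK.
by rewrite mblk_mmul !mmulE0 !addr0; apply: matP => -[i|i] [j|j].
Qed.

Lemma wcontr_two (I J : finType) n (a : mat R I J) (b : mat R J I) :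
  Pm (a ** b) -> Pm (b ** a) ->
  wcontr Pm (twodeg I J n) (mblk 0 a 0 0) (mblk 0 0 b 0) (mblk (a ** b) 0 0 (b ** a)) /\
  (mblk 0 0 b 0 : mat R (I + J)%type (I + J)%type) ** (mblk 0 0 b 0 : mat R (I + J)%type (I + J)%type) = 0.
Proof.
move=> h1 h2; split; last first.
  by rewrite mblk_mmul !mmulE0 !addr0; apply: matP => -[i|i] [j|j].
split.
- by move=> [i|i] [j|j] /=; rewrite ?mat0E ?eqxx.
- by rewrite !mblk_mmul !mmulE0 !addr0 !add0r mblkD !addr0 !add0r.
- by rewrite !mblk_mmul !mmulE0 !addr0 !add0r mmulA.
- exact: (gc_blk gc).
Qed.

(** The homotopy is the partner of $a$ from [gc_dual]: the inverse for isomorphisms, the adjoint for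
    weak isomorphisms. *)
Lemma sqcontr_two (I J : finType) n (a : mat R I J) : Pm a -> sqcontr (twodeg I J n) (mblk 0 a 0 0).
Proof.
move=> ha; have [b [h1 h2]] := gc_dual gc ha.
apply/sqcontr_wcontr; split; first exact: cpx_two.
by do 2! eexists; apply: (@wcontr_two _ _ n a b).
Qed.

End Sqz.
Arguments twodeg : clear implicits.

(** * Classes of complexes and of two-term complexes *)

Section KChClass.
Variables (R : nzRingType).
Variable Pm : forall I J : finType, mat R I J -> Prop.
Hypothesis gc : good_class Pm.
Variable Q : chainCpx R -> Prop.
Hypothesis QE : forall (C : chainCpx R) (B : finType) (e : B -> Tot C), bijective e ->
  (Q C <-> sqcontr Pm (edeg e) (cmat e)).
Local Notation sqcontr := (sqcontr Pm).

Definition hasX (B : finType) (deg : B -> int) (c : mat R B B) : set (KCh Q) :=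
  [set x | exists (S : kch_gen Q) (e : B -> Tot S),
    [/\ bijective e, edeg e =1 deg, cmat e = c & x = kch_class S]].

(** All standard complexes with the given degrees and matrix are isomorphic by [enum_iso], so the
    choice does not matter; under [sqcontr] one exists and the default 0 is not reached. *)
Definition cpxclass (B : finType) (deg : B -> int) (c : mat R B B) : KCh Q := xget 0 (hasX deg c).

Lemma kch_iso (S S' : kch_gen Q) : basedCpxIso S S' -> kch_class S = kch_class S'.
Proof. by move=> h; apply: toQuot_rel; left; left; exists S, S'. Qed.

Lemma cpxclass_class (B : finType) (deg : B -> int) (c : mat R B B) (S : kch_gen Q) (e : B -> Tot S) :
  bijective e -> edeg e =1 deg -> cmat e = c -> cpxclass deg c = kch_class S.
Proof.
move=> be ed ec; have : hasX deg c (cpxclass deg c) by apply: xgetPex; exists (kch_class S), S, e.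
move=> [S' [e' [be' ed' ec' ->]]]; apply: kch_iso.
by apply: (enum_iso be' be) => [b|]; rewrite ?ed ?ed' // ec ec'.
Qed.

Lemma cpxclass_ex (B : finType) (deg : B -> int) (c : mat R B B) : sqcontr deg c ->
  exists (S : kch_gen Q) (e : B -> Tot S), [/\ bijective e, edeg e =1 deg, cmat e = c
    & cpxclass deg c = kch_class S].
Proof.
move=> h; have [S [e [be /funext ed ec]]] := std_enum h.1.
have q : Q S by apply/(QE be); rewrite ed ec.
have ed' b : edeg e b = deg b by rewrite ed.
by exists (KChGen q), e; split=> //; apply: (@cpxclass_class _ _ _ (KChGen q) e).
Qed.

Lemma cpxclass_re (B B' : finType) (deg : B -> int) (c : mat R B B) (f : B' -> B) :
  bijective f -> sqcontr deg c -> cpxclass (deg \o f) (mre f f c) = cpxclass deg c.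
Proof.
move=> bf /cpxclass_ex[S [e [be ed ec ->]]].
apply: (@cpxclass_class _ _ _ S (e \o f)); first exact: bij_comp.
  by move=> b; apply: ed.
by rewrite -ec.
Qed.

Lemma cpxclass_blk (B1 B2 : finType) (d1 : B1 -> int) (d2 : B2 -> int) c1 c2 k :
  cpx (sumdeg d1 d2) (mblk c1 0 k c2) -> sqcontr d1 c1 -> sqcontr d2 c2 ->
  cpxclass (sumdeg d1 d2) (mblk c1 0 k c2) = cpxclass d1 c1 + cpxclass d2 c2.
Proof.
move=> hc h1 h2; have h := sqcontr_ext gc hc h1 h2.
have [S1 [e1 [b1 ed1 ec1 ->]]] := cpxclass_ex h1.
have [S2 [e2 [b2 ed2 ec2 ->]]] := cpxclass_ex h2.
have [S [e [b ed ec ->]]] := cpxclass_ex h.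
rewrite /kch_class -toQuotD; apply: toQuot_rel; left; right; exists S1, S, S2; split=> //.
apply: (enum_exact b1 b2 b (k := k)); last by rewrite ec ec1 ec2.
by case=> x; rewrite ed /= ?ed1 ?ed2.
Qed.

Lemma kch_valueP (C : chainCpx R) (B : finType) (e : B -> Tot C) : bijective e -> Q C ->
  kch_value Q C = [set cpxclass (edeg e) (cmat e)].
Proof.
move=> be qC; apply/seteqP; split=> x /=.
  move=> [S [iso ->]]; have := be => /bij_isEnum[ei en].
  have [S' [e' [be' ed' ec' ->]]] := cpxclass_ex ((QE be).1 qC).
  have isoC : basedCpxIso C S' by apply: (enum_iso be be') => // b; rewrite ed'.
  have bp := pe_bij S.
  have [f [bf fd fc]] := iso_enum bp iso.
  have [f' [bf' fd' fc']] := iso_enum bf isoC.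
  apply: kch_iso; apply: (enum_iso bp bf'); last by rewrite fc fc'.
  by move=> b; rewrite fd fd'.
move=> ->; have [S [e' [be' ed' ec' ->]]] := cpxclass_ex ((QE be).1 qC).
by exists S; split=> //; apply: (enum_iso be' be).
Qed.

Definition pairclass n (I J : finType) (a : mat R I J) : KCh Q := cpxclass (twodeg I J n) (mblk 0 a 0 0).

Lemma pairclass_re n (I J I' J' : finType) (f : I' -> I) (g : J' -> J) (a : mat R I J) :
  bijective f -> bijective g -> Pm a -> pairclass n (mre f g a) = pairclass n a.
Proof.
move=> bf bg ha; rewrite /pairclass -(cpxclass_re (sum_bij bf bg) (sqcontr_two gc n ha)); congr cpxclass.
  by apply: funext => -[].
by apply: matP => -[i|i] [j|j].
Qed.

Lemma kch_onedimP n (M N : basedMod R) (f : {linear M -> N}) : Pm (lmx f) ->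
  [set x | exists S : kch_gen Q, isTwoTerm n f S /\ x = kch_class S] = [set pairclass n (lmx f)].
Proof.
move=> h; apply/seteqP; split=> x /=.
  by move=> [S [/two_term_enum[e [be ed ec]] ->]]; rewrite -(cpxclass_class be ed ec).
move=> ->; have [S [e [be ed ec]]] := cpxclass_ex (sqcontr_two gc n h).
rewrite /pairclass => ->; exists S; split=> //; apply/two_term_enum; by exists e.
Qed.

(** Sorting the four summands by extension instead of by degree shows the complex of a triangular
    map as an extension of two-term complexes. *)
Lemma pairclass_blk n (I I' J J' : finType) (a : mat R I I') (b : mat R J J') (x : mat R J I') :
  Pm a -> Pm b -> pairclass n (mblk a 0 x b) = pairclass n a + pairclass n b.
Proof.
move=> ha hb.
pose k : mat R (J + J') (I + I') := mblk 0 x 0 0.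
pose f (z : (I + I') + (J + J')) : (I + J) + (I' + J') := match z with
  inl (inl i) => inl (inl i) | inl (inr i) => inr (inl i)
  | inr (inl j) => inl (inr j) | inr (inr j) => inr (inr j) end.
have bf : bijective f.
  exists (fun z : (I + J) + (I' + J') => match z with
    inl (inl i) => inl (inl i) | inl (inr j) => inr (inl j)
    | inr (inl i) => inl (inr i) | inr (inr j) => inr (inr j) end); by case=> -[].
have h := sqcontr_two gc n (gc_blk gc x ha hb).
have E : mblk (mblk 0 a 0 0) 0 k (mblk 0 b 0 0) = mre f f (mblk 0 (mblk a 0 x b) 0 0).
  by apply: matP => -[[i|i]|[i|i]] [[j|j]|[j|j]].
have D : sumdeg (twodeg I I' n) (twodeg J J' n) = twodeg (I + J)%type (I' + J')%type n \o f.
  by apply: funext => -[[i|i]|[i|i]].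
rewrite /pairclass -(cpxclass_re bf h) -D -E cpxclass_blk //; try exact: sqcontr_two.
by rewrite D E; apply: cpx_re => //; exact: h.1.
Qed.

Definition sgn_one (b : bool) (I : finType) : mat R I I := if b then - mone I else mone I.
Arguments sgn_one : clear implicits.

Lemma Pm_sgn b (I : finType) : Pm (sgn_one b I).
Proof. by case: b; [exact: gc_opp | exact: gc_one]. Qed.

Lemma pairclass_sgn n b (I : finType) : pairclass n (sgn_one b I) = 0.
Proof.
suff H m : pairclass n (sgn_one b 'I_m) = 0.
  have [h bh] := @bij_ord I I erefl.
  rewrite -(pairclass_re n bh bh (Pm_sgn b I)) -[RHS](H #|I|); congr pairclass.
  by apply: matP => i j; rewrite /mre /sgn_one /mone; case: (b); rewrite ?matNE (bij_eq bh).
have E1 : pairclass n (sgn_one b 'I_1) = 0.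
  pose f : {linear stdMod R 1 -> stdMod R 1} := @mx_map R (stdMod R 1) (stdMod R 1) (sgn_one b 'I_1).
  have lf : lmx f = sgn_one b 'I_1 by exact: (@lmx_mx_map _ (stdMod R 1)).
  have h := @kch_onedimP n _ _ f; rewrite lf in h.
  have [S [tS ->]] : [set x | exists S : kch_gen Q, isTwoTerm n f S /\ x = kch_class S]
    (pairclass n (sgn_one b 'I_1)) by rewrite h //; exact: Pm_sgn.
  rewrite -(toQuot0 (kch_iso_rel (Q:=Q) `|` kch_exact_rel (Q:=Q) `|` kch_elem_rel (Q:=Q))).
  apply: toQuot_rel; rewrite subr0; right; exists n, S; split=> //.
  have fE x : f x = (if b then - x else x).
    apply: (@bm_coord_inj _ (stdMod R 1)) => c; rewrite (@coord_mx_map _ (stdMod R 1) (stdMod R 1)).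
    rewrite big_ord1 !ord1 /sgn_one; case: (b) => /=.
      by rewrite matNE /mone eqxx mulrN mulr1 mxE.
    by rewrite /mone eqxx mulr1.
  case: tS => [p [q [hp hq fp z]]]; move: fE; case: (b) => fE; [right|left];
    by exists p, q; split=> // x; rewrite -fp fE.
elim: m => [|m ih].
  (* The empty complex is its own direct sum, so its class equals twice itself. *)
  apply: (addrI (pairclass n (sgn_one b 'I_0))); rewrite addr0 -(@pairclass_blk _ _ _ _ _ _ _ 0) //; try exact: Pm_sgn.
  have b0 : bijective (fun i : 'I_0 => inl i : 'I_0 + 'I_0).
    by apply: inj_surj_bij => [[]|[[]|[]]].
  rewrite -(pairclass_re n b0 b0); last by apply: (gc_blk gc); exact: Pm_sgn.
  by congr pairclass.
have bs := split_bij 1 m.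
rewrite -[RHS]addr0 -{1}E1 -ih -(@pairclass_blk _ _ _ _ _ _ _ 0) //; try exact: Pm_sgn.
rewrite -(pairclass_re n bs bs); last by apply: (gc_blk gc); exact: Pm_sgn.
congr pairclass; apply: matP => i j; rewrite /mre.
have -> : sgn_one b 'I_m.+1 i j = sgn_one b ('I_1 + 'I_m)%type (@fintype.split 1 m i) (@fintype.split 1 m j).
  by rewrite /sgn_one /mone; case: (b); rewrite ?matNE (bij_eq bs).
case: (@fintype.split 1 m i) => i'; case: (@fintype.split 1 m j) => j' /=; rewrite /sgn_one; case: (b);
  by rewrite ?matE ?oppr0.
Qed.

(* The mapping cone of (1, b) from the complex of a to the complex of a b is also an extension of
   the complex of b by a trivial one. *)
Lemma pairclass_cone n (I J L : finType) (a : mat R I J) (b : mat R J L) : Pm a -> Pm b ->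
  pairclass n (a ** b) + pairclass (n + 1) a = pairclass n b.
Proof.
move=> ha hb; have hab := gc_mul gc ha hb.
(* The sign makes the two paths $-ab$ and $ab$ cancel in the square of the differential. *)
pose k1 : mat R (I + J) (I + L) := mblk (- mone I) 0 0 b.
pose k2 : mat R (I + I) (J + L) := mblk a 0 0 (a ** b).
pose t1 : mat R (I + L + (I + J)) (I + L + (I + J)) := mblk (mblk 0 (a ** b) 0 0) 0 k1 (mblk 0 a 0 0).
pose t2 : mat R (J + L + (I + I)) (J + L + (I + I)) := mblk (mblk 0 b 0 0) 0 k2 (mblk 0 (- mone I) 0 0).
pose f (z : (J + L) + (I + I)) : (I + L) + (I + J) := match z with
  inl (inl j) => inr (inr j) | inl (inr l) => inl (inr l)
  | inr (inl i) => inr (inl i) | inr (inr i) => inl (inl i) end.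
have bf : bijective f.
  exists (fun z : (I + L) + (I + J) => match z with
    inl (inl i) => inr (inr i) | inl (inr l) => inl (inr l)
    | inr (inl i) => inr (inl i) | inr (inr j) => inl (inl j) end); by case=> -[].
have E : t2 = mre f f t1 by apply: matP => -[[i|i]|[i|i]] [[j|j]|[j|j]].
have D : sumdeg (twodeg J L n) (twodeg I I (n + 1)) = sumdeg (twodeg I L n) (twodeg I J (n + 1)) \o f.
  by apply: funext => -[[i|i]|[i|i]].
have c1 : cpx (sumdeg (twodeg I L n) (twodeg I J (n + 1))) t1.
  split.
    move=> [[i|i]|[i|i]] [[j|j]|[j|j]] /=; rewrite ?mat0E ?eqxx //= ?addrK //.
  rewrite /t1 /k1 !mblk_mmul !mmulE0 !addr0 !add0r mblkD !addr0 addNr.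
  by apply: matP => -[[i|i]|[i|i]] [[j|j]|[j|j]].
have s1 := sqcontr_two gc n hab; have s2 := sqcontr_two gc (n + 1) ha.
have s3 := sqcontr_two gc n hb; have s4 := sqcontr_two gc (n + 1) (Pm_sgn true I).
have st := sqcontr_ext gc c1 s1 s2.
rewrite /pairclass -(cpxclass_blk c1 s1 s2) -(cpxclass_re bf st) -D -E cpxclass_blk //; last first.
  by rewrite -/t2 E D; apply: cpx_re.
by rewrite -/(pairclass n b) -/(pairclass (n + 1) (sgn_one true I)) pairclass_sgn addr0.
Qed.

(** The cone formula for $b=1$, where the class of the identity vanishes. Inserted back into the
    cone formula it gives multiplicativity. *)
Lemma pairclass_shift n (I J : finType) (a : mat R I J) : Pm a -> pairclass (n + 1) a = - pairclass n a.
Proof.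
move=> ha; have := pairclass_cone n ha (gc_one gc J).
rewrite mmul1r (pairclass_sgn n false J) => h.
by apply/eqP; rewrite -addr_eq0 addrC h.
Qed.

Lemma pairclass_mul n (I J L : finType) (a : mat R I J) (b : mat R J L) : Pm a -> Pm b ->
  pairclass n (a ** b) = pairclass n a + pairclass n b.
Proof.
by move=> ha hb; rewrite -(pairclass_cone n ha hb) pairclass_shift // addrCA subrr addr0.
Qed.

End KChClass.
Arguments sgn_one R b I : clear implicits.

(** * The torsion of a graded matrix and the map in the other direction *)

Section Iso.
Variables (R : nzRingType).
Variable Pm : forall I J : finType, mat R I J -> Prop.
Hypothesis gc : good_class Pm.
Variable P : forall M N : basedMod R, (M -> N) -> Prop.
Hypothesis PE : forall (M N : basedMod R) (f : {linear M -> N}), P f <-> Pm (lmx f).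
Variable Q : chainCpx R -> Prop.
Hypothesis QE : forall (C : chainCpx R) (B : finType) (e : B -> Tot C), bijective e ->
  (Q C <-> sqcontr Pm (edeg e) (cmat e)).
Local Notation sqcontr := (sqcontr Pm).
Local Notation mxclass := (mxclass PE).
Local Notation K := (K1t P).
Local Notation KC := (KCh Q).
Local Notation pairclass := (@pairclass R Q).
Local Notation cpxclass := (@cpxclass R Q).

Lemma k1t_ind (p : K -> Prop) : p 0 -> (forall x y, p x -> p y -> p (x - y)) ->
  (forall n (a : mat R 'I_n 'I_n), Pm a -> p (mxclass a)) -> forall x, p x.
Proof.
move=> p0 pB pk x; have [u ->] := toQuot_surj x; have [v ->] := toQuot_surj u.
apply: (@free_ind _ (fun v => p (toQuot _ (toQuot _ v)))) => [|v1 v2|g].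
- by rewrite !toQuot0.
- by rewrite !toQuotB; exact: pB.
have Pg : Pm (lmx (k1_map g)) := (PE _).1 (k1_mapP g).
by rewrite -[toQuot _ _]/(k1t_class g) (ordclass_class gc PE) -(mxclass_ord gc PE Pg); exact: pk.
Qed.

Lemma kch_ind (p : KC -> Prop) : p 0 -> (forall x y, p x -> p y -> p (x - y)) ->
  (forall (B : finType) (deg : B -> int) (c : mat R B B), sqcontr deg c -> p (cpxclass deg c)) ->
  forall x, p x.
Proof.
move=> p0 pB pk x; have [v ->] := toQuot_surj x.
apply: (@free_ind _ (fun v => p (toQuot _ v))) => [|v1 v2|S].
- by rewrite !toQuot0.
- by rewrite !toQuotB; exact: pB.
have be := pe_bij S; rewrite -[toQuot _ _]/(kch_class S) -(@cpxclass_class _ _ _ (edeg (@pe R S)) (cmat (@pe R S)) _ _ be) //.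
by apply: pk; apply/(QE be); exact: kch_cpxP.
Qed.

(** A generator goes to its two-term complex. The relations hold by [pairclass_mul] for composites,
    [pairclass_blk] for blocks and [pairclass_sgn] for $-\mathrm{id}$. *)
Lemma rho_inv_ex : exists ri : {additive K -> KC},
  forall (I J : finType) (a : mat R I J), Pm a -> ri (mxclass a) = pairclass 0 a.
Proof.
have [phi phiE] := free_lift (fun g : k1_gen P => pairclass 0 (lmx (k1_map g))).
have Pg (g : k1_gen P) : Pm (lmx (k1_map g)) := (PE _).1 (k1_mapP g).
have [s|psi psiE] := @quot_lift _ _ (k1_comp_rel (P:=P) `|` k1_block_rel (P:=P)) phi.
  case=> [[n [f1 [f2 [f [h1 [h2 [h [e ->]]]]]]]]|].
    rewrite raddfB raddfD !phiE /=.
    have -> : lmx f = lmx f1 ** lmx f2.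
      by rewrite -lmx_comp; apply: matP => b c; rewrite /lmx e.
    by rewrite (pairclass_mul gc QE) ?subrr //; [exact: ((PE f1).1 h1) | exact: ((PE f2).1 h2)].
  move=> [m [n [f0 [f1 [f2 [f [h0 [h2 [h [e ->]]]]]]]]]].
  rewrite raddfB raddfD !phiE /=.
  have P0 : Pm (lmx f0) := (PE f0).1 h0.
  have P2 : Pm (lmx f2) := (PE f2).1 h2.
  have -> : lmx f = mre (@fintype.split m n) (@fintype.split m n)
      (mblk (lmx f0) 0 (lmx f1) (lmx f2)).
    apply: matP => i j; rewrite /mre.
    have vE : @bm_vec R (stdMod R (m + n)) i = match fintype.split i with
        | inl i => row_mx (delta_mx 0 i) 0 | inr i => row_mx 0 (delta_mx 0 i) end.
      apply/rowP => k; rewrite -[k]splitK -[i in LHS]splitK.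
      case: (fintype.split i) => i'; case: (fintype.split k) => k' /=;
        rewrite ?(row_mxEl, row_mxEr) !mxE ?eqxx /=;
        by rewrite ?eq_lshift ?eq_rshift ?eq_lrshift ?eq_rlshift.
    rewrite /lmx vE; case: (fintype.split i) => i'; rewrite e -[X in X = _]/((row_mx _ _ : 'rV_(m + n)) 0 j);
      rewrite -[j]splitK; case: (fintype.split j) => j' /=; rewrite ?(unsplitK (inl _)) ?(unsplitK (inr _)) /=
        ?(row_mxEl, row_mxEr) ?linear0 ?addr0 ?add0r //.
    by rewrite mxE.
  rewrite (pairclass_re gc QE) //; try exact: split_bij; last exact: (gc_blk gc).
  by rewrite (pairclass_blk gc QE) // subrr.
have [s|ri riE] := @quot_lift _ _ (k1_minus_id (P:=P)) psi.
  move=> [f [h [e ->]]]; rewrite /k1_class psiE phiE /=.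
  have -> : lmx f = sgn_one R true 'I_1.
    apply: matP => b c; rewrite /lmx e /sgn_one matNE /mone /= !mxE.
    by rewrite eqxx /= eq_sym.
  exact: (pairclass_sgn gc QE).
exists ri => I J a ha.
have [k bk] := bij_ord (gc_card gc ha); have [h bh] := @bij_ord I I erefl.
have Pa' := gc_re gc bh bk ha.
rewrite (mxclass_eq gc PE ha bh bk) (ordclassE PE (P_mx PE Pa')) /k1t_class riE /k1_class psiE phiE /=.
by rewrite (@lmx_mx_map _ (stdMod R _) (stdMod R _)) (pairclass_re gc QE).
Qed.

(** Admits every splitting into odd and even degrees and every weak contraction, so that any
    concrete torsion is compared by a single membership. *)
Definition torsions (B : finType) (deg : B -> int) (c : mat R B B) : set K :=
  [set t | exists (B1 B2 : finType) (s : B1 + B2 -> B) g u,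
    [/\ bijective s, parity (deg \o s), wcontr Pm (deg \o s) (mre s s c) g u
      & t = torsionval PE (mre s s c) g u]].

Definition torsion (B : finType) (deg : B -> int) (c : mat R B B) : K := xget 0 (torsions deg c).

Lemma parity_split (B : finType) (deg : B -> int) :
  exists (B1 B2 : finType) (s : B1 + B2 -> B), bijective s /\ parity (deg \o s).
Proof.
pose p := [pred b | (deg b %% 2)%Z == 1].
exists {i | p i}, {i | ~~ p i}, (@sub_split B p); split; first exact: sub_split_bij.
split=> -[i hi] /=; first exact/eqP.
by move: hi => /=; lia.
Qed.

Lemma parity_unique (B B1 B2 B1' B2' : finType) (deg : B -> int) (s : B1 + B2 -> B)
  (s' : B1' + B2' -> B) : bijective s -> bijective s' -> parity (deg \o s) -> parity (deg \o s') ->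
  exists (f : B1 -> B1') (g : B2 -> B2'), [/\ bijective f, bijective g,
    s \o inl = s' \o inl \o f & s \o inr = s' \o inr \o g].
Proof.
move=> bs bs' [p1 p2] [p1' p2']; have is' := bij_inj bs'; have is_ := bij_inj bs.
have [t st ts] := bs; have [t' st' ts'] := bs'.
have /choice[f fE] : forall b, exists b', s' (inl b') = s (inl b).
  move=> b; case E : (t' (s (inl b))) => [b'|b'].
    by exists b'; rewrite -E ts'.
  have := p2' b'; rewrite -E /= ts'; have /= -> := p1 b; by [].
have /choice[g gE] : forall b, exists b', s' (inr b') = s (inr b).
  move=> b; case E : (t' (s (inr b))) => [b'|b'].
    have := p1' b'; rewrite -E /= ts'; have /= -> := p2 b; by [].
  by exists b'; rewrite -E ts'.
exists f, g; split.
- apply: inj_surj_bij => [x y h|y].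
    by have := fE x; rewrite h fE => /is_[].
  case E : (t (s' (inl y))) => [b|b].
    by exists b; have := fE b; rewrite -E ts => /is'[].
  by have := p2 b; rewrite -E /= ts; have /= -> := p1' y.
- apply: inj_surj_bij => [x y h|y].
    by have := gE x; rewrite h gE => /is_[].
  case E : (t (s' (inr y))) => [b|b].
    by have := p1 b; rewrite -E /= ts; have /= -> := p2' y.
  by exists b; have := gE b; rewrite -E ts => /is'[].
- by apply: funext => b; rewrite /= fE.
- by apply: funext => b; rewrite /= gE.
Qed.

(** [torsionval_indep] compares an arbitrary contraction with one of square zero, so fixing one such
    $d$ makes all values agree; [parity_unique] takes care of the splitting. *)
Lemma torsions_sq (B : finType) (deg : B -> int) (c d v : mat R B B) (B1 B2 : finType)
    (s : B1 + B2 -> B) t :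
  cpx deg c -> wcontr Pm deg c d v -> d ** d = 0 -> bijective s -> parity (deg \o s) ->
  torsions deg c t -> t = torsionval PE (mre s s c) (mre s s d) (mre s s v).
Proof.
move=> hc hd dd bs ps [B1' [B2' [s' [g [u [bs' ps' h ->]]]]]].
have hd' := wcontr_re gc bs' hd; have hc' := cpx_re bs' hc.
have dd' : mre s' s' d ** mre s' s' d = 0 by rewrite (mre_mmul s' s' d d bs') dd.
rewrite (torsionval_indep gc PE ps' hc' h hd' dd').
have [PT Po _ _] := wcontr_facts gc PE ps' hc' hd'.
have [f [k [bf bk ef ek]]] := parity_unique bs bs' ps ps'.
rewrite /torsionval (mre_mmul s s c v bs) (mre_mmul s' s' c v bs') in PT *.
have E1 (a : mat R B B) : mre inl inr (mre s s a) = mre f k (mre inl inr (mre s' s' a)).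
  by rewrite -[LHS]/(mre (s \o inl) (s \o inr) a) ef ek.
have E2 (a : mat R B B) : mre inl inl (mre s s a) = mre f f (mre inl inl (mre s' s' a)).
  by rewrite -[LHS]/(mre (s \o inl) (s \o inl) a) ef.
rewrite -!mreD in PT *.
by rewrite E1 E2 (mxclass_re gc PE bf bk PT) (mxclass_re gc PE bf bf Po).
Qed.

Lemma torsion_sq (B : finType) (deg : B -> int) (c d v : mat R B B) (B1 B2 : finType)
    (s : B1 + B2 -> B) :
  cpx deg c -> wcontr Pm deg c d v -> d ** d = 0 -> bijective s -> parity (deg \o s) ->
  torsion deg c = torsionval PE (mre s s c) (mre s s d) (mre s s v).
Proof.
move=> hc hd dd bs ps; apply: (torsions_sq hc hd dd bs ps); apply: xgetPex.
exists (torsionval PE (mre s s c) (mre s s d) (mre s s v)), B1, B2, s, (mre s s d), (mre s s v).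
by split=> //; exact: wcontr_re.
Qed.

Lemma torsions_torsion (B : finType) (deg : B -> int) (c : mat R B B) t :
  sqcontr deg c -> torsions deg c t -> t = torsion deg c.
Proof.
move=> /sqcontr_wcontr[hc [d [v [hd dd]]]] ht; have [B1 [B2 [s [bs ps]]]] := parity_split deg.
by rewrite (torsion_sq hc hd dd bs ps); apply: (torsions_sq hc hd dd bs ps).
Qed.

Lemma torsion_blk (B1 B2 : finType) (d1 : B1 -> int) (d2 : B2 -> int) c1 c2 k :
  cpx (sumdeg d1 d2) (mblk c1 0 k c2) -> sqcontr d1 c1 -> sqcontr d2 c2 ->
  torsion (sumdeg d1 d2) (mblk c1 0 k c2) = torsion d1 c1 + torsion d2 c2.
Proof.
move=> hc [hc1 [g1 [h1 gg1 P1]]] [hc2 [g2 [h2 gg2 P2]]].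
have [y [hg gg e Pg]] := sqcontr_blk gc hc h1 gg1 h2 gg2 P1 P2.
set c := mblk c1 0 k c2 in e Pg hc *; set g := mblk g1 0 0 g2 in e Pg hg gg *.
have mk (B : finType) (deg : B -> int) (x z : mat R B B) : cpx deg x -> homog 1 deg z ->
    z ** z = 0 -> Pm ((x + z) ** (x + z)) -> wcontr Pm deg x z ((x + z) ** (x + z)).
  move=> [hx xx] hz zz Pz; rewrite sq_sum // in Pz *; split=> //.
  rewrite mmulDl mmulDr -[x ** z ** z]mmulA zz mmul0r add0r.
  by rewrite [z ** (z ** x)]mmulA zz mmul0l addr0 mmulA.
have k1 := mk _ _ _ _ hc1 h1 gg1 P1; have k2 := mk _ _ _ _ hc2 h2 gg2 P2.
have k0 := mk _ _ _ _ hc hg gg Pg.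
have [O1 [E1 [s1 [bs1 ps1]]]] := parity_split d1.
have [O2 [E2 [s2 [bs2 ps2]]]] := parity_split d2.
(* The splitting of the extension lists both odd parts before both even parts; the parity blocks are
   then triangular with the blocks of the two complexes on the diagonal. *)
pose s (z : (O1 + O2) + (E1 + E2)) : B1 + B2 := match z with
  inl (inl x) => inl (s1 (inl x)) | inl (inr x) => inr (s2 (inl x))
  | inr (inl x) => inl (s1 (inr x)) | inr (inr x) => inr (s2 (inr x)) end.
have bs : bijective s.
  have [t1 st1 ts1] := bs1; have [t2 st2 ts2] := bs2.
  exists (fun z : B1 + B2 => match z with
    inl x => match t1 x with inl o => inl (inl o) | inr o => inr (inl o) end
    | inr x => match t2 x with inl o => inl (inr o) | inr o => inr (inr o) end end).
    by case=> -[x|x] /=; rewrite ?st1 ?st2.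
  case=> x /=.
    by case E : (t1 x) => [o|o] /=; rewrite -E ts1.
  by case E : (t2 x) => [o|o] /=; rewrite -E ts2.
have ps : parity (sumdeg d1 d2 \o s).
  split=> -[x|x] /=; [exact: ps1.1|exact: ps2.1|exact: ps1.2|exact: ps2.2].
rewrite (torsion_sq hc k0 gg bs ps) (torsion_sq hc1 k1 gg1 bs1 ps1) (torsion_sq hc2 k2 gg2 bs2 ps2).
have [PT1 Po1 _ _] := wcontr_facts gc PE ps1 (cpx_re bs1 hc1) (wcontr_re gc bs1 k1).
have [PT2 Po2 _ _] := wcontr_facts gc PE ps2 (cpx_re bs2 hc2) (wcontr_re gc bs2 k2).
move: PT1 PT2 Po1 Po2.
set v1 := (c1 + g1) ** _; set v2 := (c2 + g2) ** _; set v := (c + g) ** _.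
rewrite /torsionval (mre_mmul s1 s1 c1 v1 bs1) (mre_mmul s2 s2 c2 v2 bs2) (mre_mmul s s c v bs).
rewrite -!mreD => PT1 PT2 Po1 Po2.
have ve : v = mblk v1 0 y v2 by exact: e.
have Te : c ** v + g = mblk (c1 ** v1 + g1) 0 (k ** v1 + c2 ** y) (c2 ** v2 + g2).
  by rewrite ve /c /g mblk_mmul !mmulE0 !addr0 !add0r mblkD !addr0.
have -> : mre inl inr (mre s s (c ** v + g)) = mblk (mre inl inr (mre s1 s1 (c1 ** v1 + g1))) 0
    (mre (s2 \o inl) (s1 \o inr) (k ** v1 + c2 ** y)) (mre inl inr (mre s2 s2 (c2 ** v2 + g2))).
  by rewrite Te; apply: matP => -[i|i] [j|j].
have -> : mre inl inl (mre s s v) = mblk (mre inl inl (mre s1 s1 v1)) 0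
    (mre (s2 \o inl) (s1 \o inl) y) (mre inl inl (mre s2 s2 v2)).
  by rewrite ve; apply: matP => -[i|i] [j|j].
by rewrite !(mxclass_blk gc PE) // opprD addrACA.
Qed.

(** Degree 1 is the left summand, so the identity splits by parity. With $b$ as homotopy the torsion
    is $[aba]-[ab]=[a]$. *)
Lemma torsion_two (I J : finType) (a : mat R I J) : Pm a -> torsion (twodeg I J 0) (mblk 0 a 0 0) = mxclass a.
Proof.
move=> ha; have [b [h1 h2]] := gc_dual gc ha; have [k dd] := wcontr_two gc 0 h1 h2.
have bi : bijective (fun x : I + J => x) by exists id.
have par : parity (twodeg I J 0 \o (fun x : I + J => x)) by [].
rewrite (torsion_sq (cpx_two 0 a) k dd bi par) /torsionval !mre_id.
have -> : mre inl inr (mblk 0 a 0 0 ** mblk (a ** b) 0 0 (b ** a) + mblk 0 0 b 0) = a ** (b ** a).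
  by rewrite mblk_mmul !mmulE0 !addr0 !add0r mblkD !addr0.
have -> : mre inl inl (mblk (a ** b) 0 0 (b ** a)) = a ** b by [].
by rewrite mmulA (mxclass_mul gc PE h1 ha) addrAC subrr add0r.
Qed.

End Iso.

(** * Folding a complex into two adjacent degrees *)

Section Fold.
Variables (R : nzRingType).
Variable Pm : forall I J : finType, mat R I J -> Prop.
Hypothesis gc : good_class Pm.
Local Notation sqcontr := (sqcontr Pm).

(* With [S] the sum of the differential and a contraction of square zero, the complex can be
   regraded as long as [S] keeps shifting the degree by 1 or -1. *)
Definition graded_root (B : finType) (deg : B -> int) (S : mat R B B) :=
  [/\ forall b b', S b b' != 0 -> deg b' = deg b + 1 \/ deg b' = deg b - 1,
      homog 0 deg (S ** S) & Pm (S ** S)].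

Definition dcomp (k : int) (B : Type) (deg : B -> int) (S : mat R B B) : mat R B B :=
  fun b b' => if deg b' == deg b + k then S b b' else 0.

Lemma dcomp_homog k (B : Type) (deg : B -> int) (S : mat R B B) : homog k deg (dcomp k deg S).
Proof. by move=> b b'; rewrite /dcomp; case: (eqVneq (deg b') (deg b + k)); rewrite ?eqxx. Qed.

Lemma dcomp_sum (B : finType) (deg : B -> int) (S : mat R B B) : graded_root deg S ->
  S = dcomp (-1) deg S + dcomp 1 deg S.
Proof.
move=> [h _ _]; apply: matP => b b'; rewrite matDE /dcomp.
have [->|/h hd] := eqVneq (S b b') 0; first by rewrite !if_same addr0.
case: hd => ->; rewrite eqxx ?addr0.
  by rewrite (inj_eq (addrI _)) add0r.
by rewrite (inj_eq (addrI _)) addr0.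
Qed.

(** For $S=l+u$ the terms $l^2$, $lu+ul$ and $u^2$ have degrees $-2$, 0 and 2. As $S^2$ has degree
    0, the outer two vanish. *)
Lemma root_cpx (B : finType) (deg : B -> int) (S : mat R B B) : graded_root deg S ->
  dcomp (-1) deg S ** dcomp (-1) deg S = 0 /\ dcomp 1 deg S ** dcomp 1 deg S = 0.
Proof.
move=> g; have e := dcomp_sum g; have [h h0 _] := g.
set l := dcomp (-1) deg S in e *; set u := dcomp 1 deg S in e *.
have hl : homog (-1) deg l by exact: dcomp_homog.
have hu : homog 1 deg u by exact: dcomp_homog.
have hll : homog (-1 + -1) deg (l ** l) := homog_mul hl hl.
have huu : homog (1 + 1) deg (u ** u) := homog_mul hu hu.
have hlu : homog 0 deg (l ** u + u ** l).
  by apply: homog_add; [exact: (homog_mul hl hu) | exact: (homog_mul hu hl)].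
have E b b' : (S ** S) b b' = (l ** l) b b' + (l ** u + u ** l) b b' + (u ** u) b b'.
  by rewrite e mmulDl !mmulDr !matDE !addrA.
have z k (a : mat R B B) b b' : homog k deg a -> deg b' != deg b + k -> a b b' = 0.
  by move=> ha n; apply/eqP; apply: contraNT n => /ha ->.
split; apply: matP => b b'; rewrite mat0E; apply/eqP; apply: contraT.
  move=> n; have d := hll _ _ n; case/eqP: n.
  have := E b b'; rewrite (z _ _ _ _ h0) ?(z _ _ _ _ hlu) ?(z _ _ _ _ huu) ?addr0 => [<- //|||];
    by rewrite d; lia.
move=> n; have d := huu _ _ n; case/eqP: n.
have := E b b'; rewrite (z _ _ _ _ h0) ?(z _ _ _ _ hlu) ?(z _ _ _ _ hll) ?addr0 ?add0r => [<- //|||];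
  by rewrite d; lia.
Qed.

Lemma root_sqcontr (B : finType) (deg : B -> int) (S : mat R B B) : graded_root deg S ->
  sqcontr deg (dcomp (-1) deg S).
Proof.
move=> g; have [h1 h2] := root_cpx g; split; first by split=> //; exact: dcomp_homog.
exists (dcomp 1 deg S); split=> //; first exact: dcomp_homog.
by rewrite -dcomp_sum //; case: g.
Qed.

Lemma sqcontr_root (B : finType) (deg : B -> int) (c : mat R B B) : sqcontr deg c ->
  exists S, graded_root deg S /\ c = dcomp (-1) deg S.
Proof.
move=> [[hc cc] [d [hd dd h]]]; exists (c + d); split.
  split=> //.
    by move=> b b'; rewrite matDE => /add_neq0[/hc|/hd] ->; [right|left].
  rewrite sq_sum //; apply: homog_add; [exact: (homog_mul hc hd) | exact: (homog_mul hd hc)].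
apply: matP => b b'; rewrite /dcomp matDE.
have [->|/hc hb] := eqVneq (c b b') 0.
  rewrite add0r; have [->|/hd hb] := eqVneq (d b b') 0; first by rewrite if_same.
  by rewrite hb (inj_eq (addrI _)).
rewrite hb eqxx; have [->|/hd] := eqVneq (d b b') 0; first by rewrite addr0.
by rewrite hb => /addrI.
Qed.

End Fold.

Section Surj.
Variables (R : nzRingType).
Variable Pm : forall I J : finType, mat R I J -> Prop.
Hypothesis gc : good_class Pm.
Variable Q : chainCpx R -> Prop.
Hypothesis QE : forall (C : chainCpx R) (B : finType) (e : B -> Tot C), bijective e ->
  (Q C <-> sqcontr Pm (edeg e) (cmat e)).
Local Notation sqcontr := (sqcontr Pm).
Local Notation KC := (KCh Q).
Local Notation pairclass := (@pairclass R Q).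
Local Notation cpxclass := (@cpxclass R Q).
Variable Im : KC -> Prop.
Hypothesis ImB : forall x y, Im x -> Im y -> Im (x - y).
Hypothesis ImE : forall (I J : finType) (a : mat R I J), Pm a -> Im (pairclass 0 a).

Lemma Im0 : Im 0.
Proof. by rewrite -(pairclass_sgn gc QE 0 false void); apply: ImE; apply: gc_one. Qed.

Lemma ImN x : Im x -> Im (- x).
Proof. by move=> h; rewrite -sub0r; apply: ImB => //; exact: Im0. Qed.

Lemma Im_pairclass n (I J : finType) (a : mat R I J) : Pm a -> Im (pairclass n a).
Proof.
move=> ha; have up (m : nat) : Im (pairclass m%:Z a).
  elim: m => [|m ih]; first exact: ImE.
  by rewrite -addn1 PoszD (pairclass_shift gc QE) //; exact: ImN.
case: n => // n; rewrite NegzE; elim: n => [|n ih].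
  by rewrite -[pairclass _ a]opprK -(pairclass_shift gc QE) //; apply: ImN; rewrite addNr; exact: ImE.
rewrite -[pairclass _ a]opprK -(pairclass_shift gc QE) //; apply: ImN.
have -> : - n.+2%:Z + 1 = - n.+1%:Z :> int by lia.
exact: ih.
Qed.

(** Let $T$ be the basis in the top degree $d$ and $v$ the restriction of $S^2$ to it. The complex
    [t1] extends [l] by $v\colon T\to T$ in degrees $d-1$ and $d-2$. Regrouped, it extends $-1\colon
    T\to T$ in degrees $d$ and $d-1$ by the folded complex, in which the copy of $T$ in degree $d-2$
    has replaced the top one. As the class of $-1$ vanishes, folding changes the class by that of
    $v$ only. *)
Lemma fold_step (B : finType) (deg : B -> int) (S : mat R B B) (d : int) :
  graded_root Pm deg S -> (forall b, deg b <= d) ->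
  let deg' b := if deg b == d then d - 2 else deg b in
  graded_root Pm deg' S /\
  (Im (cpxclass deg' (dcomp (-1) deg' S)) -> Im (cpxclass deg (dcomp (-1) deg S))).
Proof.
move=> g dmax deg'; have [h1 h2 h3] := g.
have g' : graded_root Pm deg' S.
  split=> //; rewrite /deg'.
    move=> b b' /h1; have := dmax b; have := dmax b'.
    by case: eqP; case: eqP; lia.
  by move=> b b' /h2; rewrite /deg' !addr0 => ->.
split=> //.
have [ll uu] := root_cpx g; have s := root_sqcontr g; have s' := root_sqcontr g'.
have Se := dcomp_sum g.
set l := dcomp (-1) deg S in ll s Se *; set u := dcomp 1 deg S in uu Se *.
set l' := dcomp (-1) deg' S in s' *.
pose p := [pred b | deg b == d]; pose T : finType := {b | p b}.
have dT (t : T) : deg (val t) = d by case: t => b /= /eqP.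
pose v : mat R T T := mre val val (S ** S).
have Pv : Pm v.
  have bs := sub_split_bij p; have := gc_re gc bs bs h3.
  rewrite [mre _ _ _]mblkE.
  have -> : mre inl inr (mre (@sub_split B p) (@sub_split B p) (S ** S)) = 0.
    apply: matP => -[i hi] [j hj]; apply/eqP; apply: contraT => /h2 /=.
    by move: (hi) (hj) => /= /eqP -> /eqP; rewrite addr0.
  have -> : mre inr inl (mre (@sub_split B p) (@sub_split B p) (S ** S)) = 0.
    apply: matP => -[i hi] [j hj]; apply/eqP; apply: contraT => /h2 /=.
    by move: (hi) (hj) => /= /eqP hh /eqP ->; rewrite addr0 => /esym.
  by move=> /(gc_diag gc)[].
(* Top elements are attached to their copies in degree $d-1$ by $-1$, and elements of degree $d-1$
   to the copies in degree $d-2$ by $u$. The square of [t1] vanishes because $lu=v$ on the top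
   degree. *)
pose k : mat R B (T + T) := fun b t => match t with
  inl t => - (b == val t)%:R | inr t => u b (val t) end.
pose t1 : mat R ((T + T) + B) ((T + T) + B) := mblk (mblk 0 v 0 0) 0 k l.
pose D1 := sumdeg (twodeg T T (d - 2)) deg.
have lT b (t : T) : l b (val t) = 0.
  by rewrite /l /dcomp dT; case: eqP => // e; have := dmax b; lia.
have uT (t : T) b : u (val t) b = 0.
  by rewrite /u /dcomp dT; case: eqP => // e; have := dmax b; lia.
(* In $S^2=lu+ul$ the second term could only contribute for $b$ of top degree, where the rows of $u$
   vanish. *)
have lu b (t : T) : (l ** u) b (val t) = (S ** S) b (val t).
  rewrite Se mmulDl !mmulDr ll uu add0r addr0 matDE.
  have [->|hb] := eqVneq ((u ** l) b (val t)) 0; first by rewrite addr0.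
  have := homog_mul (dcomp_homog (k := 1) (deg := deg) (S := S)) (dcomp_homog (k := -1) (deg := deg) (S := S)) hb.
  rewrite subrr addr0 dT => e.
  have pb : p b by rewrite /= e.
  by case/eqP: hb; rewrite mmulE big1 // => j _; rewrite (uT (exist _ b pb)) mul0r.
have ct1 : cpx D1 t1.
  split.
    move=> [[i|i]|i] [[j|j]|j]; rewrite /t1 /= ?mat0E ?eqxx //=.
    - by move=> _; lia.
    - rewrite oppr_eq0; case: (eqVneq i (val j)) => [-> _|]; last by rewrite eqxx.
      by rewrite dT; lia.
    - by rewrite /u /dcomp dT; case: (eqVneq d (deg i + 1)) => [e _|_]; rewrite ?eqxx //; lia.
    - exact: s.1.1.
  rewrite /t1 mblk_mmul ll !mmulE0 !addr0 mblk_mmul !mmulE0 !addr0.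
  suff -> : k ** mblk 0 v 0 0 + l ** k = 0.
    by apply: matP => -[[i|i]|i] [[j|j]|j].
  apply: matP => b [t|t]; rewrite matDE !mmulE big_sumType mat0E /=.
    rewrite big1 ?add0r => [|i _]; last by rewrite mulr0.
    rewrite big1 ?add0r => [|i _]; last by rewrite mulr0.
    rewrite (bigD1 (val t)) //= eqxx lT mul0r add0r big1 // => j jt.
    by rewrite (negPf jt) oppr0 mulr0.
  rewrite [X in _ + X + _]big1 ?addr0 => [|i _]; last by rewrite mulr0.
  rewrite -mmulE lu.
  have [hb|hb] := boolP (p b).
    rewrite (bigD1 (exist _ b hb)) //= eqxx big1 => [|j jb].
      by rewrite addr0 mulN1r addNr.
    case: eqP => [e|]; last by rewrite oppr0 mul0r.
    by case/eqP: jb; apply: val_inj.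
  rewrite big1 ?add0r => [|j _].
    apply/eqP; apply: contraT => /h2; rewrite dT addr0 => e.
    by rewrite /= e eqxx in hb.
  case: eqP => [e|]; last by rewrite oppr0 mul0r.
  by rewrite /= e dT eqxx in hb.
have e1 : cpxclass D1 t1 = pairclass (d - 2) v + cpxclass deg l.
  by apply: (cpxclass_blk gc QE) => //; exact: sqcontr_two.
(* The copy in degree $d-2$ takes the place of the top elements of [B], which are split off together
   with the copy in degree $d-1$. *)
pose be (z : B + (T + T)) : (T + T) + B := match z with
  inl b => if insub b is Some t then inl (inr t) else inr b
  | inr (inl t) => inr (val t) | inr (inr t) => inl (inl t) end.
have bbe : bijective be.
  exists (fun z : (T + T) + B => match z with
    inl (inl t) => inr (inr t) | inl (inr t) => inl (val t)
    | inr b => if insub b is Some t then inr (inl t) else inl b end).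
    move=> [b|[t|t]] //=; last by rewrite valK.
    by case: insubP => [t _ <-|nb] //; rewrite insubN.
  move=> [[t|t]|b] //=; first by rewrite valK.
  by case: insubP => [t _ <-|nb] //=; rewrite insubN.
have dpT (t : T) : deg' (val t) = d - 2 by rewrite /deg' dT eqxx.
have dpN b : ~~ p b -> deg' b = deg b by rewrite /deg' /= => /negPf ->.
pose k2 : mat R (T + T) B := mre (be \o inr) (be \o inl) t1.
pose t2 : mat R (B + (T + T)) (B + (T + T)) := mblk l' 0 k2 (mblk 0 (- mone T) 0 0).
have E : t2 = mre be be t1.
  apply: matP => -[b|[t|t]] [b'|[t'|t']] //; rewrite /mre /=.
  - case: insubP => [t _ <-|nb]; case: insubP => [t' _ <-|nb'] /=; rewrite ?mat0E.
    + by rewrite /l' /dcomp !dpT; case: eqP => //; lia.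
    + rewrite /l' /dcomp dpT dpN //; case: eqP => // e.
      apply/eqP; apply: contraT => /h1; rewrite dT; lia.
    + rewrite /l' /u /dcomp dpT dT dpN //; congr (if _ then _ else _).
      by apply/eqP/eqP; lia.
    + by rewrite /l' /l /dcomp !dpN.
  - by case: insubP => [t _ <-|nb] /=; rewrite ?mat0E ?lT.
  - case: insubP => [t _ <-|nb] /=; rewrite ?mat0E //.
    by case: eqP => [e|]; rewrite ?oppr0 //; case/negP: nb; rewrite e; exact: valP t'.
  - by rewrite lT.
have D : sumdeg deg' (twodeg T T (d - 1)) = D1 \o be.
  apply: funext => -[b|[t|t]] /=; last by lia.
    by case: insubP => [t _ <-|nb] /=; rewrite ?dpT ?dpN.
  by rewrite dT; lia.
have st1 : sqcontr D1 t1 by apply: (sqcontr_ext gc) => //; exact: sqcontr_two.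
have e2 : cpxclass D1 t1 = cpxclass deg' l' + pairclass (d - 1) (- mone T).
  rewrite -(cpxclass_re QE bbe st1) -D -E; apply: (cpxclass_blk gc QE) => //.
    by rewrite -/t2 D E; apply: cpx_re => //; exact: st1.1.
  by apply: sqcontr_two => //; exact: gc_opp.
move=> h; have -> : cpxclass deg l = cpxclass deg' l' - pairclass (d - 2) v.
  by rewrite -[cpxclass deg' l']addr0 -(pairclass_sgn gc QE (d - 1) true T) -e2 e1 addrAC subrr add0r.
by apply: ImB => //; exact: Im_pairclass.
Qed.

(** In two adjacent degrees $S$ is antidiagonal with blocks $a,b$, and $S^2$ has the diagonal blocks
    $ab,ba$. So [gc_sq] applies to $a$, which is the whole differential. *)
Lemma two_degrees (B : finType) (deg : B -> int) (S : mat R B B) (m : int) :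
  graded_root Pm deg S -> (forall b, deg b = m \/ deg b = m + 1) ->
  Im (cpxclass deg (dcomp (-1) deg S)).
Proof.
move=> g hd; have [h1 h2 h3] := g.
pose p := [pred b | deg b == m + 1].
have bs := sub_split_bij p; set s := @sub_split B p in bs.
have sl i : deg (s (inl i)) = m + 1 by case: i => b /= /eqP.
have sr i : deg (s (inr i)) = m.
  by case: i => b /= hb; case: (hd b) => // e; rewrite e eqxx in hb.
have z (i j : B) : deg i = deg j -> S i j = 0.
  by move=> e; apply/eqP; apply: contraT => /h1; rewrite e; lia.
have sE : mre s s S = mblk 0 (mre (s \o inl) (s \o inr) S) (mre (s \o inr) (s \o inl) S) 0.
  by apply: matP => -[i|i] [j|j] //; rewrite /mre /= mat0E z // ?sl ?sr.
have := gc_re gc bs bs h3; rewrite -(mre_mmul s s S S bs) sE mblk_mmul !mmulE0 !addr0 !add0r.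
move=> /(gc_diag gc)[P1 P2]; have Pa := gc_sq gc P1 P2.
rewrite -(cpxclass_re QE bs (root_sqcontr g)).
have -> : deg \o s = twodeg _ _ m by apply: funext => -[i|i]; rewrite /= ?sl ?sr.
have -> : mre s s (dcomp (-1) deg S) = mblk 0 (mre (s \o inl) (s \o inr) S) 0 0.
  apply: matP => -[i|i] [j|j]; rewrite /mre /dcomp /= ?sl ?sr ?mat0E.
  - by case: eqP => //; lia.
  - by rewrite addrK eqxx.
  - by case: eqP => //; lia.
  - by case: eqP => //; lia.
exact: Im_pairclass.
Qed.

Lemma Im_root (N : nat) (B : finType) (deg : B -> int) (S : mat R B B) (m : int) :
  graded_root Pm deg S -> (forall b, m <= deg b <= m + N.+1%:Z) ->
  Im (cpxclass deg (dcomp (-1) deg S)).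
Proof.
elim: N deg => [|N ih] deg g hd.
  by apply: (two_degrees g (m := m)) => b; have := hd b; lia.
(* The top degree $m+N+2$ moves to $m+N\ge m$, so the range of degrees shrinks by one without
   growing below. *)
have [|g' h] := @fold_step _ _ _ (m + N.+2%:Z) g; first by move=> b; have := hd b; lia.
apply: h; apply: ih => // b; have := hd b; case: eqP; lia.
Qed.

Lemma Im_cpxclass (B : finType) (deg : B -> int) (c : mat R B B) : sqcontr deg c -> Im (cpxclass deg c).
Proof.
move=> /sqcontr_root[S [g ->]].
pose M := \max_b `|deg b|%N.
apply: (@Im_root (M + M) _ _ _ (- M%:Z)) => // b.
have : (`|deg b| <= M)%N by exact: (leq_bigmax b).
by lia.
Qed.

End Surj.

(** * From families of maps in each degree to total matrices *)

Section Dsum.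
Variable R : nzRingType.

Lemma dsum_coordE' (I : finType) (M : I -> basedMod R) (x : dsum M) c :
  bm_coord x c = bm_coord (x (tag c)) (tagged c).
Proof. by []. Qed.

Section Mx.
Variables (I J : finType) (M : I -> basedMod R) (N : J -> basedMod R).
Variable f : forall i j, {linear M i -> N j}.

Lemma dsum_mx_linear : linear (dsum_mx (fun i j x => f i j x) : dsum M -> dsum N).
Proof.
move=> a x y; apply/ffunP => j; rewrite dsumDE dsumZE !ffunE scaler_sumr -big_split /=.
by apply: eq_bigr => i _; rewrite dsumDE dsumZE linearP.
Qed.

Lemma lmx_dsum_mx b c : lmx (dsum_mx (fun i j x => f i j x) : dsum M -> dsum N) b c =
  lmx (f (tag b) (tag c)) (tagged b) (tagged c).
Proof.
rewrite /lmx dsum_coordE' ffunE (bigD1 (tag b)) //= big1 ?addr0 => [|i ib].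
  by rewrite ffunE dfwith_in.
by rewrite ffunE dfwith_out ?linear0 // eq_sym.
Qed.

End Mx.

Section Diag.
Variables (I : finType) (M : I -> basedMod R).
Variable f : forall i, {linear M i -> M i}.

Lemma dsum_diag_linear : linear (dsum_diag (fun i x => f i x) : dsum M -> dsum M).
Proof.
move=> a x y; apply/ffunP => j.
by rewrite [LHS]ffunE dsumDE dsumZE linearP [RHS]dsumDE dsumZE !ffunE.
Qed.

Lemma lmx_dsum_diag b c : lmx (dsum_diag (fun i x => f i x) : dsum M -> dsum M) b c =
  bm_coord (f (tag c) (dsum_vec b (tag c))) (tagged c).
Proof. by rewrite /lmx dsum_coordE' ffunE. Qed.

End Diag.
End Dsum.

Section DegBlocks.
Variables (R : nzRingType) (Pm : forall I J : finType, mat R I J -> Prop).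
Hypothesis gc : good_class Pm.

Definition deg_enum (B I : Type) (deg : B -> int) n (f : I -> B) :=
  injective f /\ forall b, deg b = n <-> exists i, f i = b.

Lemma deg_enum_bij (B I J : finType) (deg : B -> int) n (f : I -> B) (g : J -> B) :
  deg_enum deg n f -> deg_enum deg n g -> exists h : I -> J, bijective h /\ f = g \o h.
Proof.
move=> [fi fE] [gi gE].
have /choice[h hE] : forall i, exists j, g j = f i by move=> i; apply/gE/fE; exists i.
exists h; split; last by apply: funext => i; rewrite /= hE.
apply: inj_surj_bij => [i j e|j]; first by apply: fi; rewrite -!hE e.
by have /fE[i ij] : deg (g j) = n by [apply/gE; exists j]; exists i; apply: gi; rewrite hE.
Qed.

Lemma homog0_split (B : finType) (deg : B -> int) n (U : mat R B B) : homog 0 deg U ->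
  let s := @sub_split B [pred b | deg b == n] in
  mre s s U = mblk (mre (s \o inl) (s \o inl) U) 0 0 (mre (s \o inr) (s \o inr) U).
Proof.
move=> h s; apply: matP => -[[i hi]|[i hi]] [[j hj]|[j hj]] //; rewrite /mre /=;
  apply/eqP; apply: contraT => /h; rewrite addr0; move: (hi) (hj) => /=.
  by move=> /eqP -> /eqP hj' /hj'.
by move=> /eqP hi' /eqP -> /esym/hi'.
Qed.

Lemma sub_deg_enum (B : finType) (deg : B -> int) n :
  deg_enum deg n (@sub_split B [pred b | deg b == n] \o inl).
Proof.
split=> [[x hx] [y hy] /= e|b]; first exact: val_inj.
split=> [h|[[x /= /eqP hx] <-]] //; have hb : deg b == n by apply/eqP.
by exists (exist _ b hb).
Qed.

Lemma Pm_blocks (B I : finType) (deg : B -> int) n (f : I -> B) (U : mat R B B) :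
  homog 0 deg U -> Pm U -> deg_enum deg n f -> Pm (mre f f U).
Proof.
move=> h PU fE; have bs := sub_split_bij [pred b | deg b == n].
have := gc_re gc bs bs PU; rewrite homog0_split // => /(gc_diag gc)[P1 _].
have [g [bg ->]] := deg_enum_bij fE (sub_deg_enum deg n).
exact: (gc_re gc bg bg P1).
Qed.

(** Induction on the size of [B]: a matrix of degree 0 is block diagonal along the splitting into
    one degree and the rest. *)
Lemma blocks_Pm (B : finType) (deg : B -> int) (U : mat R B B) : homog 0 deg U ->
  (forall n (I : finType) (f : I -> B), deg_enum deg n f -> Pm (mre f f U)) -> Pm U.
Proof.
have [n] := ubnP #|B|; elim: n B deg U => // n ih B deg U /ltnSE Bn h hP.
have [b0 _|B0] := pickP B; last first.
  suff -> : U = mone B by exact: gc_one.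
  by apply: matP => b; have := B0 b.
pose p := [pred b | deg b == deg b0].
have bs := sub_split_bij p; apply: (gc_re_inv gc bs bs).
rewrite homog0_split //; apply: (gc_blk gc); first by apply: (hP (deg b0)); exact: sub_deg_enum.
apply: (ih _ (deg \o (@sub_split B p \o inr))); first last.
- move=> m I f [fi fE].
  have [mb|mb] := eqVneq m (deg b0).
    (* This degree has been split off already, so its index type is empty and the block is an
       identity matrix. *)
    suff -> : mre f f (mre (@sub_split B p \o inr) (@sub_split B p \o inr) U) = mone I by exact: gc_one.
    apply: matP => i; have : deg (val (f i)) = m by apply/fE; exists i.
    by case: (f i) => x /= hx e; rewrite e mb eqxx in hx.
  apply: (hP m _ (@sub_split B p \o inr \o f)); split.
    by move=> i j /= /val_inj/fi.
  move=> b; split=> [hb|[i <-]].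
    have np : ~~ p b by rewrite /= hb.
    have /fE[i ib] : deg (val (exist (fun b => ~~ p b) b np)) = m by [].
    by exists i; rewrite /= ib.
  by apply/(fE (f i)); exists i.
- exact: homog_re.
rewrite card_sig; apply: leq_trans Bn; rewrite -(cardC p) -add1n leq_add2r.
by apply/card_gt0P; exists b0; rewrite inE eqxx.
Qed.

End DegBlocks.

Section Families.
Variable R : nzRingType.
Variables (C : chainCpx R) (B : finType) (e : B -> Tot C) (ei : Tot C -> B).
Hypothesis en : isEnum e ei.

Section U.
Variables (U : mat R B B) (u : forall n, {linear C n -> C n}).
Hypothesis U0 : homog 0 (edeg e) U.
Hypothesis UE : forall n (x y : bm_idx (C n)), U (ei (tot x)) (ei (tot y)) = lmx (u n) x y.

Lemma U_mul (f : forall i j, {linear C i -> C j}) i j (x : bm_idx (C i)) (y : bm_idx (C j)) :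
  (U ** fmat e f) (ei (tot x)) (ei (tot y)) = bm_coord (f i j (u i (bm_vec x))) y.
Proof.
rewrite mmulE (bigID (fun b => edeg e b == i)) /= [X in _ + X]big1 ?addr0 => [|b bi].
  rewrite (sum_deg en) coord_lin; apply: eq_bigr => z _.
  by rewrite UE (fmatE en).
have [->|/U0] := eqVneq (U (ei (tot x)) b) 0; first by rewrite mul0r.
by rewrite edegE // addr0 => h; rewrite h eqxx in bi.
Qed.

Lemma mul_U (f : forall i j, {linear C i -> C j}) i j (x : bm_idx (C i)) (y : bm_idx (C j)) :
  (fmat e f ** U) (ei (tot x)) (ei (tot y)) = bm_coord (u j (f i j (bm_vec x))) y.
Proof.
rewrite mmulE (bigID (fun b => edeg e b == j)) /= [X in _ + X]big1 ?addr0 => [|b bj].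
  rewrite (sum_deg en) coord_lin; apply: eq_bigr => z _.
  by rewrite UE (fmatE en).
have [->|/U0] := eqVneq (U b (ei (tot y))) 0; first by rewrite mulr0.
by rewrite edegE // addr0 => h; rewrite h eqxx in bj.
Qed.

Lemma comm_U (f : forall i j, {linear C i -> C j}) :
  (forall i j x, f i j (u i x) = u j (f i j x)) <-> U ** fmat e f = fmat e f ** U.
Proof.
split=> [h|h i j x].
  apply: matP => b b'; elim/(enum_elim en): b => i x; elim/(enum_elim en): b' => j y.
  by rewrite U_mul mul_U h.
have := @linear_ext _ _ _ (f i j \o u i) (u j \o f i j); apply=> b.
by apply: bm_coord_inj => c; rewrite /= -U_mul -mul_U h.
Qed.

End U.

Lemma tot_deg_enum n : deg_enum (edeg e) n (fun x : bm_idx (C n) => ei (tot x)).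
Proof.
split; first by move=> x y /(can_inj en.2)/tot_inj.
move=> b; elim/(enum_elim en): b => m x; rewrite edegE //; split=> [mn|[y]].
  by subst m; exists x.
by move/(congr1 (edeg e)); rewrite !edegE.
Qed.

End Families.

Section Parts.
Variable R : nzRingType.
Variable C : chainCpx R.
Variable e : bm_idx (oddPart C) + bm_idx (evPart C) -> Tot C.
Hypothesis eE : e = @pe R C.

Lemma lmx_oddToEv (F : forall i j, {linear C i -> C j}) :
  lmx (oddToEv (fun i j x => F i j x)) = mre inl inr (fmat e F).
Proof. by rewrite eE; apply: matP => b c; rewrite [LHS]lmx_dsum_mx. Qed.

Lemma oddToEv_linear (F : forall i j, {linear C i -> C j}) :
  linear (oddToEv (fun i j x => F i j x)).
Proof. exact: dsum_mx_linear. Qed.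

Lemma oddToOdd_linear (u : forall n, {linear C n -> C n}) :
  linear (oddToOdd (fun n x => u n x)).
Proof. exact: dsum_diag_linear. Qed.

Lemma lmx_oddToOdd (u : forall n, {linear C n -> C n}) ei (U : mat R _ _) : isEnum e ei ->
  homog 0 (edeg e) U ->
  (forall n (x y : bm_idx (C n)), U (ei (tot x)) (ei (tot y)) = lmx (u n) x y) ->
  lmx (oddToOdd (fun n x => u n x)) = mre inl inl U.
Proof.
move=> en U0 UE; apply: matP => b c; rewrite [LHS]lmx_dsum_diag /=.
have eiE (z : bm_idx (oddPart C)) : inl z = ei (tot (tagged z)) :> (_ + _)%type.
  by rewrite -[LHS]en.1 eE.
rewrite /mre !eiE; case: b c => k x [l y] /=.
have [kl|kl] := eqVneq k l.
  by subst l; rewrite UE ffunE dfwith_in.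
rewrite ffunE dfwith_out // linear0 bm_coord0; apply/esym/eqP; apply: contraT => /U0.
rewrite !edegE // addr0 /odd_deg /cc_deg => h; case/eqP: kl; apply: val_inj => /=.
by lia.
Qed.

End Parts.

(** * The isomorphism and the values of the torsion *)

Section Abstract.
Variables (R : nzRingType).
Variable Pm : forall I J : finType, mat R I J -> Prop.
Hypothesis gc : good_class Pm.
Variable P : forall M N : basedMod R, (M -> N) -> Prop.
Hypothesis PE : forall (M N : basedMod R) (f : {linear M -> N}), P f <-> Pm (lmx f).
Variable Q : chainCpx R -> Prop.
Hypothesis QE : forall (C : chainCpx R) (B : finType) (e : B -> Tot C), bijective e ->
  (Q C <-> sqcontr Pm (edeg e) (cmat e)).
Local Notation sqcontr := (sqcontr Pm).
Local Notation mxclass := (mxclass PE).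
Local Notation K := (K1t P).
Local Notation KC := (KCh Q).
Local Notation pairclass := (@pairclass R Q).
Local Notation cpxclass := (@cpxclass R Q).
Local Notation torsion := (torsion PE).

Lemma torsion_re (B B' : finType) (deg : B -> int) (c : mat R B B) (f : B' -> B) :
  bijective f -> sqcontr deg c -> torsion (deg \o f) (mre f f c) = torsion deg c.
Proof.
move=> bf /sqcontr_wcontr[hc [d [v [hd dd]]]].
have [B1 [B2 [s [bs ps]]]] := parity_split (deg \o f).
have dd' : mre f f d ** mre f f d = 0 by rewrite (mre_mmul f f d d bf) dd.
rewrite (torsion_sq gc PE (cpx_re bf hc) (wcontr_re gc bf hd) dd' bs ps).
by rewrite (torsion_sq gc PE hc hd dd (bij_comp bf bs) ps).
Qed.

Lemma torsion_enum (C : chainCpx R) (B B' : finType) (e : B -> Tot C) (e' : B' -> Tot C) :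
  Q C -> bijective e -> bijective e' -> torsion (edeg e) (cmat e) = torsion (edeg e') (cmat e').
Proof.
move=> qC be be'; have [ei ee eie] := be'.
have bf : bijective (ei \o e) by apply: bij_comp => //; exists e'.
have := torsion_re bf ((QE be').1 qC).
have ef : e' \o (ei \o e) = e by apply: funext => b; rewrite /= eie.
have -> : mre (ei \o e) (ei \o e) (cmat e') = cmat (e' \o (ei \o e)) by [].
have -> : edeg e' \o (ei \o e) = edeg (e' \o (ei \o e)) by [].
by rewrite ef.
Qed.

(** As $ss=1$, the matrix $s$ itself is a homotopy, with $u=1$, and the torsion is $[s]=0$. For odd
    $n$ the two summands exchange parity, hence the swap [w]. *)
Lemma torsion_sgn n b (I : finType) : torsion (twodeg I I n) (mblk 0 (sgn_one R b I) 0 0) = 0.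
Proof.
pose s := sgn_one R b I.
have ss : s ** s = mone I.
  by rewrite /s /sgn_one; case: (b); rewrite ?mmulNl ?mmulNr ?opprK mmul1l.
have h1 : Pm (s ** s) by rewrite ss; exact: gc_one.
have ks : mxclass s = 0 by rewrite /s /sgn_one; case: (b); [exact: mxclass_opp | exact: mxclass_one].
have [k dd] := wcontr_two gc n h1 h1; rewrite -/s.
set c := mblk 0 s 0 0 in k *; set d := mblk 0 0 s 0 in k dd *; set v := mblk (s ** s) 0 0 (s ** s) in k.
have hc : cpx (twodeg I I n) c := cpx_two n s.
have Te : c ** v + d = mblk 0 s s 0.
  by rewrite /c /v /d ss mblk_mmul !mmulE0 !addr0 !add0r mblkD !addr0 !add0r.
have [n0|n1] := eqVneq (n %% 2)%Z 0.
  have bi : bijective (fun x : I + I => x) by exists id.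
  have par : parity (twodeg I I n \o (fun x : I + I => x)) by split=> i /=; lia.
  rewrite (torsion_sq gc PE hc k dd bi par) /torsionval !mre_id Te.
  have -> : mre inl inr (mblk 0 s s 0) = s by [].
  have -> : mre inl inl v = mone I by rewrite -ss.
  by rewrite ks mxclass_one ?subrr.
pose w (x : I + I) : I + I := match x with inl i => inr i | inr i => inl i end.
have bw : bijective w by exists w; case.
have par : parity (twodeg I I n \o w) by split=> i /=; lia.
rewrite (torsion_sq gc PE hc k dd bw par) /torsionval (mre_mmul w w c v bw) -mreD Te.
have -> : mre inl inr (mre w w (mblk 0 s s 0)) = s by [].
have -> : mre inl inl (mre w w v) = mone I by rewrite -ss.
by rewrite ks mxclass_one ?subrr.
Qed.

Lemma rho_ex : exists rho : {additive KC -> K},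
  forall (B : finType) (deg : B -> int) (c : mat R B B), sqcontr deg c -> rho (cpxclass deg c) = torsion deg c.
Proof.
have [phi phiE] := free_lift (fun S : kch_gen Q => torsion (edeg (@pe R S)) (cmat (@pe R S))).
have sq (S : kch_gen Q) (B : finType) (e : B -> Tot S) : bijective e -> sqcontr (edeg e) (cmat e).
  by move=> be; apply/(QE be); exact: kch_cpxP.
have phiS (S : kch_gen Q) (B : finType) (e : B -> Tot S) : bijective e ->
    phi (freeGen S) = torsion (edeg e) (cmat e).
  by move=> be; rewrite phiE; apply: torsion_enum => //; [exact: kch_cpxP | exact: pe_bij].
have [s|rho rhoE] := @quot_lift _ _ (kch_iso_rel (Q:=Q) `|` kch_exact_rel (Q:=Q) `|` kch_elem_rel (Q:=Q)) phi.
  case=> [[[S [S' [iso ->]]]|[S1 [S [S2 [ex ->]]]]]|[n [S [el ->]]]].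
  - have [e' [be' ed ec]] := iso_enum (pe_bij S) iso.
    by rewrite raddfB phiE (phiS S' _ e' be') -ec (funext ed) subrr.
  - have [e [k [be ed ec]]] := exact_enum (pe_bij S1) (pe_bij S2) ex.
    have h := sq S _ e be; rewrite (funext ed) ec in h.
    rewrite raddfB raddfD !phiE -phiE (phiS S _ e be) (funext ed) ec.
    by rewrite (torsion_blk gc PE h.1 (sq _ _ _ (pe_bij S1)) (sq _ _ _ (pe_bij S2))) subrr.
  have [b [f tS]] : exists b (f : {linear stdMod R 1 -> stdMod R 1}),
      isTwoTerm n f S /\ lmx f = sgn_one R b 'I_1.
    case: el => h; [exists false, idfun | exists true, -%R]; split=> //.
      exact: lmx_id.
    by apply: matP => i j; rewrite /lmx /sgn_one matNE /mone /= !mxE eqxx /= eq_sym.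
  move: tS => [/two_term_enum[e [be ed ec]] lf].
  by rewrite (phiS S _ e be) (funext ed) ec lf torsion_sgn.
exists rho => B deg c /(cpxclass_ex QE)[S [e [be ed ec ->]]].
by rewrite /kch_class rhoE (phiS S _ e be) (funext ed) ec.
Qed.

(** On generators [rho] undoes [ri] by [torsion_two]. Folding, applied with the image of [ri] as
    [Im], shows that [ri] is onto, and an onto map with a left inverse is an isomorphism. *)
Theorem abstract_iso : exists (rho : {additive KC -> K}) (ri : {additive K -> KC}),
  [/\ forall (B : finType) (deg : B -> int) (c : mat R B B), sqcontr deg c -> rho (cpxclass deg c) = torsion deg c,
      forall (I J : finType) (a : mat R I J), Pm a -> ri (mxclass a) = pairclass 0 a,
      cancel rho ri & cancel ri rho].
Proof.
have [rho rhoE] := rho_ex; have [ri riE] := rho_inv_ex gc PE QE.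
have can1 : cancel ri rho.
  move=> z; apply: (k1t_ind gc (PE := PE) (p := fun x => rho (ri x) = x)) => [|x y hx hy|n a ha].
  - by rewrite !raddf0.
  - by rewrite !raddfB hx hy.
  by rewrite riE // rhoE ?torsion_two //; exact: sqcontr_two.
exists rho, ri; split=> //.
have surj : forall x, exists t, x = ri t.
  apply: (kch_ind QE (p := fun x => exists t, x = ri t)) => [|x y [t ->] [t' ->]|B deg c h].
  - by exists 0; rewrite raddf0.
  - by exists (t - t'); rewrite raddfB.
  apply: (Im_cpxclass gc QE (Im := fun x => exists t, x = ri t)) h => [x y [t ->] [t' ->]|I J a ha].
    by exists (t - t'); rewrite raddfB.
  by exists (mxclass a); rewrite riE.
by move=> x; have [t ->] := surj x; rewrite can1.
Qed.

Section Values.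
Variables (C : chainCpx R).
Variables (h : forall i j, {linear C i -> C j}) (u : forall n, {linear C n -> C n}).
Hypothesis hu : isNullHtpy h u.
Hypothesis qC : Q C.
Hypothesis comm : forall i j x, h i j (u i x) = u j (h i j x).
Local Notation e := (@pe R C).

Lemma htpy_wcontr ei : isEnum e ei -> (forall n, P (u n)) ->
  exists U, [/\ wcontr Pm (edeg e) (cmat e) (fmat e h) U, homog 0 (edeg e) U &
    forall n (x y : bm_idx (C n)), U (ei (tot x)) (ei (tot y)) = lmx (u n) x y].
Proof.
move=> en hP; have [h1 h2] := (nullHtpy_mat en h u).1 hu.
have [hc cc] := enum_cpx en.
set U := cmat e ** fmat e h + fmat e h ** cmat e in h2.
have U0 : homog 0 (edeg e) U.
  by apply: homog_add; [exact: (homog_mul hc h1) | exact: (homog_mul h1 hc)].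
have PU : Pm U.
  apply: (blocks_Pm gc U0) => n I f fE.
  have [g [bg ->]] := deg_enum_bij fE (tot_deg_enum en n).
  rewrite (_ : mre _ _ _ = mre g g (lmx (u n))).
    exact: (gc_re gc bg bg ((PE (u n)).1 (hP n))).
  by apply: matP => x y; rewrite /mre /= h2.
exists U; split=> //; split=> //.
exact: (comm_U en U0 h2 h).1.
Qed.

(** In the enumeration [pe] the two maps of the definition have the blocks of a [torsionval] as
    matrices, so their difference is a member of [torsions]. *)
Lemma htpy_value : (forall n, P (u n)) -> exists t1 t2,
  [/\ k1_value P (oddToEv (fun i j x => u j (cc_d C i j x) + h i j x)) = [set t1],
      k1_value P (oddToOdd u) = [set t2] & t1 - t2 = torsion (edeg e) (cmat e)].
Proof.
move=> hP; have be := pe_bij C; have [ei en] := bij_isEnum be.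
have [U [hk U0 UE]] := htpy_wcontr en hP.
have hc := enum_cpx en; have par := pe_parity C.
have [PT Po _ _] := wcontr_facts gc PE par hc hk.
pose F i j : {linear C i -> C j} := (u j \o cc_d C i j) \+ h i j.
have FE : fmat e F = cmat e ** U + fmat e h.
  apply: matP => b b'; elim/(enum_elim en): b => i x; elim/(enum_elim en): b' => j y.
  rewrite matDE (mul_U en U0 UE (cc_d C)) !(fmatE en) /lmx /F /=.
  exact: bm_coordD.
pose f1 : {linear oddPart C -> evPart C} :=
  HB.pack (oddToEv (fun i j x => F i j x)) (GRing.isLinear.Build _ _ _ _ _ (oddToEv_linear F)).
pose f2 : {linear oddPart C -> oddPart C} :=
  HB.pack (oddToOdd (fun n x => u n x)) (GRing.isLinear.Build _ _ _ _ _ (oddToOdd_linear u)).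
have l1 : lmx f1 = mre inl inr (cmat e ** U + fmat e h) by rewrite -FE; exact: lmx_oddToEv.
have l2 : lmx f2 = mre inl inl U by exact: (lmx_oddToOdd erefl en).
have P1 : P f1 by apply: (PE f1).2; rewrite l1.
have P2 : P f2 by apply: (PE f2).2; rewrite l2.
exists (mxclass (lmx f1)), (mxclass (lmx f2)); split; [exact: (k1_valueP gc PE P1)|exact: (k1_valueP gc PE P2)|].
rewrite l1 l2; apply: (torsions_torsion gc (PE := PE)); first exact: (QE be).1.
by exists _, _, id, (fmat e h), U; split=> //; exists id.
Qed.

End Values.

End Abstract.

(** * Invertible matrices *)

Section IsoClass.
Variable R : nzRingType.
Hypothesis ibn : forall (I J : finType) (a : mat R I J) (b : mat R J I),
  a ** b = mone I -> b ** a = mone J -> #|I| = #|J|.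

Definition invertible (I J : finType) (a : mat R I J) : Prop :=
  exists b : mat R J I, a ** b = mone I /\ b ** a = mone J.

(** For [gc_sq]: if $(ab)w=1$ and $z(ba)=1$, then $zb=zb(abw)=bw$ is a two-sided inverse of $a$. *)
Lemma invertible_good : good_class invertible.
Proof.
split.
- by move=> I J a [b [h1 h2]]; exact: ibn h1 h2.
- by move=> I; exists (mone I); rewrite mmul1l.
- move=> I J K a b [a' [h1 h2]] [b' [h3 h4]]; exists (b' ** a'); split.
    by rewrite -mmulA [b ** _]mmulA h3 mmul1l.
  by rewrite -mmulA [a' ** _]mmulA h2 mmul1l.
- move=> I J I' J' f g a bf bg [b [h1 h2]]; exists (mre g f b).
  rewrite (mre_mmul f f a b bg) (mre_mmul g g b a bf) h1 h2.
  by rewrite !mre_one //; exact: bij_inj.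
- move=> I J I' J' a b x [a' [h1 h2]] [b' [h3 h4]].
  exists (mblk a' 0 (- (b' ** x ** a')) b'); rewrite !mblk_mmul !mmulE0 !addr0 !add0r.
  rewrite h1 h2 h3 h4 !mone_sum; split; congr (mblk _ _ _ _).
    by rewrite !mmulA h3 mmul1l subrr.
  by rewrite -!mmulA h2 mmul1r addNr.
- move=> I J a b [w []]; rewrite [w]mblkE !mblk_mmul !mmulE0 !addr0 !add0r !mone_sum.
  move=> /mblk_inj[h1 _ _ h2] /mblk_inj[h3 _ _ h4].
  by split; [exists (mre inl inl w) | exists (mre inr inr w)].
- move=> I J a b [w [h1 _]] [z [_ h2]].
  have e : z ** b = b ** w.
    by rewrite -[LHS]mmul1r -h1 !mmulA -[z ** b ** a]mmulA h2 mmul1l.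
  by exists (b ** w); split; [rewrite mmulA | rewrite -e -mmulA].
- by move=> I J a [b [h1 h2]]; exists b; rewrite h1 h2; split; exists (mone _); rewrite mmul1l.
Qed.

Lemma isIso_mx (M N : basedMod R) (f : {linear M -> N}) : isIso f <-> invertible (lmx f).
Proof.
split=> [[g fg gf]|[b [h1 h2]]].
  pose G : {linear N -> M} := mx_map (lmx g).
  have Gv c : G (bm_vec c) = g (bm_vec c) by rewrite /G /= mx_map_vec bm_sumE.
  have fG : f \o G =1 id.
    apply: (@linear_ext _ _ _ (f \o G) idfun) => c.
    by rewrite /= [X in f X]Gv gf.
  exists (lmx G); rewrite -!lmx_comp; split.
    suff -> : G \o f = id by exact: lmx_id.
    by apply: funext => x; apply: (can_inj fg); have := fG (f x).
  by rewrite (funext fG); exact: lmx_id.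
exists (mx_map b : {linear N -> M}) => x.
  apply: (@lmx_inj _ _ _ ((mx_map b : {linear N -> M}) \o f) idfun).
  by rewrite lmx_comp lmx_mx_map h1 -lmx_id.
apply: (@lmx_inj _ _ _ (f \o (mx_map b : {linear N -> M})) idfun).
by rewrite lmx_comp lmx_mx_map h2 -lmx_id.
Qed.

(** A contraction $g$ is replaced by $gcg$, which is still a contraction and has square zero because
    $c\,g\,g\,c=0$. Conversely, $d$ with $v=(c+d)^2$ invertible gives the contraction $dv^{-1}$. *)
Lemma contractible_sqcontr (C : chainCpx R) (B : finType) (e : B -> Tot C) : bijective e ->
  contractible C <-> sqcontr invertible (edeg e) (cmat e).
Proof.
move=> /bij_isEnum[ei en]; have [hc cc] := enum_cpx en.
have I1 : invertible (mone B) := gc_one invertible_good B.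
have hP (h : forall i j, {linear C i -> C j}) : isContraction h <->
    homog 1 (edeg e) (fmat e h) /\ cmat e ** fmat e h + fmat e h ** cmat e = mone B.
  have := nullHtpy_mat en h (fun n => idfun); rewrite -/(isContraction h) => ->.
  split=> -[h1 h2]; split=> //.
    apply: matP => b b'; have [d|d] := eqVneq (edeg e b) (edeg e b').
      elim/(enum_elim en): b d => n x; elim/(enum_elim en): b' => m y.
      rewrite !edegE // => nm; subst m; rewrite h2.
      by rewrite /mone (inj_eq (can_inj en.2)) (inj_eq (@tot_inj R C n)) -[RHS]bm_coord_vec.
    have -> : mone B b b' = 0 by rewrite /mone; case: (eqVneq b b') d => [->|//]; rewrite eqxx.
    apply/eqP; apply: contraNT d; move=> nz; apply/eqP.
    have h0 : homog 0 (edeg e) (cmat e ** fmat e h + fmat e h ** cmat e).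
      by apply: homog_add; [exact: (homog_mul hc h1) | exact: (homog_mul h1 hc)].
    by rewrite (h0 _ _ nz) addr0.
  move=> n x y; rewrite h2 /mone (inj_eq (can_inj en.2)) (inj_eq (@tot_inj R C n)).
  by rewrite /lmx bm_coord_vec.
split.
  move=> [h /hP[h1 h2]]; set c := cmat e in hc cc h2 *; set g := fmat e h in h1 h2.
  split=> //; exists (g ** c ** g).
  have gc1 : g ** c = mone B - c ** g by rewrite -h2 addrAC subrr add0r.
  have cgc : c ** g ** c = c by rewrite -mmulA gc1 mmulDr mmulNr mmul1r mmulA cc mmul0l subr0.
  have z : c ** g ** (g ** c) = 0.
    by rewrite gc1 mmulDr mmulNr mmul1r mmulA cgc subrr.
  have gg : g ** c ** g ** (g ** c ** g) = 0.
    have -> : g ** c ** g ** (g ** c ** g) = g ** (c ** g ** (g ** c)) ** g by rewrite !mmulA.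
    by rewrite z mmul0r mmul0l.
  split=> //; first exact: (homog_mul (homog_mul h1 hc) h1).
  rewrite sq_sum // !mmulA cgc -[g ** c ** g ** c]mmulA.
  by rewrite -[g ** c ** (g ** c)]mmulA [c ** (g ** c)]mmulA cgc h2.
move=> /sqcontr_wcontr[hcc [d [v [hk dd]]]]; have vc := wcontr_comm hcc hk.
have [hd dv vd [w [h1 h2]]] := hk.
have hv : homog 0 (edeg e) v.
  by rewrite -dv; apply: homog_add; [exact: (homog_mul hc hd) | exact: (homog_mul hd hc)].
(* The degree 0 part of the inverse is again an inverse of $v$, so the inverse has degree 0. *)
have hw : homog 0 (edeg e) w.
  have grM : v ** gr (edeg e) w = gr (edeg e) (v ** w).
    apply: matP => i k; rewrite /gr mmulE; case: eqP => [ik|ik].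
      rewrite mmulE; apply: eq_bigr => j _; have [->|/hv ij] := eqVneq (v i j) 0.
        by rewrite !mul0r.
      by rewrite ij addr0 ik eqxx.
    apply: big1 => j _; have [->|/hv ij] := eqVneq (v i j) 0; first by rewrite mul0r.
    by rewrite ij addr0; case: eqP => // _; rewrite mulr0.
  have <- : gr (edeg e) w = w.
    rewrite -[LHS]mmul1l -h2 -mmulA grM h1 gr_homog0; last exact: homog_one.
    by rewrite mmul1r.
  by move=> i j; rewrite /gr addr0; case: (eqVneq (edeg e i) (edeg e j)) => [->|]; rewrite ?eqxx.
exists (fam ei (d ** w)); apply/hP; rewrite fmat_fam //; split.
  exact: (homog_mul hd hw).
have wc : w ** cmat e = cmat e ** w.
  by rewrite -[LHS]mmul1r -h1 !mmulA -[w ** cmat e ** v]mmulA -vc mmulA h2 mmul1l.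
by rewrite mmulA -[d ** w ** cmat e]mmulA wc mmulA -mmulDl dv h1.
Qed.

End IsoClass.

(** * Square summable functions *)

Section Tsum.
Variables (R : realType) (T : choiceType).
Implicit Types (f g u v : T -> R).

Definition psum u : \bar R := (\esum_(t in [set: T]) (u t)%:E)%E.

Lemma psum_ge0 u : (forall t, 0 <= u t) -> (0 <= psum u)%E.
Proof. by move=> h; apply: esum_ge0 => t _; rewrite lee_fin. Qed.

Lemma psum0 : psum (fun _ => 0) = 0%E.
Proof. by rewrite /psum esum1. Qed.

Lemma psumD u v : (forall t, 0 <= u t) -> (forall t, 0 <= v t) ->
  psum (fun t => u t + v t) = (psum u + psum v)%E.
Proof.
by move=> hu hv; rewrite /psum -esumD => [|t _|t _]; rewrite ?lee_fin.
Qed.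

Lemma le_psum u v : (forall t, u t <= v t) -> (psum u <= psum v)%E.
Proof. by move=> h; apply: le_esum => t _; rewrite lee_fin. Qed.

Definition summ f := (psum (fun t => `|f t|)%R < +oo)%E.

Lemma summ_le f g : (forall t, `|f t| <= `|g t|) -> summ g -> summ f.
Proof. by move=> h; apply: le_lt_trans; apply: le_psum. Qed.

Lemma summD f g : summ f -> summ g -> summ (fun t => f t + g t).
Proof.
move=> hf hg; rewrite /summ.
apply: (@le_lt_trans _ _ (psum (fun t => `|f t| + `|g t|))).
  by apply: le_psum => t; exact: ler_normD.
by rewrite psumD // lte_add_pinfty.
Qed.

Lemma summN f : summ f -> summ (fun t => - f t).
Proof. by apply: summ_le => t; rewrite normrN. Qed.

Lemma summ0 : summ (fun _ => 0).
Proof. by rewrite /summ /psum esum1 ?ltry // => t _; rewrite normr0. Qed.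

Lemma summMn n f : summ f -> summ (fun t => f t *+ n).
Proof.
move=> hf; elim: n => [|n ih]; first exact: (summ_le _ summ0).
by apply: summ_le (summD hf ih) => t; rewrite mulrS.
Qed.

Lemma summZ a f : summ f -> summ (fun t => a * f t).
Proof.
move=> hf; have [n hn] : exists n : nat, `|a| <= n%:R.
  by exists (Num.Def.archi_bound `|a|); exact/ltW/archi_boundP.
apply: summ_le (summMn n hf) => t; rewrite normrM normrMn -mulr_natl.
by rewrite ler_wpM2r.
Qed.

Lemma psum_fin u : (forall t, 0 <= u t) -> summ u -> psum u \is a fin_num.
Proof.
move=> h; rewrite /summ; have -> : (fun t => `|u t|) = u by apply: funext => t; rewrite ger0_norm.
by move=> hs; rewrite ge0_fin_numE //; exact: psum_ge0.
Qed.

(* [f] is the difference of the nonnegative functions [|f| + f] and [|f|]. *)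
Definition tsum f : R := fine (psum (fun t => `|f t| + f t)) - fine (psum (fun t => `|f t|)).

Let pos_ge0 f t : 0 <= `|f t| + f t.
Proof. by have := ler_norm (- f t); rewrite normrN; lra. Qed.

Lemma summ_norm f : summ f -> summ (fun t => `|f t|).
Proof. by apply: summ_le => t; rewrite normr_id. Qed.

(** From $(|f|+f)+v=u+|f|$, any difference of nonnegative summable functions computes the sum; the
    linearity of [tsum] is reduced to this. *)
Lemma tsumE f u v : (forall t, 0 <= u t) -> (forall t, 0 <= v t) -> summ u -> summ v ->
  (forall t, f t = u t - v t) -> tsum f = fine (psum u) - fine (psum v).
Proof.
move=> hu hv su sv e.
have sf : summ f by apply: summ_le (summD su (summN sv)) => t; rewrite e.
have sp : summ (fun t => `|f t| + f t) by apply: summD => //; exact: summ_norm.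
have E : (psum (fun t => `|f t| + f t)%R + psum v = psum u + psum (fun t => `|f t|)%R)%E.
  rewrite -!psumD //; congr psum; apply: funext => t.
  by have := e t; lra.
move/(congr1 fine): E; rewrite !fineD ?psum_fin //; last exact: summ_norm.
by rewrite /tsum => E; lra.
Qed.

Lemma tsum_pos u : (forall t, 0 <= u t) -> summ u -> tsum u = fine (psum u).
Proof.
move=> hu su; rewrite (@tsumE u u (fun _ => 0)) //; last by move=> t; rewrite subr0.
  by rewrite psum0 subr0.
exact: summ0.
Qed.

Lemma tsumD f g : summ f -> summ g -> tsum (fun t => f t + g t) = tsum f + tsum g.
Proof.
move=> sf sg.
have sf' := summD (summ_norm sf) sf; have sg' := summD (summ_norm sg) sg.
rewrite (@tsumE _ (fun t => (`|f t| + f t) + (`|g t| + g t)) (fun t => `|f t| + `|g t|)).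
- rewrite (psumD (pos_ge0 f) (pos_ge0 g)).
  rewrite (psumD (fun t => normr_ge0 (f t)) (fun t => normr_ge0 (g t))).
  rewrite !fineD ?psum_fin // /tsum; try exact: summ_norm.
  by lra.
- by move=> t; apply: addr_ge0.
- by move=> t; apply: addr_ge0.
- exact: summD.
- by apply: summD; exact: summ_norm.
- by move=> t; lra.
Qed.

Lemma eq_tsum f g : f =1 g -> tsum f = tsum g.
Proof. by move=> /funext ->. Qed.

Lemma tsumN f : summ f -> tsum (fun t => - f t) = - tsum f.
Proof.
move=> sf; rewrite (@tsumE _ (fun t => `|f t|) (fun t => `|f t| + f t)) //.
- by rewrite /tsum opprB.
- exact: summ_norm.
- by apply: summD => //; exact: summ_norm.
- by move=> t; lra.
Qed.

Lemma tsum_ge0 u : (forall t, 0 <= u t) -> 0 <= tsum u.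
Proof.
move=> hu; have [su|su] := pselect (summ u).
  by rewrite tsum_pos //; apply: fine_ge0; exact: psum_ge0.
(* Without summability both sums are $+\infty$, whose [fine] is 0, so [tsum u] is 0. *)
rewrite /tsum; have nu : (fun t => `|u t|) = u by apply: funext => t; rewrite ger0_norm.
have : psum u = +oo%E.
  by apply/eqP; rewrite -leye_eq leNgt; apply/negP => h; apply: su; rewrite /summ nu.
move=> e; have e2 : psum (fun t => `|u t| + u t) = +oo%E.
  by apply/eqP; rewrite -leye_eq -e; apply: le_psum => t; rewrite lerDr.
by rewrite e2 nu e subr0.
Qed.

Lemma tsumZ a f : summ f -> tsum (fun t => a * f t) = a * tsum f.
Proof.
move=> sf.
suff H b u : 0 <= b -> (forall t, 0 <= u t) -> summ u ->
    fine (psum (fun t => b * u t)) = b * fine (psum u).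
  have key b : 0 <= b -> tsum (fun t => b * f t) = b * tsum f.
    move=> b0; rewrite (@tsumE _ (fun t => b * (`|f t| + f t)) (fun t => b * `|f t|)).
    - rewrite !H /tsum; [lra|by []|by []|exact: summ_norm|by []|by []|].
      by apply: summD => //; exact: summ_norm.
    - by move=> t; exact: mulr_ge0.
    - by move=> t; exact: mulr_ge0.
    - by apply/summZ/summD => //; exact: summ_norm.
    - by apply/summZ/summ_norm.
    - by move=> t; lra.
  have [a0|a0] := leP 0 a; first exact: key.
  have -> : tsum (fun t => a * f t) = - tsum (fun t => - a * f t).
    rewrite -tsumN; last exact: summZ.
    by apply: eq_tsum => t; rewrite mulNr opprK.
  by rewrite key; lra.
move=> b0 hu su; have [->|bn] := eqVneq b 0.
  by rewrite mul0r /psum esum1 // => t _; rewrite mul0r.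
have bp : 0 < b by rewrite lt_def bn.
have := su; rewrite /summ; have -> : (fun t => `|u t|) = u by apply: funext => t; rewrite ger0_norm.
move=> su'.
(* One inequality suffices: applied to $b^{-1}$ and $bu$ it gives the other. *)
have E c w : 0 < c -> (forall t, 0 <= w t) -> (psum (fun t => (c * w t)%R) <= c%:E * psum w)%E.
  move=> c0 hw; apply: ge_ereal_sup => _ [X [fX _] <-].
  rewrite fsbig_finite //=; under eq_bigr do rewrite EFinM.
  rewrite -ge0_sume_distrr => [|t _]; last by rewrite lee_fin.
  rewrite lee_pmul2l //; apply: esum_ge; exists X; first by split.
  by rewrite fsbig_finite.
have e1 := E b u bp hu.
have e2 := E b^-1 (fun t => b * u t); rewrite invr_gt0 in e2.
have {e2} := e2 bp (fun t => mulr_ge0 b0 (hu t)).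
have -> : (fun t => b^-1 * (b * u t)) = u by apply: funext => t; rewrite mulKf.
move: e1; have fu := psum_fin hu su.
have fbu := psum_fin (fun t => mulr_ge0 b0 (hu t)) (summZ b su).
rewrite -(fineK fu) -(fineK fbu) /= -!EFinM !lee_fin => e1 e2.
apply/eqP; rewrite eq_le e1 /=.
by rewrite -(ler_pM2l (x := b^-1)) ?invr_gt0 // mulKf.
Qed.

Lemma tsum_ge f t0 : (forall t, 0 <= f t) -> summ f -> f t0 <= tsum f.
Proof.
move=> hf sf; rewrite tsum_pos // -lee_fin fineK ?psum_fin //.
apply: esum_ge; exists [set t0]; first by split.
by rewrite fsbig_set1.
Qed.

Lemma tsum_single f t0 : (forall t, t != t0 -> f t = 0) -> summ f /\ tsum f = f t0.
Proof.
move=> h.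
have P u : (forall t, 0 <= u t) -> (forall t, t != t0 -> u t = 0) -> psum u = (u t0)%:E.
  move=> hu hz; rewrite /psum (esumID [set t0]) ?setTI => [|t _]; last by rewrite lee_fin.
  rewrite esum_set1 ?lee_fin // esum1 ?adde0 // => t /= /eqP ht.
  by rewrite hz.
have e : psum (fun t => `|f t|) = `|f t0|%:E.
  by apply: P => // t /h ->; rewrite normr0.
split; first by rewrite /summ e ltry.
rewrite /tsum e P => [|t|t /h ->] //=; first by lra.
by rewrite normr0 addr0.
Qed.

Lemma limr_le_cvg (w : nat -> R) l M : w @ \oo --> l -> (forall n, w n <= M) -> l <= M.
Proof.
move=> c h; have <- := cvg_lim (@Rhausdorff R) c.
by apply: limr_le; [apply/cvg_ex; exists l | apply: nearW].
Qed.

(** Fatou's lemma with a uniform bound: it holds on each finite set, where the limit passes through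
    the sum. *)
Lemma tsum_fatou (u : nat -> T -> R) f M : (forall n t, 0 <= u n t) -> (forall t, 0 <= f t) ->
  (forall t, (fun n => u n t) @ \oo --> f t) -> (forall n, summ (u n)) ->
  (forall n, tsum (u n) <= M) -> summ f /\ tsum f <= M.
Proof.
move=> hu hf cv su hM.
have le : (psum f <= M%:E)%E.
  apply: ge_ereal_sup => _ [X [fX _] <-].
  rewrite fsbig_finite //= sumEFin lee_fin.
  have c : (fun n => \sum_(t <- fset_set X) u n t) @ \oo --> \sum_(t <- fset_set X) f t.
    elim: (finmap.enum_fset (fset_set X)) => [|t r ih].
      under eq_fun do rewrite big_nil; rewrite big_nil; exact: cvg_cst.
    under eq_fun do rewrite big_cons; rewrite big_cons; apply: cvgD; [exact: cv|exact: ih].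
  apply: (limr_le_cvg c) => n; rewrite -lee_fin -sumEFin -fsbig_finite //.
  have h := hM n; rewrite tsum_pos // -lee_fin fineK ?psum_fin // in h.
  by apply: le_trans h; apply: esum_ge; exists X.
have sf : summ f.
  rewrite /summ; have -> : (fun t => `|f t|) = f by apply: funext => t; rewrite ger0_norm.
  by apply: le_lt_trans le _; rewrite ltry.
by split=> //; rewrite tsum_pos // -lee_fin fineK ?psum_fin.
Qed.

End Tsum.

(** * Inner products and orthogonal projection *)

Section Ell2.
Variables (R : realType) (T : choiceType).
Implicit Types (f g h : T -> R).

Definition L2 f := summ (fun t => f t * f t).
Definition ip f g : R := tsum (fun t => f t * g t).

Lemma summ_ip f g : L2 f -> L2 g -> summ (fun t => f t * g t).
Proof.
move=> hf hg; apply: summ_le (summD hf hg) => t.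
rewrite [leRHS]ger0_norm; last by rewrite addr_ge0 // -expr2 sqr_ge0.
rewrite ler_norml; have := sqr_ge0 (f t - g t); have := sqr_ge0 (f t + g t).
have := sqr_ge0 (f t); have := sqr_ge0 (g t).
by move=> *; apply/andP; split; nra.
Qed.

Lemma L20 : L2 (fun _ => 0).
Proof. by apply: summ_le (@summ0 R T) => t; rewrite mulr0. Qed.

Lemma L2Z a f : L2 f -> L2 (fun t => a * f t).
Proof. by move=> hf; apply: summ_le (summZ (a * a) hf) => t; rewrite mulrACA. Qed.

Lemma L2D f g : L2 f -> L2 g -> L2 (fun t => f t + g t).
Proof.
move=> hf hg; apply: summ_le (summD (summD hf hg) (summZ 2 (summ_ip hf hg))) => t.
have -> : (f t + g t) * (f t + g t) = f t * f t + g t * g t + 2 * (f t * g t) by ring.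
by [].
Qed.

Lemma L2N f : L2 f -> L2 (fun t => - f t).
Proof. by apply: summ_le => t; rewrite mulrNN. Qed.

Lemma L2B f g : L2 f -> L2 g -> L2 (fun t => f t - g t).
Proof. by move=> hf hg; apply: L2D => //; exact: L2N. Qed.

Lemma L2_sum (J : Type) (r : seq J) (F : J -> T -> R) : (forall j, L2 (F j)) ->
  L2 (fun t => \sum_(j <- r) F j t).
Proof.
move=> h; elim: r => [|j r ih]; first by apply: summ_le L20 => t; rewrite big_nil.
by have := L2D (h j) ih; congr L2; apply: funext => t; rewrite big_cons.
Qed.

Lemma ipC f g : ip f g = ip g f.
Proof. by apply: eq_tsum => t; rewrite mulrC. Qed.

Lemma ipDl f g h : L2 f -> L2 g -> L2 h -> ip (fun t => f t + g t) h = ip f h + ip g h.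
Proof.
move=> hf hg hh; rewrite /ip -tsumD; try exact: summ_ip.
by apply: eq_tsum => t; rewrite mulrDl.
Qed.

Lemma ipZl a f h : L2 f -> L2 h -> ip (fun t => a * f t) h = a * ip f h.
Proof.
move=> hf hh; rewrite /ip -tsumZ; last exact: summ_ip.
by apply: eq_tsum => t; rewrite mulrA.
Qed.

Lemma ipNl f h : L2 f -> L2 h -> ip (fun t => - f t) h = - ip f h.
Proof.
move=> hf hh; rewrite /ip -tsumN; last exact: summ_ip.
by apply: eq_tsum => t; rewrite mulNr.
Qed.

Lemma ipBl f g h : L2 f -> L2 g -> L2 h -> ip (fun t => f t - g t) h = ip f h - ip g h.
Proof. by move=> hf hg hh; rewrite ipDl ?ipNl //; exact: L2N. Qed.

Lemma ip0l h : ip (fun _ => 0) h = 0.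
Proof.
rewrite /ip (@eq_tsum _ _ _ (fun _ => 0)) => [|t]; last by rewrite mul0r.
by rewrite tsum_pos ?psum0 //; exact: summ0.
Qed.

Lemma ip_suml (J : Type) (r : seq J) (F : J -> T -> R) h : (forall j, L2 (F j)) -> L2 h ->
  ip (fun t => \sum_(j <- r) F j t) h = \sum_(j <- r) ip (F j) h.
Proof.
move=> hF hh; elim: r => [|j r ih].
  by rewrite big_nil -[RHS](ip0l h); apply: eq_tsum => t; rewrite big_nil.
rewrite big_cons -ih -ipDl //; last exact: L2_sum.
by apply: eq_tsum => t; rewrite big_cons.
Qed.

Lemma ip_ge0 f : 0 <= ip f f.
Proof. by apply: tsum_ge0 => t; rewrite -expr2 sqr_ge0. Qed.

Lemma ip_ge f t : L2 f -> f t * f t <= ip f f.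
Proof. by move=> hf; apply: (tsum_ge (f := fun t => f t * f t)) => // s; rewrite -expr2 sqr_ge0. Qed.

Lemma ip_eq0 f : L2 f -> ip f f = 0 -> f = fun _ => 0.
Proof.
move=> hf e; apply: funext => t; have := ip_ge t hf; rewrite e -expr2 => h.
by apply/eqP; rewrite -sqrf_eq0 eq_le h sqr_ge0.
Qed.

Lemma nsqD a f g : L2 f -> L2 g ->
  ip (fun t => f t + a * g t) (fun t => f t + a * g t) = ip f f + 2 * a * ip f g + a * a * ip g g.
Proof.
move=> hf hg; have hag := L2Z a hg; have hs := L2D hf hag.
rewrite ipDl // ipZl // [ip f _]ipC [ip g _]ipC !ipDl // !ipZl // [ip g f]ipC.
by ring.
Qed.

Lemma nsqB f g : L2 f -> L2 g ->
  ip (fun t => f t - g t) (fun t => f t - g t) = ip f f - 2 * ip f g + ip g g.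
Proof.
move=> hf hg; have := nsqD (-1) hf hg.
have -> : (fun t => f t + -1 * g t) = (fun t => f t - g t) by apply: funext => t; rewrite mulN1r.
by move=> ->; ring.
Qed.

Lemma cauchy_schwarz f g : L2 f -> L2 g -> ip f g * ip f g <= ip f f * ip g g.
Proof.
move=> hf hg; have [e|n] := eqVneq (ip g g) 0.
  by rewrite [ip f g]ipC (ip_eq0 hg e) !ip0l !mulr0.
have p : 0 < ip g g by rewrite lt_def n ip_ge0.
have := ip_ge0 (fun t => f t + - (ip f g / ip g g) * g t); rewrite nsqD //.
have -> : ip f f + 2 * - (ip f g / ip g g) * ip f g + - (ip f g / ip g g) * - (ip f g / ip g g) * ip g g
  = (ip f f * ip g g - ip f g * ip f g) / ip g g by field.
by rewrite pmulr_lge0 ?invr_gt0 // subr_ge0.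
Qed.

(** Expands $\|f-sg\|^2\ge0$; it bounds an inner product by squared norms, so no square roots
    appear. *)
Lemma amgm f g s : L2 f -> L2 g -> 0 < s -> 2 * ip f g <= ip f f / s + s * ip g g.
Proof.
move=> hf hg s0; have := ip_ge0 (fun t => f t + (- s) * g t); rewrite nsqD // => h.
rewrite -subr_ge0.
have -> : ip f f / s + s * ip g g - 2 * ip f g =
  (ip f f + 2 * - s * ip f g + - s * - s * ip g g) / s by field; lra.
by rewrite pmulr_lge0 ?invr_gt0.
Qed.

(** The variation argument for an almost minimal $y_n$: $a=\langle e-p,z\rangle$, $b=\langle
    p-y_n,z\rangle$, $C=\|z\|^2$, $X=\|e-y_n\|^2$, and $r$ is the excess over the infimum $D$. The
    step $(a+b)/(C+1)$ gives $(a+b)^2\le r(C+1)$, and $a^2\le2(a+b)^2+2b^2$. Dividing by $C+1$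
    avoids the case $z=0$. *)
Lemma proj_arith (a b C D X r : R) : 0 <= C -> X < D + r -> b * b <= 4 * r * C ->
  D <= X + 2 * - ((a + b) / (C + 1)) * (a + b) + - ((a + b) / (C + 1)) * - ((a + b) / (C + 1)) * C ->
  a * a <= (10 * C + 2) * r.
Proof.
move=> C0 h1 h5; have C1 : 0 < C + 1 by lra.
move sE : ((a + b) / (C + 1)) => s h2.
have e : a + b = s * (C + 1) by rewrite -sE mulfVK //; lra.
have h3 : s * s * (C + 1) <= r.
  rewrite e in h2.
  have : 2 * - s * (s * (C + 1)) + - s * - s * C = - (s * s * (C + 1)) - s * s by ring.
  have := sqr_ge0 s; rewrite expr2; move: h2.
  move: (2 * - s * (s * (C + 1))) (- s * - s * C) (s * s) => *; lra.
have h4 : (a + b) * (a + b) <= r * (C + 1).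
  rewrite e; have -> : s * (C + 1) * (s * (C + 1)) = s * s * (C + 1) * (C + 1) by ring.
  by apply: ler_wpM2r => //; lra.
have := sqr_ge0 (a + 2 * b); have -> : (a + 2 * b) ^+ 2 = 2 * ((a + b) * (a + b)) + 2 * (b * b) - a * a by ring.
have -> : (10 * C + 2) * r = 2 * (r * (C + 1)) + 2 * (4 * r * C) by ring.
move: h4 h5; move: ((a + b) * (a + b)) (b * b) (a * a) (r * (C + 1)) (4 * r * C) => *; lra.
Qed.

Section Projection.
Variable V : set (T -> R).
Hypothesis V0 : V (fun _ => 0).
Hypothesis VD : forall a f g, V f -> V g -> V (fun t => f t + a * g t).
Hypothesis VL : forall f, V f -> L2 f.

Definition adherent p := forall d : R, 0 < d -> exists2 y, V y & ip (fun t => p t - y t) (fun t => p t - y t) < d.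

Lemma adherent_orth p q : L2 p -> L2 q -> adherent p -> (forall y, V y -> ip y q = 0) -> ip p q = 0.
Proof.
move=> hp hq ap oq; apply/eqP; rewrite -sqrf_eq0 expr2 -[_ == _]negbK; apply/negP => n.
have n0 : 0 < ip p q * ip p q by rewrite lt_def n -expr2 sqr_ge0.
have M0 : 0 < ip q q + 1 by have := ip_ge0 q; lra.
(* Chosen so that Cauchy-Schwarz gives $\langle p,q\rangle^2<\langle p,q\rangle^2$; the added 1
   covers $q=0$. *)
have [|y Vy hy] := ap (ip p q * ip p q / (ip q q + 1)); first exact: divr_gt0.
have := cauchy_schwarz (L2B hp (VL Vy)) hq; rewrite ipBl //; last exact: VL.
rewrite (oq y Vy) subr0 => h.
have : ip p q * ip p q < ip p q * ip p q; last by rewrite ltxx.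
move: hy; rewrite ltr_pdivlMr // => hy; apply: le_lt_trans h _; apply: le_lt_trans hy.
by apply: ler_wpM2l; [exact: ip_ge0 | lra].
Qed.

(** Projects onto the closure of $V$. A minimising sequence is Cauchy by the parallelogram law,
    hence converges pointwise, and Fatou's lemma makes the pointwise limit a limit in norm. *)
Lemma projection e : L2 e -> exists p, [/\ L2 p, adherent p &
  forall y, V y -> ip (fun t => e t - p t) y = 0].
Proof.
move=> he.
pose E := [set ip (fun t => e t - y t) (fun t => e t - y t) | y in V].
have lbE : has_lbound E by exists 0 => _ [y _ <-]; exact: ip_ge0.
have hE : has_inf E by split=> //; exists (ip (fun t => e t - 0) (fun t => e t - 0)), (fun _ => 0).
have [D DE hD] : exists2 D, forall y, V y -> D <= ip (fun t => e t - y t) (fun t => e t - y t) &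
    forall d, 0 < d -> exists y, V y /\ ip (fun t => e t - y t) (fun t => e t - y t) < D + d.
  exists (inf E) => [y Vy|d d0]; first by apply: ge_inf => //; exists y.
  by have [_ [y Vy <-] lt] := inf_adherent d0 hE; exists y.
have /choice[y hy] : forall n : nat, exists y, V y /\
    ip (fun t => e t - y t) (fun t => e t - y t) < D + n.+1%:R^-1.
  by move=> n; apply: hD; rewrite invr_gt0.
have Vy n := (hy n).1; have Ly n := VL (Vy n).
have par n m : ip (fun t => y n t - y m t) (fun t => y n t - y m t) <=
    2 * n.+1%:R^-1 + 2 * m.+1%:R^-1.
  (* The midpoint of $y_n$ and $y_m$, in the form that [VD] produces. *)
  have Vz : V (fun t => 0 + 2^-1 * (y n t + 1 * y m t)).
    by apply: (VD 2^-1 V0 (g := fun t => y n t + 1 * y m t)); apply: VD.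
  have := DE _ Vz; have := (hy n).2; have := (hy m).2.
  set A := fun t => e t - y n t; set B := fun t => e t - y m t.
  have LA : L2 A by exact: L2B.
  have LB : L2 B by exact: L2B.
  have -> : (fun t => e t - (0 + 2^-1 * (y n t + 1 * y m t))) = (fun t => 2^-1 * (A t + 1 * B t)).
    by apply: funext => t; rewrite /A /B; field.
  have -> : (fun t => y n t - y m t) = (fun t => B t + -1 * A t).
    by apply: funext => t; rewrite /A /B; ring.
  have LS : L2 (fun t => A t + 1 * B t) by apply: L2D => //; exact: L2Z.
  rewrite ipZl //; last exact: L2Z.
  rewrite ipC ipZl // !nsqD // [ip B A]ipC => h1 h2 h3.
  move: h1 h2 h3; move: (n.+1%:R^-1) (m.+1%:R^-1) (ip A A) (ip B B) (ip A B) => *; lra.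
have small (d : R) : 0 < d -> exists n : nat, n.+1%:R^-1 < d.
  move=> d0; exists (Num.Def.archi_bound d^-1); rewrite invf_plt ?posrE //.
  apply: lt_trans (archi_boundP _) _; first by rewrite invr_ge0 ltW.
  by rewrite ltr_nat.
have ycvg t : exists l : R, (fun n => y n t) @ \oo --> l.
  suff c : cvg ((fun n => y n t) @ \oo) by exists (lim ((fun n => y n t) @ \oo)).
  apply: cauchy_cvg; apply: cauchy_exP => d d0.
  have [N hN] := small (d * d / 4) (divr_gt0 (mulr_gt0 d0 d0) (ltr0n _ 4)).
  exists (y N t); exists N => // n /= Nn.
  have le : n.+1%:R^-1 <= N.+1%:R^-1 :> R by rewrite lef_pV2 ?posrE // ler_nat ltnS.
  have h := le_trans (ip_ge t (L2B (Ly N) (Ly n))) (par N n).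
  have : (y N t - y n t) * (y N t - y n t) < d * d.
    by move: h le hN; move: (N.+1%:R^-1) (n.+1%:R^-1) => a b *; lra.
  rewrite /ball /= => hz.
  by rewrite -(@ltr_pXn2r _ 2) ?nnegrE ?normr_ge0 ?ltW // real_normK ?num_real // !expr2.
have [p hp] := choice ycvg.
(* Fatou's lemma for $|y_{m+n}-y_n|^2$ as $m$ grows, with the uniform bound from [par]. *)
have lim n : L2 (fun t => p t - y n t) /\
    ip (fun t => p t - y n t) (fun t => p t - y n t) <= 4 * n.+1%:R^-1.
  apply: (@tsum_fatou _ _ (fun m t => (y (m + n)%N t - y n t) * (y (m + n)%N t - y n t))).
  - by move=> m t; rewrite -expr2 sqr_ge0.
  - by move=> t; rewrite -expr2 sqr_ge0.
  - move=> t; have c : (fun m => y (m + n)%N t) @ \oo --> p t.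
      by have := hp t; rewrite -(cvg_shiftn n).
    by apply: cvgM; apply: cvgB => //; exact: cvg_cst.
  - by move=> m; exact: (L2B (Ly _) (Ly _)).
  move=> m; apply: le_trans (par (m + n)%N n) _.
  have : (m + n).+1%:R^-1 <= n.+1%:R^-1 :> R by rewrite lef_pV2 ?posrE // ler_nat ltnS leq_addl.
  by move: ((m + n).+1%:R^-1) (n.+1%:R^-1) => a b *; lra.
have Lp : L2 p.
  have := L2D (lim 0%N).1 (Ly 0%N); congr L2; apply: funext => t; by rewrite subrK.
exists p; split=> //.
  move=> d d0; have [n hn] := small (d / 4) (divr_gt0 d0 (ltr0n _ 4)).
  exists (y n) => //; apply: le_lt_trans (lim n).2 _.
  by move: hn; move: (n.+1%:R^-1) => a *; lra.
move=> z Vz; have Lz := VL Vz; have Lep := L2B he Lp.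
set a := ip _ _; set C := ip z z; have C0 : 0 <= C := ip_ge0 z.
have bound n : a * a <= (10 * C + 2) * n.+1%:R^-1.
  have hb := cauchy_schwarz (lim n).1 Lz; have hl := (lim n).2.
  set b := ip _ z in hb; rewrite -/C in hb.
  have Lyn : L2 (fun t => e t - y n t) := L2B he (Ly n).
  have ab : ip (fun t => e t - y n t) z = a + b.
    have Lpn := (lim n).1; rewrite /a /b -(ipDl Lep Lpn Lz).
    by apply: eq_tsum => t; congr (_ * _); ring.
  have C1 : 0 < C + 1 by lra.
  pose s := (a + b) / (C + 1).
  have := DE _ (VD s (Vy n) Vz); have := (hy n).2.
  have -> : (fun t => e t - (y n t + s * z t)) = (fun t => (e t - y n t) + (- s) * z t).
    by apply: funext => t; ring.
  rewrite (nsqD _ Lyn Lz) ab -/C => h1 h2.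
  have h5 : b * b <= 4 * n.+1%:R^-1 * C.
    by apply: le_trans hb _; apply: ler_wpM2r.
  exact: (proj_arith C0 h1 h5 h2).
apply/eqP; rewrite -sqrf_eq0 expr2 eq_le -{2}expr2 sqr_ge0 andbT leNgt; apply/negP => a0.
have [|n hn] := small (a * a / (10 * C + 2)); first by apply: divr_gt0 => //; lra.
move: hn; rewrite ltr_pdivlMr; last by lra.
by move=> hn; have := bound n; rewrite leNgt => /negP; apply; rewrite [ltLHS]mulrC.
Qed.

End Projection.
End Ell2.

Section Pairs.
Variables (R : realType).

Lemma psum_reindex (T T' : choiceType) (s : T -> T') (u : T' -> R) : bijective s ->
  psum (fun t => u (s t)) = psum u.
Proof.
move=> bs; rewrite /psum (@reindex_esum _ T T' setT setT s) //.
split=> // [x y _ _|y _]; first exact: bij_inj.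
by case: bs => t _ ts; exists (t y).
Qed.

Lemma summ_reindex (T T' : choiceType) (s : T -> T') (f : T' -> R) : bijective s ->
  summ f -> summ (fun t => f (s t)).
Proof. by move=> bs; rewrite /summ (psum_reindex (fun t => `|f t|) bs). Qed.

Lemma tsum_reindex (T T' : choiceType) (s : T -> T') (f : T' -> R) : bijective s ->
  tsum (fun t => f (s t)) = tsum f.
Proof.
move=> bs; rewrite /tsum (psum_reindex (fun t => `|f t| + f t) bs).
by rewrite (psum_reindex (fun t => `|f t|) bs).
Qed.

Variables (I : finType) (T : choiceType).

Lemma psum_pair (u : I * T -> R) : (forall p, 0 <= u p) ->
  psum u = (\sum_i psum (fun t => u (i, t)))%E.
Proof.
move=> hu; have := @esum_esum R I T setT (fun _ => setT) (fun i t => (u (i, t))%:E).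
have -> : [set: I] `*`` (fun _ => [set: T]) = [set: I * T] by apply/seteqP; split.
have fI : finite_set [set: I] by exact: finite_finset.
rewrite esum_fset => [|//|i _]; last by apply: esum_ge0 => t _; rewrite lee_fin.
rewrite (@fsbigE _ _ _ _ _ (index_enum I)) ?index_enum_uniq //.
  move=> h; rewrite /psum; transitivity (\esum_(k in [set: I * T]) (u (k.1, k.2))%:E)%E.
    by apply: eq_esum => -[].
  rewrite -h => [|i t _ _]; last by rewrite lee_fin.
  by apply: eq_bigl => i; rewrite mem_set.
by move=> i _; rewrite mem_index_enum.
Qed.

Lemma summ_pair (f : I * T -> R) : summ f <-> forall i, summ (fun t => f (i, t)).
Proof.
rewrite /summ psum_pair //; split=> [h i|h].
  apply: le_lt_trans h; rewrite (bigD1 i) //= leeDl //.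
  by apply: sume_ge0 => j _; exact: psum_ge0.
by apply: lte_sum_pinfty => i _; exact: h.
Qed.

Lemma tsum_pair (f : I * T -> R) : summ f -> tsum f = \sum_i tsum (fun t => f (i, t)).
Proof.
move=> /summ_pair sf.
have p t : 0 <= `|f t| + f t by have := ler_norm (- f t); rewrite normrN; lra.
rewrite /tsum !psum_pair //.
have E (u : I * T -> R) : (forall t, 0 <= u t) -> (forall i, summ (fun t => u (i, t))) ->
    fine (\sum_i psum (fun t => u (i, t)))%E = \sum_i fine (psum (fun t => u (i, t))).
  move=> hu su; have -> : (\sum_i psum (fun t => u (i, t)))%E =
      (\sum_i (fine (psum (fun t => u (i, t))))%:E)%E.
    by apply: eq_bigr => i _; rewrite fineK // psum_fin.
  by rewrite sumEFin.
rewrite (E (fun t => `|f t| + f t)) //; last first.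
  by move=> i; apply: summD => //; exact: summ_norm.
rewrite (E (fun t => `|f t|)) //; first by rewrite sumrB.
by move=> i; exact: summ_norm.
Qed.

End Pairs.

(** * The action of matrices over ZG *)

Section Action.
Variables (R : realType) (G : groupType).
Local Notation ZG := (groupRing G).
Local Notation mat := (mat ZG).
Implicit Types (y z : G -> R) (a b : ZG).

Definition ract y a : G -> R := fun h =>
  \sum_(g <- dom a) (coeff g a)%:~R * y (h * g^-1)%g.

Lemma ractE y a h : ract y a h = fglift (fun g => y (h * g^-1)%g : zmodule R) a.
Proof.
by rewrite fglift_sumE; apply: eq_bigr => g _; rewrite scalezrE mulrzl.
Qed.

Lemma ractD y a b h : ract y (a + b) h = ract y a h + ract y b h.
Proof. by rewrite !ractE fglift_add. Qed.

Lemma ract0 y h : ract y 0 h = 0.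
Proof. by rewrite ractE fglift0. Qed.

Lemma ract_sum (J : Type) (r : seq J) (F : J -> ZG) y h :
  ract y (\sum_(j <- r) F j) h = \sum_(j <- r) ract y (F j) h.
Proof.
exact: (big_morph (fun a => ract y a h) (fun a b => ractD y a b h) (ract0 y h)).
Qed.

Lemma ractU y k (g : G) h : ract y << k *g g >> h = k%:~R * y (h * g^-1)%g.
Proof. by rewrite ractE liftU scalezrE mulrzl. Qed.

Lemma ract1 y h : ract y 1 h = y h.
Proof. by rewrite [1]/(<< 1 *g 1%g >>) ractU mul1r invg1 mulg1. Qed.

Lemma ractM y a b h : ract y (a * b) h = ract (ract y a) b h.
Proof.
rewrite [a * b]/(gr_mul a b) /gr_mul ract_sum.
under eq_bigr do rewrite ract_sum.
rewrite exchange_big /=; apply: eq_bigr => k _; rewrite mulr_sumr.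
apply: eq_bigr => g _; rewrite ractU intrM invgM !mulgA.
by rewrite mulrA [_ * (coeff g a)%:~R]mulrC.
Qed.

Lemma ract_lin c y z a h : ract (fun g => y g + c * z g) a h = ract y a h + c * ract z a h.
Proof.
rewrite /ract mulr_sumr -big_split; apply: eq_bigr => g _ /=.
by rewrite mulrDr mulrCA.
Qed.

(** The canonical involution of the group ring; by [ip_ract] it gives the adjoint operator. *)
Definition gstar a : ZG := \sum_(g <- dom a) << coeff g a *g (g^-1)%g >>.

Lemma ract_star y a h : ract y (gstar a) h = \sum_(g <- dom a) (coeff g a)%:~R * y (h * g)%g.
Proof. by rewrite ract_sum; apply: eq_bigr => g _; rewrite ractU invgK. Qed.

Lemma transl_bij (g : G) : bijective (fun h => h * g)%g.
Proof. by exists (fun h => h * g^-1)%g => h; rewrite -mulgA ?mulgV ?mulVg mulg1. Qed.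

Lemma L2_transl y g : L2 y -> L2 (fun h => y (h * g)%g).
Proof. exact: (summ_reindex (f := fun h => y h * y h) (transl_bij g)). Qed.

Lemma L2_ract y a : L2 y -> L2 (ract y a).
Proof.
move=> hy; apply: (@L2_sum R G _ (dom a) (fun g h => (coeff g a)%:~R * y (h * g^-1)%g)) => g.
by apply: L2Z; exact: L2_transl.
Qed.

Lemma ip_ract y z a : L2 y -> L2 z -> ip (ract y a) z = ip y (ract z (gstar a)).
Proof.
move=> hy hz.
have -> : ract z (gstar a) = fun h => \sum_(g <- dom a) (coeff g a)%:~R * z (h * g)%g.
  by apply: funext => h; rewrite ract_star.
rewrite [RHS]ipC !ip_suml //; last 2 first.
- by move=> g; apply: L2Z; exact: L2_transl.
- by move=> g; apply: L2Z; exact: L2_transl.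
apply: eq_bigr => g _; rewrite !ipZl //; try exact: L2_transl.
congr (_ * _); rewrite [RHS]ipC /ip -[RHS](tsum_reindex _ (transl_bij g^-1)).
by apply: eq_tsum => h; rewrite -mulgA mulVg mulg1.
Qed.

Section Operators.
Variables I J K : finType.
Implicit Types (x u : I * G -> R).

(** Vectors are functions on [I * G], so that a finite sum of copies of $\ell^2(G)$ is again
    $\ell^2$ of one set. *)
Definition Lam_real (I J : finType) (A : mat I J) (x : I * G -> R) : J * G -> R :=
  fun p => \sum_i ract (fun g => x (i, g)) (A i p.1) p.2.

Lemma Lam_lin (A : mat I J) c x u p : Lam_real A (fun p => x p + c * u p) p = Lam_real A x p + c * Lam_real A u p.
Proof.
rewrite /Lam_real mulr_sumr -big_split; apply: eq_bigr => i _ /=.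
exact: (ract_lin c (fun g => x (i, g)) (fun g => u (i, g))).
Qed.

Lemma LamD (A B : mat I J) x p : Lam_real (A + B) x p = Lam_real A x p + Lam_real B x p.
Proof. by rewrite /Lam_real -big_split; apply: eq_bigr => i _ /=; rewrite ractD. Qed.

Lemma Lam_mul (A : mat I J) (B : mat J K) x : Lam_real (A ** B) x = Lam_real B (Lam_real A x).
Proof.
apply: funext => -[k h]; rewrite /Lam_real /=.
transitivity (\sum_i \sum_j ract (ract (fun g => x (i, g)) (A i j)) (B j k) h).
  by apply: eq_bigr => i _; rewrite mmulE ract_sum; apply: eq_bigr => j _; rewrite ractM.
rewrite exchange_big /=; apply: eq_bigr => j _.
rewrite /ract [RHS](eq_bigr (fun g => \sum_i (coeff g (B j k))%:~R *
   \sum_(g0 <- dom (A i j)) (coeff g0 (A i j))%:~R * x (i, h * g^-1 * g0^-1)%g)).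
  by rewrite exchange_big.
by move=> g _; rewrite mulr_sumr.
Qed.

Lemma Lam_one x : Lam_real (mone I) x = x.
Proof.
apply: funext => -[k h]; rewrite /Lam_real (bigD1 k) //= big1 ?addr0 => [|i ik].
  by rewrite /mone eqxx ract1.
by rewrite /mone (negPf ik) ract0.
Qed.

Lemma Lam0 x p : Lam_real (0 : mat I J) x p = 0.
Proof. by rewrite /Lam_real big1 // => i _; rewrite ract0. Qed.

Lemma L2_pair (I' : finType) (y : I' * G -> R) : L2 y <-> forall i, L2 (fun g => y (i, g)).
Proof. exact: summ_pair. Qed.

Lemma ip_pair (I' : finType) (y z : I' * G -> R) : L2 y -> L2 z ->
  ip y z = \sum_i ip (fun g => y (i, g)) (fun g => z (i, g)).
Proof. by move=> hy hz; apply: (@tsum_pair _ _ _ (fun p => y p * z p)); exact: summ_ip. Qed.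

Lemma L2_Lam (A : mat I J) x : L2 x -> L2 (Lam_real A x).
Proof.
move=> /L2_pair hx; apply/L2_pair => j.
apply: (@L2_sum R G _ _ (fun i h => ract (fun g => x (i, g)) (A i j) h)) => i.
exact: L2_ract.
Qed.

Definition mstar (I J : finType) (A : mat I J) : mat J I := fun j i => gstar (A i j).

End Operators.

Lemma ip_Lam (I J : finType) (A : mat I J) (x : I * G -> R) (y : J * G -> R) : L2 x -> L2 y ->
  ip (Lam_real A x) y = ip x (Lam_real (mstar A) y).
Proof.
move=> hx hy; have hx' := (L2_pair x).1 hx; have hy' := (L2_pair y).1 hy.
rewrite (ip_pair (L2_Lam A hx) hy) (ip_pair hx (L2_Lam (mstar A) hy)).
transitivity (\sum_j \sum_i ip (ract (fun g => x (i, g)) (A i j)) (fun g => y (j, g))).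
  apply: eq_bigr => j _; rewrite -ip_suml // => i; exact: L2_ract.
rewrite exchange_big /=; apply: eq_bigr => i _; rewrite [RHS]ipC.
transitivity (\sum_j ip (ract (fun g => y (j, g)) (mstar A j i)) (fun g => x (i, g))).
  by apply: eq_bigr => j _; rewrite ip_ract // ipC.
by rewrite -ip_suml // => j; exact: L2_ract.
Qed.

Definition injL (I J : finType) (A : mat I J) : Prop :=
  forall x : I * G -> R, L2 x -> Lam_real A x = (fun _ => 0) -> x = fun _ => 0.

End Action.

(** * Regularised equations and the trace estimate *)

Section Tikhonov.
Variables (R : realType) (G : groupType).
Local Notation ZG := (groupRing G).
Local Notation mat := (mat ZG).
Local Notation Lam := (@Lam_real R G _ _).
Implicit Types I J K : finType.

(** Left translation, which commutes with the right action of $\mathbb ZG$ ([Lam_ltr]). *)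
Definition ltr I (g : G) (x : I * G -> R) : I * G -> R := fun p => x (p.1, (g^-1 * p.2)%g).

Lemma L2_ltr I g (x : I * G -> R) : L2 x -> L2 (ltr g x).
Proof.
have bs : bijective (fun p : I * G => (p.1, (g^-1 * p.2)%g)).
  exists (fun p : I * G => (p.1, (g * p.2)%g)) => -[i h] /=.
    by rewrite mulVKg.
  by rewrite mulKg.
exact: (summ_reindex (f := fun p => x p * x p) bs).
Qed.

Lemma Lam_ltr I J (A : mat I J) g (x : I * G -> R) : Lam A (ltr g x) = ltr g (Lam A x).
Proof.
apply: funext => -[j h]; apply: eq_bigr => i _; rewrite /ract /=.
by apply: eq_bigr => k _; rewrite /ltr /= mulgA.
Qed.

Definition delta I (i : I) : I * G -> R := fun p => (p == (i, 1%g))%:R.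

Lemma delta_single I (i : I) (f : I * G -> R) :
  summ (fun p => f p * delta i p) /\ tsum (fun p => f p * delta i p) = f (i, 1%g).
Proof.
have [|s ->] := @tsum_single R _ (fun p => f p * delta i p) (i, 1%g).
  by move=> p np; rewrite /delta (negPf np) mulr0.
by rewrite /delta eqxx mulr1.
Qed.

Lemma L2_delta I (i : I) : L2 (delta i).
Proof. exact: (delta_single i (delta i)).1. Qed.

Lemma ip_delta I (i : I) (f : I * G -> R) : ip f (delta i) = f (i, 1%g).
Proof. exact: (delta_single i f).2. Qed.

Lemma nsq_delta I (i : I) : ip (delta i) (delta i) = 1.
Proof. by rewrite ip_delta /delta eqxx. Qed.

Lemma coeff_pick (a : ZG) h :
  \sum_(g <- dom a) (if g == h then (coeff h a)%:~R else 0) = (coeff h a)%:~R :> R.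
Proof.
have [hd|hd] := boolP (h \in dom a).
  rewrite (bigD1_seq h) ?uniq_dom //= eqxx big1 ?addr0 // => g gh.
  by rewrite (negPf gh).
rewrite coeff_outdom // big1_seq // => g /andP[_ hg].
by case: eqP hg hd => // -> ->.
Qed.

Lemma Lam_delta I J (A : mat I J) i j h : Lam A (delta i) (j, h) = (coeff h (A i j))%:~R.
Proof.
rewrite /Lam_real (bigD1 i) //= [X in _ + X]big1 ?addr0 => [|k ki]; last first.
  by rewrite /ract big1 // => g _; rewrite /delta xpair_eqE (negPf ki) mulr0.
rewrite /ract; have E g : (coeff g (A i j))%:~R * delta i (i, (h * g^-1)%g) =
    if g == h then (coeff h (A i j))%:~R else 0 :> R.
  rewrite /delta xpair_eqE eqxx /=.
  have -> : ((h * g^-1)%g == 1%g) = (g == h).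
    apply/eqP/eqP => [e|->]; last by rewrite mulgV.
    by rewrite -[g]mul1g -e -mulgA mulVg mulg1.
  by case: eqP => [->|_]; rewrite ?mulr1 ?mulr0.
under eq_bigr do rewrite E.
exact: coeff_pick.
Qed.

(** The value at $Ae_i$ of the equivariant operator that sends $e_j$ to $k_j$. The entries of $A$
    have finite support, so this value is a finite combination of translates of the $k_j$. *)
Definition comb I J K (A : mat I J) (i : I) (k : J -> K * G -> R) : K * G -> R := fun p =>
  \sum_j \sum_(g <- dom (A i j)) (coeff g (A i j))%:~R * ltr g (k j) p.

Lemma comb_delta I J (A : mat I J) i : comb A i (@delta J) = Lam A (delta i).
Proof.
apply: funext => -[j h]; rewrite Lam_delta /comb (bigD1 j) //= [X in _ + X]big1 ?addr0; last first.
  move=> j' jj; rewrite big1 // => g _.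
  by rewrite /ltr /delta xpair_eqE [_ == j']eq_sym (negPf jj) mulr0.
have E g : (coeff g (A i j))%:~R * ltr g (delta j) (j, h) =
    if g == h then (coeff h (A i j))%:~R else 0 :> R.
  rewrite /ltr /delta xpair_eqE eqxx /=.
  have -> : ((g^-1 * h)%g == 1%g) = (g == h).
    apply/eqP/eqP => [e|->]; last by rewrite mulVg.
    by rewrite -[h]mul1g -(mulgV g) -mulgA e mulg1.
  by case: eqP => [->|_]; rewrite ?mulr1 ?mulr0.
under eq_bigr do rewrite E.
exact: coeff_pick.
Qed.

Lemma Lam_zero I J (A : mat I J) p : Lam A (fun _ => 0) p = 0.
Proof.
by rewrite /Lam_real big1 // => i _; rewrite /ract big1 // => g _; rewrite mulr0.
Qed.

Lemma Lam_sum I J (A : mat I J) (T : Type) (r : seq T) (F : T -> I * G -> R) p :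
  Lam A (fun q => \sum_(t <- r) F t q) p = \sum_(t <- r) Lam A (F t) p.
Proof.
elim: r => [|t r ih].
  rewrite big_nil -[RHS](Lam_zero A p); congr (Lam A _ p).
  by apply: funext => q; rewrite big_nil.
rewrite big_cons -ih -[X in _ + X]mul1r -Lam_lin; congr (Lam A _ p).
by apply: funext => q; rewrite big_cons mul1r.
Qed.

Lemma LamZ I J (A : mat I J) c (x : I * G -> R) p : Lam A (fun q => c * x q) p = c * Lam A x p.
Proof.
rewrite -[LHS]/(Lam A (fun q => c * x q) p) -[RHS]add0r -[X in X + _](Lam_zero A p) -Lam_lin.
by congr (Lam A _ p); apply: funext => q; rewrite add0r.
Qed.

Lemma Lam_comb I J K (L : finType) (A : mat I J) i (B : mat K L) (k : J -> K * G -> R) :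
  Lam B (comb A i k) = comb A i (fun j => Lam B (k j)).
Proof.
apply: funext => p; rewrite /comb Lam_sum; apply: eq_bigr => j _.
rewrite Lam_sum; apply: eq_bigr => g _.
by rewrite LamZ Lam_ltr.
Qed.

Lemma L2_comb I J K (A : mat I J) i (k : J -> K * G -> R) : (forall j, L2 (k j)) -> L2 (comb A i k).
Proof.
move=> h; apply: (@L2_sum R _ _ _ (fun j p =>
  \sum_(g <- dom (A i j)) (coeff g (A i j))%:~R * ltr g (k j) p)) => j.
apply: (@L2_sum R _ _ _ (fun g p => (coeff g (A i j))%:~R * ltr g (k j) p)) => g.
by apply: L2Z; exact: L2_ltr.
Qed.

(* Both traces are the same finite sum. *)
Lemma trace_comb I J (A : mat I J) (k : J -> I * G -> R) :
  \sum_i ip (comb A i k) (delta i) = \sum_j ip (Lam A (k j)) (delta j).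
Proof.
under eq_bigr do rewrite ip_delta.
under [RHS]eq_bigr do rewrite ip_delta.
rewrite /comb exchange_big /=; apply: eq_bigr => j _; apply: eq_bigr => i _.
by apply: eq_bigr => g _; rewrite /ltr /= mulg1 mul1g.
Qed.

(** Both sides are adjoint to the operator of [mstar A], so they have the same inner products. *)
Lemma Lam_starK I J (A : mat I J) (x : I * G -> R) : L2 x -> Lam (mstar (mstar A)) x = Lam A x.
Proof.
move=> hx; have L1 := L2_Lam (mstar (mstar A)) hx; have L2' := L2_Lam A hx.
have e y : L2 y -> ip (Lam (mstar (mstar A)) x) y = ip (Lam A x) y.
  by move=> hy; rewrite [LHS]ipC -ip_Lam // ipC -ip_Lam.
have LB := L2B L1 L2'.
have z := ip_eq0 LB.
apply: funext => p; apply/eqP; rewrite -subr_eq0; apply/eqP.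
have /z h : ip (fun t => Lam (mstar (mstar A)) x t - Lam A x t)
   (fun t => Lam (mstar (mstar A)) x t - Lam A x t) = 0.
  by rewrite ipBl // e // subrr.
exact: (congr1 (fun f => f p) h).
Qed.

Lemma injL_starK I J (A : mat I J) : injL R A -> injL R (mstar (mstar A)).
Proof. by move=> h x Lx; rewrite Lam_starK //; exact: h. Qed.

Section Solve.
Variables (I J : finType) (A : mat I J).
Local Notation As := (mstar A).

(* The orthogonal projection of (e, 0) onto the closure of the vectors (A x, s x). *)
Lemma tikhonov (e : J * G -> R) (s : R) : 0 < s -> L2 e ->
  exists k, L2 k /\ forall p, Lam As (Lam A k) p + s * s * k p = Lam As e p.
Proof.
move=> s0 he.
pose pair (u : J * G -> R) (v : I * G -> R) : (J + I) * G -> R := fun p =>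
  match p.1 with inl j => u (j, p.2) | inr i => v (i, p.2) end.
have L2p u v : L2 (pair u v) <-> L2 u /\ L2 v.
  rewrite !L2_pair; split=> [h|[h1 h2] [j|i]].
  - by split=> i; [exact: (h (inl i)) | exact: (h (inr i))].
  - exact: h1.
  - exact: h2.
have ipp u v u' v' : L2 u -> L2 v -> L2 u' -> L2 v' ->
    ip (pair u v) (pair u' v') = ip u u' + ip v v'.
  move=> hu hv hu' hv'; rewrite (ip_pair (y := pair u v)); try by apply/L2p.
  by rewrite big_sumType /=; congr (_ + _); rewrite ip_pair.
have pairE (p : (J + I) * G -> R) : p = pair (fun q => p (inl q.1, q.2)) (fun q => p (inr q.1, q.2)).
  by apply: funext => -[[j|i] g].
pose V := [set pair (Lam A x) (fun q => s * x q) | x in [set x | L2 x]].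
have V0 : V (fun _ => 0).
  exists (fun _ => 0); first exact: L20.
  by apply: funext => -[[j|i] g]; rewrite /pair /= ?Lam_zero ?mulr0.
have VD a f g : V f -> V g -> V (fun t => f t + a * g t).
  move=> [x hx <-] [y hy <-]; exists (fun t => x t + a * y t).
    by apply: L2D => //; exact: L2Z.
  by apply: funext => -[[j|i] h]; rewrite /pair /= ?Lam_lin //; ring.
have VL f : V f -> L2 f.
  by move=> [x hx <-]; apply/L2p; split; [exact: L2_Lam | exact: L2Z].
have L0 (K : finType) : L2 (fun _ : K * G => 0 : R) by exact: L20.
have [p [Lp ap op]] := @projection R _ V V0 VD VL (pair e (fun _ => 0)) ((L2p _ _).2 (conj he (L0 I))).
move: Lp ap op; rewrite [p]pairE; set p1 := fun q => p (inl q.1, q.2); set p2 := fun q => p (inr q.1, q.2).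
move=> /L2p[L1 L2'] ap op.
(* Orthogonality of $(e-p_1,-p_2)$ to $(Aw,sw)$, taken for $w$ equal to the difference of the two
   sides. *)
have E1 q : Lam As (fun t => e t - p1 t) q = s * p2 q.
  have Le1 : L2 (fun t => e t - p1 t) by exact: L2B.
  have Lu : L2 (fun q => Lam As (fun t => e t - p1 t) q - s * p2 q).
    by apply: L2B; [exact: L2_Lam | exact: L2Z].
  have z : ip (fun q => Lam As (fun t => e t - p1 t) q - s * p2 q)
      (fun q => Lam As (fun t => e t - p1 t) q - s * p2 q) = 0.
    set w := fun q => _ - _ in Lu *.
    have := op _ (ex_intro2 _ _ w Lu erefl).
    have -> : (fun t => pair e (fun _ => 0) t - pair p1 p2 t) =
        pair (fun t => e t - p1 t) (fun t => - 1 * p2 t).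
      by apply: funext => -[[j|i] g]; rewrite /pair /= //; ring.
    rewrite ipp //; [|exact: L2Z|exact: L2_Lam|exact: L2Z].
    rewrite [ip (fun t => e t - p1 t) _]ipC ip_Lam // [ip w _]ipC.
    rewrite [ip _ (fun q => s * w q)]ipC !ipZl //; last exact: L2Z.
    rewrite [ip w (fun t => -1 * p2 t)]ipC ipZl // => h.
    rewrite {1}/w ipBl //; [|exact: L2_Lam|exact: L2Z].
    by rewrite ipZl //; lra.
  by have := congr1 (fun f => f q) (ip_eq0 Lu z) => /= /eqP; rewrite subr_eq0 => /eqP.
(* The vector $(w,-s^{-1}A^{*}w)$ is orthogonal to every $(Ax,sx)$, hence to the point $(p_1,p_2)$
   of their closure; $w$ is again the difference of the two sides. *)
have E2 q : p1 q = s^-1 * Lam A p2 q.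
  have Lu : L2 (fun q => p1 q - s^-1 * Lam A p2 q).
    by apply: L2B => //; apply: L2Z; exact: L2_Lam.
  have z : ip (fun q => p1 q - s^-1 * Lam A p2 q) (fun q => p1 q - s^-1 * Lam A p2 q) = 0.
    set w := fun q => _ - _ in Lu *.
    have Lw2 : L2 (fun q => (- s^-1) * Lam As w q) by apply: L2Z; exact: L2_Lam.
    have := @adherent_orth R _ V VL (pair p1 p2) (pair w (fun q => (- s^-1) * Lam As w q)).
    move=> /(_ ((L2p _ _).2 (conj L1 L2')) ((L2p _ _).2 (conj Lu Lw2)) ap) h.
    have {h} : ip (pair p1 p2) (pair w (fun q => (- s^-1) * Lam As w q)) = 0.
      apply: h => _ [x hx <-]; rewrite ipp //; [|exact: L2_Lam|exact: L2Z].
      rewrite ip_Lam // ipZl // [ip x (fun q => - s^-1 * _)]ipC ipZl //; last exact: L2_Lam.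
      rewrite [ip _ x]ipC; have sn : s != 0 by rewrite gt_eqF.
      by rewrite mulrA mulrN mulfV // mulN1r subrr.
    rewrite ipp // [ip p2 _]ipC ipZl //; last exact: L2_Lam.
    rewrite [ip (Lam As w) p2]ipC -ip_Lam // => h.
    rewrite {1}/w ipBl //; last by apply: L2Z; exact: L2_Lam.
    by rewrite ipZl //; [lra | exact: L2_Lam].
  by have := congr1 (fun f => f q) (ip_eq0 Lu z) => /= /eqP; rewrite subr_eq0 => /eqP.
have sn : s != 0 by rewrite gt_eqF.
exists (fun q => s^-1 * p2 q); split; first exact: L2Z.
move=> q; have -> : Lam A (fun q => s^-1 * p2 q) = p1.
  by apply: funext => t; rewrite LamZ E2.
have -> : s * s * (s^-1 * p2 q) = s * p2 q by rewrite mulrA mulfK.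
rewrite -E1.
have -> : (fun t => e t - p1 t) = (fun t => e t + -1 * p1 t) by apply: funext => t; ring.
by rewrite Lam_lin; ring.
Qed.

Definition range2 : set (J * G -> R) := [set Lam A z | z in [set z | L2 z]].

Lemma range2_L2 f : range2 f -> L2 f.
Proof. by move=> [x hx <-]; exact: L2_Lam. Qed.

Lemma range2_split (e : J * G -> R) : L2 e -> exists p,
  [/\ L2 p, adherent range2 p & Lam As (fun t => e t - p t) = fun _ => 0].
Proof.
move=> he.
have V0 : range2 (fun _ => 0).
  by exists (fun _ => 0); [exact: L20 | apply: funext => p; rewrite Lam_zero].
have VD a f g : range2 f -> range2 g -> range2 (fun t => f t + a * g t).
  move=> [x hx <-] [y hy <-]; exists (fun t => x t + a * y t).
    by apply: L2D => //; exact: L2Z.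
  by apply: funext => p; rewrite Lam_lin.
have [p [Lp ap op]] := @projection R _ range2 V0 VD range2_L2 e he.
have Le : L2 (fun t => e t - p t) by exact: L2B.
exists p; split=> //; apply: ip_eq0; first exact: L2_Lam.
rewrite -ip_Lam //; last exact: L2_Lam.
rewrite ipC; apply: op; exists (Lam As (fun t => e t - p t)) => //; exact: L2_Lam.
Qed.

Lemma dense_range : injL R As -> forall e : J * G -> R, L2 e -> adherent range2 e.
Proof.
move=> inj e he; have [p [Lp ap op]] := range2_split he.
have ez := inj _ (L2B he Lp) op; suff <- : p = e by [].
by apply: funext => t; have := congr1 (fun f => f t) ez => /= /eqP; rewrite subr_eq0 => /eqP.
Qed.

End Solve.

Section Estimates.
Variables (I J : finType) (A : mat I J).
Local Notation As := (mstar A).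
Variable s : R.
Hypothesis s0 : 0 < s.

(* [x] is a regularised solution of [A x = A e]; it converges weakly to [e] as [s] tends to 0. *)
Lemma source_estimate (x e : I * G -> R) (z' : J * G -> R) (tau : R) : L2 x -> L2 e -> L2 z' ->
  (forall p, Lam As (Lam A x) p + s * s * x p = Lam As (Lam A e) p) -> ip e e = 1 ->
  0 < tau -> ip (fun t => e t - Lam As z' t) (fun t => e t - Lam As z' t) < tau * tau ->
  s * s * (ip z' z' + 1) <= tau * tau ->
  1 - ip x e <= 2 * tau.
Proof.
move=> hx he hz' eqn e1 tau0 hd hs.
pose y := fun t => e t - x t; have hy : L2 y by exact: L2B.
have hAy := L2_Lam A hy.
have Ey p : Lam As (Lam A y) p = s * s * x p.
  have -> : Lam A y = (fun p => Lam A e p + -1 * Lam A x p).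
    apply: funext => q; rewrite -Lam_lin; congr (Lam A _ q).
    by apply: funext => t; rewrite /y; ring.
  by rewrite Lam_lin -eqn; ring.
have en : ip (Lam A y) (Lam A y) = s * s * ip x y.
  rewrite ip_Lam; [|exact: hy|exact: hAy].
  rewrite ipC -(ipZl (s * s) hx hy).
  by apply: eq_tsum => p; rewrite Ey.
have xy : ip x y = ip x e - ip x x by rewrite ipC /y ipBl // [ip e x]ipC.
have ss0 : 0 < s * s by exact: mulr_gt0.
have h1 : ip x x <= ip x e.
  rewrite -subr_ge0 -xy -(pmulr_rge0 _ ss0) -en; exact: ip_ge0.
have xe0 : 0 <= ip x e := le_trans (ip_ge0 x) h1.
have hc := cauchy_schwarz hx he; rewrite e1 mulr1 in hc.
have xe1 : ip x e <= 1.
  have [->|n] := eqVneq (ip x e) 0; first exact: ler01.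
  have p : 0 < ip x e by rewrite lt_def n.
  by rewrite -(ler_pM2r p) mul1r; apply: le_trans hc h1.
have yy : ip y y <= 1.
  rewrite /y nsqB // e1 [ip e x]ipC; lra.
have AyAy : ip (Lam A y) (Lam A y) <= s * s.
  rewrite en xy -[leRHS]mulr1 ler_pM2l //; have := ip_ge0 x; lra.
have -> : 1 - ip x e = ip y e by rewrite /y ipBl // e1.
(* Splits $e=A^{*}z'+d$. The first part is tested as $\langle Ay,z'\rangle$ with $\|Ay\|\le s$, the
   second is shorter than $\tau$. *)
have -> : ip y e = ip y (Lam As z') + ip y (fun t => e t - Lam As z' t).
  have LA := L2_Lam As hz'; rewrite ipC [X in X + _]ipC [X in _ + X]ipC.
  rewrite -(ipDl LA (L2B he LA) hy); apply: eq_tsum => t; congr (_ * _).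
  by rewrite addrC subrK.
rewrite -(ip_Lam A hy hz').
set d := fun t => e t - Lam As z' t in hd *.
have hdL : L2 d := L2B he (L2_Lam As hz').
have M0 : 0 < ip z' z' + 1 by have := ip_ge0 z'; lra.
have b1 : ip y d <= tau.
  have := amgm hdL hy tau0; rewrite [ip d y]ipC.
  have : ip d d / tau <= tau by rewrite ler_pdivrMr // ltW.
  have : tau * ip y y <= tau by rewrite ler_piMr // ltW.
  by move: (ip d d / tau) (tau * ip y y) => *; lra.
(* With the weight $\tau/(\|z'\|^2+1)$ both terms of [amgm] are at most $\tau$, the first one by the
   bound on $s$. *)
have b2 : ip (Lam A y) z' <= tau.
  have := amgm hAy hz' (divr_gt0 tau0 M0).
  have : ip (Lam A y) (Lam A y) / (tau / (ip z' z' + 1)) <= tau.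
    rewrite ler_pdivrMr ?divr_gt0 // mulrA ler_pdivlMr //; apply: le_trans hs.
    by apply: ler_wpM2r => //; exact: ltW.
  have : tau / (ip z' z' + 1) * ip z' z' <= tau.
    by rewrite mulrAC ler_pdivrMr // ler_wpM2l ?ltW // ltrDl.
  by move: (_ / (_ / _)) (_ / _ * _) => *; lra.
by move: b1 b2; move: (ip y d) (ip (Lam A y) z') => *; lra.
Qed.

(** Pairing the equation with $k$ gives $\|Ak\|^2+s^2\|k\|^2=\langle Ak,e\rangle$, so
    $\|Ak\|^2\le\langle Ak,e\rangle$; expand $\|Ak-e\|^2$. *)
Lemma target_estimate (k e : _) : L2 k -> L2 e ->
  (forall p, Lam As (Lam A k) p + s * s * k p = Lam As e p) -> ip e e = 1 ->
  ip (fun t => Lam A k t - e t) (fun t => Lam A k t - e t) <= 1 - ip (Lam A k) e.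
Proof.
move=> hk he eqn e1; have hAk := L2_Lam A hk.
have : ip (Lam A k) (Lam A k) + s * s * ip k k = ip (Lam A k) e.
  rewrite ip_Lam; [|exact: hk|exact: hAk]; rewrite ip_Lam; [|exact: hk|exact: he].
  rewrite ![ip k (Lam _ _)]ipC -(ipZl (s * s) hk hk) -(ipDl (L2_Lam As hAk) (L2Z (s * s) hk) hk).
  by apply: eq_tsum => p; rewrite eqn.
rewrite nsqB // e1; have := mulr_ge0 (mulr_ge0 (ltW s0) (ltW s0)) (ip_ge0 k); lra.
Qed.

End Estimates.

Section Injective.
Variables (I J : finType) (A : mat I J).
Local Notation As := (mstar A).

(** Injectivity of $A$ makes the range of $A^{*}$ dense, so each $e_i$ is approximated by some
    $A^{*}z_i$ and [source_estimate] applies. By [trace_comb] the sum over $j$ is a sum over $i$ of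
    terms at least $1-2\tau$. *)
Lemma trace_estimate (tau : R) : injL R A -> 0 < tau -> exists s (k : J -> I * G -> R),
  [/\ 0 < s, forall j, L2 (k j),
      forall j p, Lam As (Lam A (k j)) p + s * s * k j p = Lam As (delta j) p
    & #|I|%:R * (1 - 2 * tau) <= \sum_j ip (Lam A (k j)) (delta j)].
Proof.
move=> inj tau0; have tt : 0 < tau * tau by exact: mulr_gt0.
have /choice[z hz] : forall i : I, exists z, L2 z /\
    ip (fun t => delta i t - Lam As z t) (fun t => delta i t - Lam As z t) < tau * tau.
  move=> i; have [_ [y Ly <-] h] := dense_range (injL_starK inj) (L2_delta i) tt.
  by exists y.
pose M := \sum_i ip (z i) (z i).
have M0 : 0 <= M by apply: sumr_ge0 => i _; exact: ip_ge0.
have M1 : 0 < M + 1 by lra.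
(* Small enough for all $i$ at once: $s^2(\|z_i\|^2+1)\le s^2(M+1)=\tau^2/(M+1)$. *)
pose s := tau / (M + 1); have s0 : 0 < s by exact: divr_gt0.
have hs i : s * s * (ip (z i) (z i) + 1) <= tau * tau.
  apply: (@le_trans _ _ (s * s * (M + 1))).
    apply: ler_wpM2l; first exact/ltW/mulr_gt0.
    rewrite lerD2r /M (bigD1 i) //= lerDl.
    by apply: sumr_ge0 => i' _; exact: ip_ge0.
  have -> : s * s * (M + 1) = tau * tau / (M + 1) by rewrite /s; field; rewrite gt_eqF.
  by rewrite ler_pdivrMr // ler_peMr ?lerDr // ltW.
have /choice[k hk] : forall j : J, exists k, L2 k /\
    forall p, Lam As (Lam A k) p + s * s * k p = Lam As (delta j) p.
  by move=> j; apply: tikhonov => //; exact: L2_delta.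
have Lk j := (hk j).1.
exists s, k; split=> // [j p|]; first exact: (hk j).2.
rewrite -trace_comb -sum1_card natr_sum mulr_suml; apply: ler_sum => i _.
(* By linearity and equivariance the equations for the $e_j$ combine to the one with right hand side
   $A^{*}Ae_i$. *)
have E p : Lam As (Lam A (comb A i k)) p + s * s * comb A i k p = Lam As (Lam A (delta i)) p.
  rewrite !Lam_comb -comb_delta Lam_comb /comb mulr_sumr -big_split /=.
  apply: eq_bigr => j _; rewrite mulr_sumr -big_split /=; apply: eq_bigr => g _.
  by rewrite /ltr -(hk j).2; ring.
have := source_estimate s0 (L2_comb A i Lk) (L2_delta i) (hz i).1 E (nsq_delta i) tau0 (hz i).2 (hs i).
by rewrite mul1r => h; lra.
Qed.

(** Each $\langle Ak_j,e_j\rangle$ is at most 1, so $|I|(1-2\tau)\le|J|$. The choice of $\tau$ keeps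
    the loss $2\tau|I|$ below $1/2$, which integers do not allow if $|J|<|I|$. *)
Lemma injL_card : injL R A -> (#|I| <= #|J|)%N.
Proof.
move=> inj; rewrite leqNgt; apply/negP => lt.
have tau0 : 0 < (4 * (#|I|%:R + 1))^-1 :> R by rewrite invr_gt0 mulr_gt0 // ltr_wpDl.
have [s [k [s0 Lk eqn]]] := trace_estimate inj tau0.
have : \sum_j ip (Lam A (k j)) (delta j) <= #|J|%:R.
  rewrite -sum1_card natr_sum; apply: ler_sum => j _.
  have := target_estimate s0 (Lk j) (L2_delta j) (eqn j) (nsq_delta j).
  by have := ip_ge0 (fun t => Lam A (k j) t - delta j t) => h1 h2; lra.
move: (\sum_j _) => S hS h; have := le_trans h hS.
have : #|J|%:R + 1 <= #|I|%:R :> R by rewrite natr1 ler_nat.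
have : 0 <= #|I|%:R :> R by [].
move: (#|I|%:R) (#|J|%:R) => a b a0 ab.
have : a * (2 * (4 * (a + 1))^-1) <= 1 / 2.
  by rewrite mulrA ler_pdivrMr ?mulr_gt0 //; lra.
by move: (_^-1) => c *; lra.
Qed.

(** A vector $y\ne0$ in the kernel of $A^{*}$ is orthogonal to the range of $A$, so
    $\|Ak_i-e_i\|^2\ge b_i=\langle e_i,y\rangle^2/\|y\|^2$. This lowers the trace to at most
    $|J|-b_j$ with $b_j>0$, while $\tau$ is chosen so that the lower bound is at least
    $|I|-b_j/2$. *)
Lemma injL_mstar : injL R A -> #|I| = #|J| -> injL R As.
Proof.
(* A left translation moves any value of $y$ to the unit element and preserves the kernel. *)
move=> inj cIJ; suff main y j : L2 y -> Lam As y = (fun _ => 0) -> y (j, 1%g) = 0.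
  move=> y Ly Ay; apply: funext => -[j h].
  have := main (ltr (h^-1)%g y) j (L2_ltr _ Ly); rewrite Lam_ltr Ay.
  by rewrite /ltr /= invgK mulg1; exact.
move=> Ly Ay; apply/eqP; apply: contraT => n.
have q0 : 0 < y (j, 1%g) * y (j, 1%g) by rewrite lt_def mulf_neq0 //= -expr2 sqr_ge0.
have le := ip_ge (j, 1%g) Ly; have Y0 := lt_le_trans q0 le.
pose b i := y (i, 1%g) * y (i, 1%g) / ip y y.
have b0 i : 0 <= b i by apply: divr_ge0; [rewrite -expr2 sqr_ge0 | exact: ltW].
have bj : 0 < b j by exact: divr_gt0.
have tau0 : 0 < b j / (4 * (#|I|%:R + 1)) by rewrite divr_gt0 // mulr_gt0 // ltr_wpDl.
have [s [k [s0 Lk eqn]]] := trace_estimate inj tau0.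
have : \sum_j ip (Lam A (k j)) (delta j) <= #|J|%:R - b j.
  apply: (@le_trans _ _ (\sum_i (1 - b i))).
    apply: ler_sum => i _; have LA := L2_Lam A (Lk i).
    have h := target_estimate s0 (Lk i) (L2_delta i) (eqn i) (nsq_delta i).
    have := cauchy_schwarz (L2B LA (L2_delta i)) Ly.
    rewrite ipBl //; last exact: L2_delta.
    rewrite ip_Lam // Ay [ip (k i) _]ipC ip0l [ip (delta i) y]ipC ip_delta sub0r mulrNN => cs.
    have {}cs : b i <= ip (fun t => Lam A (k i) t - delta i t) (fun t => Lam A (k i) t - delta i t).
      by rewrite ler_pdivrMr.
    by move: cs h; move: (ip _ _) (ip _ _) (b i) => *; lra.
  rewrite big_split /= sumrN sumr_const lerD2l lerN2 (bigD1 j) //= lerDl.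
  by apply: sumr_ge0 => i _.
move: (\sum_j _) => S hS h; have := le_trans h hS; rewrite -cIJ.
have : 0 <= #|I|%:R :> R by [].
move: (#|I|%:R) (b j) bj => a c c0 a0.
have : a * (2 * (c / (4 * (a + 1)))) <= c / 2.
  by rewrite !mulrA ler_pdivrMr ?mulr_gt0 //; nra.
by move: (c / (4 * _)) => d h1 h2; clear -c0 a0 h1 h2; lra.
Qed.

End Injective.
End Tikhonov.

(** * Weak isomorphisms and L^2-acyclicity *)

Section WeakClass.
Variables (R : realType) (G : groupType).
Local Notation ZG := (groupRing G).
Local Notation mat := (mat ZG).
Local Notation Lam := (@Lam_real R G _ _).
Local Notation injL := (injL R).
Implicit Types I J K : finType.

(** Equal sizes replace density of the image: by [injL_mstar] the adjoint of an injective square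
    matrix is injective, so the image is dense. *)
Definition weak I J (a : mat I J) : Prop := #|I| = #|J| /\ injL a.

Lemma Lam_mre I J I' J' (f : I' -> I) (f' : I -> I') (g : J' -> J) (a : mat I J) (x : I' * G -> R) j h :
  cancel f f' -> cancel f' f ->
  Lam (mre f g a) x (j, h) = Lam a (fun p => x (f' p.1, p.2)) (g j, h).
Proof.
move=> ff' f'f; rewrite /Lam_real (reindex f) /=; last by exists f' => i _.
by apply: eq_bigr => i _; rewrite ff'.
Qed.

Definition left_part (I J : Type) (x : (I + J) * G -> R) : I * G -> R := fun p => x (inl p.1, p.2).
Definition right_part (I J : Type) (x : (I + J) * G -> R) : J * G -> R := fun p => x (inr p.1, p.2).
Definition glue (I J : Type) (x : I * G -> R) (y : J * G -> R) : (I + J) * G -> R :=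
  fun p => match p.1 with inl i => x (i, p.2) | inr j => y (j, p.2) end.

Lemma L2_parts I J (x : (I + J) * G -> R) : L2 x <-> L2 (left_part x) /\ L2 (right_part x).
Proof.
rewrite !L2_pair; split=> [h|[h1 h2] [i|j]]; last 2 first.
- exact: h1.
- exact: h2.
by split=> i; [exact: (h (inl i))|exact: (h (inr i))].
Qed.

Lemma glueE I J (x : (I + J) * G -> R) : x = glue (left_part x) (right_part x).
Proof. by apply: funext => -[[i|j] g]. Qed.

Lemma left_glue (I J : Type) (x : I * G -> R) (y : J * G -> R) : left_part (glue x y) = x.
Proof. by apply: funext => -[]. Qed.

Lemma right_glue (I J : Type) (x : I * G -> R) (y : J * G -> R) : right_part (glue x y) = y.
Proof. by apply: funext => -[]. Qed.

Lemma Lam_blk I J I' J' (a : mat I I') (b : mat I J') (c : mat J I') (d : mat J J') x :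
  Lam (mblk a b c d) x = glue (fun p => Lam a (left_part x) p + Lam c (right_part x) p)
                              (fun p => Lam b (left_part x) p + Lam d (right_part x) p).
Proof. by apply: funext => -[[i|j] g]; rewrite /Lam_real big_sumType. Qed.

Lemma injL_blk I J I' J' (a : mat I I') (b : mat J J') (c : mat J I') :
  injL a -> injL b -> injL (mblk a 0 c b).
Proof.
move=> ha hb x /L2_parts[L1 L2']; rewrite Lam_blk => e.
have r0 : right_part x = fun _ => 0.
  apply: hb => //; apply: funext => -[j h].
  by have := congr1 (fun f => f (inr j, h)) e; rewrite /glue /= Lam0 add0r.
have l0 : left_part x = fun _ => 0.
  apply: ha => //; apply: funext => -[j h].
  by have := congr1 (fun f => f (inl j, h)) e; rewrite /glue /= r0 Lam_zero addr0.
by rewrite [x]glueE l0 r0; apply: funext => -[[i|j] g].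
Qed.

Lemma injL_diag I J I' J' (a : mat I I') (b : mat J J') :
  injL (mblk a 0 0 b) -> injL a /\ injL b.
Proof.
have g0 (K K' : finType) : glue (fun _ : K * G => 0 : R) (fun _ : K' * G => 0) = fun _ => 0.
  by apply: funext => -[[i|j] g].
move=> h; split=> x Lx ax.
  have Lg : L2 (glue x (fun _ : J * G => 0)) by apply/L2_parts; rewrite left_glue right_glue; split=> //; exact: L20.
  have /(h _ Lg) z : Lam (mblk a 0 0 b) (glue x (fun _ : J * G => 0)) = fun _ => 0.
    rewrite Lam_blk left_glue right_glue -(g0 I' J'); congr glue; apply: funext => p; rewrite Lam0.
      by rewrite ax addr0.
    by rewrite add0r; exact: Lam_zero.
  by apply: funext => -[i k]; exact: (congr1 (fun f => f (inl i, k)) z).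
have Lg : L2 (glue (fun _ : I * G => 0) x) by apply/L2_parts; rewrite left_glue right_glue; split=> //; exact: L20.
have /(h _ Lg) z : Lam (mblk a 0 0 b) (glue (fun _ : I * G => 0) x) = fun _ => 0.
  rewrite Lam_blk left_glue right_glue -(g0 I' J'); congr glue; apply: funext => p; rewrite Lam0.
    by rewrite addr0; exact: Lam_zero.
  by rewrite ax add0r.
by apply: funext => -[i k]; exact: (congr1 (fun f => f (inr i, k)) z).
Qed.

Lemma injL_mul I J K (a : mat I J) (b : mat J K) : injL a -> injL b -> injL (a ** b).
Proof.
by move=> ha hb x Lx; rewrite Lam_mul => /hb h; apply: ha => //; apply: h; exact: L2_Lam.
Qed.

Lemma injL_factor I J K (a : mat I J) (b : mat J K) : injL (a ** b) -> injL a.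
Proof.
move=> h x Lx ax; apply: h => //; rewrite Lam_mul ax.
by apply: funext => p; rewrite Lam_zero.
Qed.

Lemma injL_star_mul I J (a : mat I J) : injL a -> injL (a ** mstar a).
Proof.
move=> ha x Lx; rewrite Lam_mul => e; apply: ha => //; apply: ip_eq0; first exact: L2_Lam.
by rewrite ip_Lam ?e //; [rewrite ipC ip0l | exact: L2_Lam].
Qed.

(** For [gc_sq], injectivity of $ab$ and $ba$ gives that of $a$ and $b$, and [injL_card] applied to
    both equates the sizes. The partner in [gc_dual] is the adjoint. *)
Lemma weak_good : good_class weak.
Proof.
split.
- by move=> I J a [].
- by move=> I; split=> // x _; rewrite Lam_one.
- by move=> I J K a b [c1 h1] [c2 h2]; split; [rewrite c1 | exact: injL_mul].
- move=> I J I' J' f g a bf bg [c h]; split; first by rewrite (bij_eq_card bf) (bij_eq_card bg).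
  case: (bf) => f' ff' f'f; case: (bg) => g' gg' g'g x Lx e.
  have bf' : bijective f' by exists f.
  have Lx' : L2 (fun p : I * G => x (f' p.1, p.2)).
    by apply/L2_pair => i; exact: ((L2_pair x).1 Lx (f' i)).
  have /(h _ Lx') z : Lam a (fun p : I * G => x (f' p.1, p.2)) = fun _ => 0.
    apply: funext => -[j k]; have := congr1 (fun y => y (g' j, k)) e => /=.
    by rewrite (Lam_mre g a x (g' j) k ff' f'f) g'g.
  by apply: funext => -[i k]; have := congr1 (fun y => y (f i, k)) z; rewrite /= ff'.
- move=> I J I' J' a b x [c1 h1] [c2 h2]; split; first by rewrite !card_sum c1 c2.
  exact: injL_blk.
- by move=> I J a b [_ /injL_diag[]].
- move=> I J a b [_ /injL_factor ha] [_ /injL_factor hb]; split=> //.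
  by apply/eqP; rewrite eqn_leq (injL_card ha) (injL_card hb).
- move=> I J a [c h]; exists (mstar a); split; split=> //; first exact: injL_star_mul.
  by apply: injL_mul => //; exact: injL_mstar.
Qed.

(** Provides the hypothesis [ibn] for $\mathbb ZG$: both matrices act injectively, so [injL_card]
    bounds each size by the other. *)
Lemma invertible_card I J (a : mat I J) (b : mat J I) :
  a ** b = mone I -> b ** a = mone J -> #|I| = #|J|.
Proof.
move=> ab ba; have inj1 K : injL (mone K : mat K K) by move=> x _; rewrite Lam_one.
apply/eqP; rewrite eqn_leq.
have /injL_factor/injL_card -> : injL (a ** b) by rewrite ab.
by have /injL_factor/injL_card -> : injL (b ** a) by rewrite ba.
Qed.

(** The delta functions read off the coefficients. It transfers $c^{*}c^{*}=0$ from operators to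
    matrices. *)
Lemma mat_faithful I J (a : mat I J) : (forall x : I * G -> R, L2 x -> Lam a x = fun _ => 0) -> a = 0.
Proof.
move=> h; apply: matP => i j; rewrite mat0E; apply/eqP/(@freeg_eqP _ G) => g; rewrite coeff0.
have := Lam_delta R a i j g; rewrite h; last exact: L2_delta.
by move/esym/eqP; rewrite intr_eq0 => /eqP.
Qed.

Lemma gstar0 : gstar (0 : ZG) = 0.
Proof. by rewrite /gstar dom0 big_nil. Qed.

Section Square.
Variables (I : finType) (deg : I -> int) (c : mat I I).

Definition harmonic_free := forall x : I * G -> R, L2 x ->
  Lam c x = (fun _ => 0) -> Lam (mstar c) x = (fun _ => 0) -> x = fun _ => 0.

Lemma laplace_ip (d : mat I I) (x : I * G -> R) : L2 x ->
  ip x (Lam (c ** d + d ** c) x) = ip x (Lam d (Lam c x)) + ip x (Lam c (Lam d x)).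
Proof.
move=> Lx; rewrite ipC [ip x (Lam d _)]ipC [ip x (Lam c _)]ipC -ipDl //; try by do 2!apply: L2_Lam.
by apply: eq_tsum => p; rewrite LamD !Lam_mul.
Qed.

(** One direction takes $d=c^{*}$: the Laplacian kills only harmonic vectors. For the other, an
    arbitrary $d$ need not be related to $c^{*}$, so the mixed operator $T=c^{*}c+cd$ mediates. It
    is injective since its two terms have orthogonal values, and its adjoint kills harmonic vectors;
    by [injL_mstar] these are zero. *)
Lemma harmonic_sqcontr : cpx deg c -> harmonic_free <-> sqcontr weak deg c.
Proof.
move=> [hc cc]; split=> [hf|[_ [d [hd dd [_ vi]]]] x Lx cx sx].
  have ss : mstar c ** mstar c = 0.
    apply: mat_faithful => x Lx; rewrite Lam_mul; apply: ip_eq0; first by do 2!apply: L2_Lam.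
    rewrite -ip_Lam; [|by do 2!apply: L2_Lam|exact: L2_Lam].
    rewrite -ip_Lam; [|by do 3!apply: L2_Lam|by []].
    rewrite -Lam_mul cc (_ : Lam 0 _ = fun _ => 0) ?ip0l //.
    by apply: funext => p; rewrite Lam0.
  split=> //; exists (mstar c); split=> //.
    move=> i j; have [e|/hc -> _] := eqVneq (c j i) 0; last by rewrite subrK.
    by rewrite /mstar e gstar0 eqxx.
  rewrite sq_sum //; split=> // x Lx e.
  have := laplace_ip (mstar c) Lx; rewrite e ipC ip0l.
  have Lc := L2_Lam c Lx; have Ls := L2_Lam (mstar c) Lx.
  rewrite -(ip_Lam c Lx Lc) [ip x _]ipC (ip_Lam c Ls Lx) => h3.
  have h1 := ip_ge0 (Lam c x); have h2 := ip_ge0 (Lam (mstar c) x).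
  have z : ip (Lam c x) (Lam c x) = 0 /\ ip (Lam (mstar c) x) (Lam (mstar c) x) = 0.
    by clear -h1 h2 h3; split; lra.
  by apply: hf => //; apply: ip_eq0 => //; case: z.
rewrite sq_sum // in vi.
(* On rows this is the matrix of the operator $c^{*}c+cd$. *)
pose T := c ** mstar c + d ** c.
have injT : injL T.
  move=> y Ly Ty; have L1 : L2 (Lam (mstar c) (Lam c y)) by do 2!apply: L2_Lam.
  have L2' : L2 (Lam c (Lam d y)) by do 2!apply: L2_Lam.
  have Ep p : Lam (mstar c) (Lam c y) p + Lam c (Lam d y) p = 0.
    by have := congr1 (fun f => f p) Ty; rewrite LamD !Lam_mul.
  have o : ip (Lam c (Lam d y)) (Lam (mstar c) (Lam c y)) = 0.
    rewrite -ip_Lam //; last by apply: L2_Lam.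
    rewrite -Lam_mul cc (_ : Lam 0 _ = fun _ => 0) ?ip0l //.
    by apply: funext => p; rewrite Lam0.
  have z1 : Lam (mstar c) (Lam c y) = fun _ => 0.
    have z := ip0l (Lam (mstar c) (Lam c y)).
    by rewrite -(funext Ep) (ipDl L1 L2' L1) o addr0 in z; exact: (ip_eq0 L1 z).
  have z2 : Lam c (Lam d y) = fun _ => 0.
    by apply: funext => p; have := Ep p; rewrite z1 add0r.
  have z3 : Lam c y = fun _ => 0.
    have Lc := L2_Lam c Ly; apply: (ip_eq0 Lc); rewrite (ip_Lam c Ly Lc) z1.
    by rewrite ipC ip0l.
  apply: vi => //; apply: funext => p; rewrite LamD !Lam_mul z2 z3.
  by rewrite Lam_zero addr0.
apply: (injL_mstar injT) => //; apply: ip_eq0; first exact: L2_Lam.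
set w := Lam (mstar T) x; have Lw : L2 w by exact: L2_Lam.
rewrite -(ip_Lam T Lw Lx).
have -> : Lam T w = fun p => Lam (mstar c) (Lam c w) p + Lam c (Lam d w) p.
  by apply: funext => p; rewrite LamD !Lam_mul.
have Lcw := L2_Lam c Lw; have Ldw := L2_Lam d Lw.
rewrite (ipDl (L2_Lam (mstar c) Lcw) (L2_Lam c Ldw) Lx).
rewrite [X in X + _]ipC -(ip_Lam c Lx Lcw) cx ip0l add0r (ip_Lam c Ldw Lx).
by rewrite sx ipC ip0l.
Qed.

End Square.
End WeakClass.

(** * From complex to real square summable functions *)

Section Complexification.
Variables (R : realType) (G : groupType).
Local Notation ZG := (groupRing G).
Local Notation mat := (mat ZG).
Local Notation Lam := (@Lam_real R G _ _).
Local Notation injL := (injL R).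
Local Notation C := R[i].
Implicit Types (I J K : finType) (M N : basedMod ZG).

Definition re_part (I : Type) (x : I -> G -> C) : I * G -> R := fun p => complex.Re (x p.1 p.2).
Definition im_part (I : Type) (x : I -> G -> C) : I * G -> R := fun p => complex.Im (x p.1 p.2).
Definition cplx (I : Type) (u v : I * G -> R) : I -> G -> C := fun i g => (u (i, g) +i* v (i, g))%C.

Lemma re_cplx (I : Type) (u v : I * G -> R) : re_part (cplx u v) = u.
Proof. by apply: funext => -[]. Qed.

Lemma im_cplx (I : Type) (u v : I * G -> R) : im_part (cplx u v) = v.
Proof. by apply: funext => -[]. Qed.

Lemma cplxE (I : Type) (x : I -> G -> C) : x = cplx (re_part x) (im_part x).
Proof.
by apply: funext => i; apply: funext => g; rewrite /cplx /re_part /im_part /=; case: (x i g).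
Qed.

Lemma Re_intM (k : int) (z : C) : complex.Re (k%:~R * z) = k%:~R * complex.Re z.
Proof.
have -> : (k%:~R : C) = ((k%:~R : R)%:C)%C by rewrite rmorph_int.
by case: z => a b /=; rewrite mul0r subr0.
Qed.

Lemma Im_intM (k : int) (z : C) : complex.Im (k%:~R * z) = k%:~R * complex.Im z.
Proof.
have -> : (k%:~R : C) = ((k%:~R : R)%:C)%C by rewrite rmorph_int.
by case: z => a b /=; rewrite mul0r addr0.
Qed.

Lemma Re_sum (T : Type) (r : seq T) (F : T -> C) :
  complex.Re (\sum_(t <- r) F t) = \sum_(t <- r) complex.Re (F t).
Proof. by elim/big_rec2: _ => // t a b _ <-; case: (F t) b => ? ? []. Qed.

Lemma Im_sum (T : Type) (r : seq T) (F : T -> C) :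
  complex.Im (\sum_(t <- r) F t) = \sum_(t <- r) complex.Im (F t).
Proof. by elim/big_rec2: _ => // t a b _ <-; case: (F t) b => ? ? []. Qed.

Section Maps.
Variables (M N : basedMod ZG) (f : M -> N).

(** The coefficients are integers, so the operator acts on real and imaginary parts separately. *)
Lemma Lambda_mapE (x : bm_idx M -> G -> C) :
  Lambda_map f x = cplx (Lam (lmx f) (re_part x)) (Lam (lmx f) (im_part x)).
Proof.
rewrite [LHS]cplxE; congr cplx; apply: funext => -[c h].
  rewrite /re_part /Lambda_map Re_sum; apply: eq_bigr => b _.
  by rewrite /l2act Re_sum; apply: eq_bigr => g _; rewrite Re_intM.
rewrite /im_part /Lambda_map Im_sum; apply: eq_bigr => b _.
by rewrite /l2act Im_sum; apply: eq_bigr => g _; rewrite Im_intM.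
Qed.

End Maps.

Lemma psum_sq I (u v : I * G -> R) :
  psum (fun p => u p ^+ 2 + v p ^+ 2) = (psum (fun p => `|u p * u p|)%R + psum (fun p => `|v p * v p|)%R)%E.
Proof.
rewrite -psumD => [|p|p]; try exact: normr_ge0.
by congr psum; apply: funext => p; rewrite !ger0_norm -?expr2 ?sqr_ge0.
Qed.

Lemma sqnormE M (x : bm_idx M -> G -> C) : @Lambda_sqnorm R G M x =
  (psum (fun p => `|re_part x p * re_part x p|)%R + psum (fun p => `|im_part x p * im_part x p|)%R)%E.
Proof.
rewrite -psum_sq psum_pair // => p; by rewrite addr_ge0 ?sqr_ge0.
Qed.

Lemma LambdaP M (x : bm_idx M -> G -> C) : Lambda R M x <-> L2 (re_part x) /\ L2 (im_part x).
Proof.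
have -> : (L2 (re_part x) /\ L2 (im_part x)) <-> (@Lambda_sqnorm R G M x < +oo)%E.
  rewrite sqnormE; split=> [[h1 h2]|h]; first by rewrite lte_add_pinfty.
  split; apply: le_lt_trans h; [rewrite leeDl|rewrite leeDr] => //; exact: psum_ge0.
have g0 b : (0 <= l2sqnorm (x b))%E.
  by apply: esum_ge0 => g _; rewrite lee_fin addr_ge0 ?sqr_ge0.
rewrite /Lambda_sqnorm; split=> [h|h b].
  by apply: lte_sum_pinfty => b _; exact: h.
apply: le_lt_trans h; rewrite (bigD1 b) //= leeDl //.
by apply: sume_ge0 => c _.
Qed.

Lemma Lambda_cplx M (u v : bm_idx M * G -> R) : Lambda R M (cplx u v) <-> L2 u /\ L2 v.
Proof. by rewrite LambdaP re_cplx im_cplx. Qed.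

Lemma psum_ip I (u : I * G -> R) : L2 u -> psum (fun p => `|u p * u p|) = (ip u u)%:E.
Proof.
move=> Lu; have p0 p : 0 <= u p * u p by rewrite -expr2 sqr_ge0.
have -> : (fun p => `|u p * u p|) = (fun p => u p * u p) by apply: funext => p; rewrite ger0_norm.
by rewrite /ip tsum_pos // fineK // psum_fin.
Qed.

Lemma sqnorm_ip M (x : bm_idx M -> G -> C) : Lambda R M x -> @Lambda_sqnorm R G M x =
  (ip (re_part x) (re_part x) + ip (im_part x) (im_part x))%:E.
Proof. by move=> /LambdaP[h1 h2]; rewrite sqnormE !psum_ip. Qed.

Section Closure.
Variables (M N : basedMod ZG) (f : M -> N).
Local Notation a := (lmx f).

Lemma closureP (u v : bm_idx N * G -> R) : L2 u -> L2 v ->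
  Lambda_closure (Lambda_map f @` Lambda R M) (cplx u v) <->
  adherent (range2 a) u /\ adherent (range2 a) v.
Proof.
move=> Lu Lv; split=> [[_ h]|[h1 h2]].
  have k d : 0 < d -> exists y z, [/\ range2 a y, range2 a z &
      ip (fun t => u t - y t) (fun t => u t - y t) + ip (fun t => v t - z t) (fun t => v t - z t) < d].
    move=> d0; have [_ [x /LambdaP[h1 h2] <-]] := h d d0.
    rewrite Lambda_mapE => lt; exists (Lam a (re_part x)), (Lam a (im_part x)).
    split; [by exists (re_part x)|by exists (im_part x)|].
    have := sqnorm_ip (x := fun b g => cplx u v b g - cplx (Lam a (re_part x)) (Lam a (im_part x)) b g).
    rewrite (_ : (fun b g => _) = cplx (fun t => u t - Lam a (re_part x) t) (fun t => v t - Lam a (im_part x) t)) //.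
    rewrite Lambda_cplx re_cplx im_cplx -lte_fin => <- //; last by split; apply: L2B => //; exact: L2_Lam.
  split=> d d0; have [y [z [hy hz lt]]] := k d d0; [exists y|exists z] => //; apply: le_lt_trans lt.
    by rewrite lerDl ip_ge0.
  by rewrite lerDr ip_ge0.
split; first exact/Lambda_cplx.
move=> d d0; have d2 : 0 < d / 2 by rewrite divr_gt0.
have [_ [y Ly <-] ly] := h1 _ d2; have [_ [z Lz <-] lz] := h2 _ d2.
exists (cplx (Lam a y) (Lam a z)).
  by exists (cplx y z); [apply/Lambda_cplx | rewrite Lambda_mapE re_cplx im_cplx].
have := sqnorm_ip (x := fun b g => cplx u v b g - cplx (Lam a y) (Lam a z) b g).
rewrite (_ : (fun b g => _) = cplx (fun t => u t - Lam a y t) (fun t => v t - Lam a z t)) //.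
rewrite Lambda_cplx re_cplx im_cplx => -> //; last by split; apply: L2B => //; exact: L2_Lam.
by rewrite lte_fin (splitr d) ltrD.
Qed.

End Closure.

Lemma range2_orth I J (a : mat I J) (x : J * G -> R) : L2 x -> adherent (range2 a) x ->
  Lam (mstar a) x = (fun _ => 0) -> x = fun _ => 0.
Proof.
move=> Lx ax e; apply: (ip_eq0 Lx).
apply: (adherent_orth (@range2_L2 R G I J a) Lx Lx ax) => _ [z Lz <-].
by rewrite (ip_Lam a Lz Lx) e ipC ip0l.
Qed.

(** Density of the image makes the adjoint injective, and two applications of [injL_card] give equal
    ranks. Conversely, equal ranks make the adjoint injective, and then the image is dense. *)
Lemma weakIso_mx M N (f : {linear M -> N}) : weakIso R f <-> weak R (lmx f).
Proof.
have L0 (I : finType) : L2 (fun _ : I * G => 0 : R) by exact: L20.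
split=> [[inj cl]|[c inj]].
  have h1 : injL (lmx f).
    move=> x Lx ax.
    have e : cplx x (fun _ => 0) = cplx (fun _ => 0) (fun _ => 0).
      have L1 : Lambda R M (cplx x (fun _ => 0)) by apply/Lambda_cplx; split=> //; exact: L0.
      have L2' : Lambda R M (cplx (fun _ => 0) (fun _ => 0)) by apply/Lambda_cplx; split; exact: L0.
      apply: (inj _ _ (mem_set L1) (mem_set L2')).
      rewrite !Lambda_mapE !re_cplx !im_cplx ax.
      by congr cplx; apply: funext => p; rewrite Lam_zero.
    by have := congr1 (@re_part _) e; rewrite !re_cplx.
  have h2 : injL (mstar (lmx f)).
    move=> y Ly e; apply: (range2_orth Ly _ e).
    have : Lambda R N (cplx y (fun _ => 0)) by apply/Lambda_cplx; split=> //; exact: L0.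
    by rewrite -cl => /(closureP f Ly (L0 _))[].
  by split=> //; apply/eqP; rewrite eqn_leq (injL_card h1) (injL_card h2).
have h2 := injL_mstar inj c; split.
  move=> x y /set_mem/LambdaP[x1 x2] /set_mem/LambdaP[y1 y2]; rewrite !Lambda_mapE => e.
  have k (u v : bm_idx M * G -> R) : L2 u -> L2 v -> Lam (lmx f) u = Lam (lmx f) v -> u = v.
    move=> Lu Lv uv; have z := inj _ (L2D Lu (L2Z (-1) Lv)); suff /z : Lam (lmx f) (fun t => u t + -1 * v t) = fun _ => 0.
      by move=> q; apply: funext => t; have := congr1 (fun f => f t) q; lra.
    by apply: funext => p; rewrite Lam_lin uv; lra.
  rewrite [x]cplxE [y]cplxE; congr cplx; apply: k => //.
    by have := congr1 (@re_part _) e; rewrite !re_cplx.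
  by have := congr1 (@im_part _) e; rewrite !im_cplx.
apply/seteqP; split=> [y []//|y Ly]; rewrite [y]cplxE.
have /LambdaP[l1 l2] := Ly.
by apply/(closureP f l1 l2); split; apply: dense_range.
Qed.

End Complexification.

(** * Harmonic chains and acyclicity *)

Section Acyclic.
Variables (R : realType) (G : groupType).
Local Notation ZG := (groupRing G).
Local Notation mat := (mat ZG).
Local Notation Lam := (@Lam_real R G _ _).
Variable (C : chainCpx ZG).
Local Notation c := (fun i j => lmx (cc_d C i j)).

Definition no_harmonic := forall n (x : bm_idx (C n) * G -> R), L2 x ->
  Lam (c n (n - 1)) x = (fun _ => 0) -> Lam (mstar (c (n + 1) n)) x = (fun _ => 0) -> x = fun _ => 0.

Lemma cplx0 (I : Type) : cplx (fun _ : I * G => 0 : R) (fun _ => 0) = fun _ _ => 0.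
Proof. by []. Qed.

Lemma cycle_of_range n y : range2 (R := R) (c (n + 1) n) y -> Lam (c n (n - 1)) y = fun _ => 0.
Proof.
move=> [z Lz <-]; rewrite -Lam_mul -lmx_comp.
rewrite (_ : lmx _ = 0); first by apply: funext => p; rewrite Lam0.
by apply: matP => i j; rewrite /lmx /= cc_dd bm_coord0.
Qed.

(** A harmonic chain in the closure of the boundaries is orthogonal to it, hence zero. Conversely, a
    cycle minus its projection to that closure is harmonic. *)
Lemma l2acyclic_harmonic : l2acyclic R C <-> no_harmonic.
Proof.
have L0 (I : finType) : L2 (fun _ : I * G => 0 : R) by exact: L20.
split=> [h n x Lx cx sx|h n x [/LambdaP[l1 l2] /=]].
  apply: (range2_orth Lx _ sx).
  have /h : (Lambda R (C n) `&` [set x | Lambda_map (cc_d C n (n - 1)) x = fun _ _ => 0]) (cplx x (fun _ => 0)).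
    split; first by apply/Lambda_cplx; split=> //; exact: L0.
    rewrite /= Lambda_mapE re_cplx im_cplx cx -cplx0; congr cplx.
    by apply: funext => p; rewrite Lam_zero.
  by move=> /(closureP _ Lx (L0 _))[].
rewrite Lambda_mapE => e.
have k (y : bm_idx (C n) * G -> R) : L2 y -> Lam (c n (n - 1)) y = (fun _ => 0) ->
    adherent (range2 (c (n + 1) n)) y.
  move=> Ly cy; have [p [Lp ap sp]] := range2_split (c (n + 1) n) Ly.
  (* A limit of boundaries is a cycle: $\|cp\|^2=\langle p,c^{*}cp\rangle$, and $c^{*}cp$ is
     orthogonal to all boundaries. *)
  have cp : Lam (c n (n - 1)) p = fun _ => 0.
    have Lcp := L2_Lam (c n (n - 1)) Lp; apply: (ip_eq0 Lcp); rewrite (ip_Lam _ Lp Lcp).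
    apply: (adherent_orth (@range2_L2 _ _ _ _ _) Lp (L2_Lam _ Lcp) ap) => z hz.
    by rewrite -(ip_Lam _ (range2_L2 hz) Lcp) (cycle_of_range hz) ip0l.
  have z : (fun t => y t - p t) = fun _ => 0.
    apply: (h n _ (L2B Ly Lp) _ sp); apply: funext => q.
    have -> : (fun t => y t - p t) = (fun t => y t + -1 * p t) by apply: funext => t; rewrite mulN1r.
    by rewrite Lam_lin cy cp mulr0 addr0.
  suff -> : y = p by [].
  by apply: funext => t; have /eqP := congr1 (fun f => f t) z; rewrite subr_eq0 => /eqP.
rewrite [x]cplxE; apply/(closureP _ l1 l2); split; apply: k => //.
  by have := congr1 (@re_part _ _ _) e; rewrite re_cplx.
by have := congr1 (@im_part _ _ _) e; rewrite im_cplx.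
Qed.

Section Total.
Variables (B : finType) (e : B -> Tot C) (ei : Tot C -> B).
Hypothesis en : isEnum e ei.

Definition restrict n (x : B * G -> R) : bm_idx (C n) * G -> R := fun p => x (ei (tot p.1), p.2).

Definition extend n (x : bm_idx (C n) * G -> R) : B * G -> R := fun p =>
  \sum_i (p.1 == ei (tot i))%:R * x (i, p.2).

Lemma extend_out n (x : bm_idx (C n) * G -> R) b g : edeg e b != n -> extend x (b, g) = 0.
Proof.
move=> bn; apply: big1 => i _ /=; case: eqP => [h|_]; last by rewrite mul0r.
by rewrite h (edegE en) eqxx in bn.
Qed.

Lemma ei_inj n : injective (fun i : bm_idx (C n) => ei (tot i)).
Proof. by move=> i j /(can_inj en.2) /tot_inj. Qed.

Lemma extendK n (x : bm_idx (C n) * G -> R) : restrict (extend x) = x.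
Proof.
apply: funext => -[i g]; rewrite /restrict /extend /= (bigD1 i) //= eqxx mul1r.
rewrite big1 ?addr0 // => j ji; rewrite (inj_eq (@ei_inj n)) eq_sym (negPf ji).
by rewrite mul0r.
Qed.

Lemma restrict_out n m (x : bm_idx (C n) * G -> R) : m != n -> @restrict m (extend x) = fun _ => 0.
Proof.
by move=> mn; apply: funext => -[i g]; rewrite /restrict /= extend_out // (edegE en).
Qed.

Lemma L2_restrict n (x : B * G -> R) : L2 x -> L2 (@restrict n x).
Proof.
by move=> Lx; apply/(L2_pair (restrict x)) => i; exact: ((L2_pair x).1 Lx (ei (tot i))).
Qed.

Lemma L2_extend n (x : bm_idx (C n) * G -> R) : L2 x -> L2 (extend x).
Proof.
move=> Lx; apply/(L2_pair (extend x)) => b; rewrite /extend /=.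
apply: (@L2_sum _ _ _ _ (fun i g => (b == ei (tot i))%:R * x (i, g))) => i.
by apply: L2Z; exact: ((L2_pair x).1 Lx i).
Qed.

Lemma restrict_inj (x : B * G -> R) : (forall n, @restrict n x = fun _ => 0) -> x = fun _ => 0.
Proof.
move=> h; apply: funext => -[b g]; elim/(enum_elim en): b => n i.
exact: (congr1 (fun f => f (i, g)) (h n)).
Qed.

Lemma restrict_Lam k (a : mat B B) n m (x : B * G -> R) : homog k (edeg e) a -> m = n + k ->
  @restrict m (Lam a x) = Lam (fun i j => a (ei (@tot ZG C n i)) (ei (tot j))) (restrict x).
Proof.
move=> ha mn; apply: funext => -[j h]; rewrite /restrict /Lam_real /=.
rewrite (bigID (fun b => edeg e b == n)) /= [X in _ + X]big1 ?addr0 => [|b bn].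
  exact: (sum_deg en n (fun b => ract (fun g => x (b, g)) (a b (ei (tot j))) h)).
have [->|/ha] := eqVneq (a b (ei (tot j))) 0; first by rewrite ract0.
by rewrite (edegE en) => h'; rewrite -(inj_eq (addIr k)) -mn h' eqxx in bn.
Qed.

Lemma cmat_d n m : (fun i j => cmat e (ei (@tot ZG C n i)) (ei (@tot ZG C m j))) = c n m.
Proof. by apply: matP => i j; rewrite /cmat (fmatE en). Qed.

Lemma mstar_homog (a : mat B B) k : homog k (edeg e) a -> homog (- k) (edeg e) (mstar a).
Proof.
move=> ha i j; have [z|/ha -> _] := eqVneq (a j i) 0; last by rewrite addrK.
by rewrite /mstar z gstar0 eqxx.
Qed.

Lemma harmonic_total : no_harmonic <-> harmonic_free R (cmat e).
Proof.
have hc : homog (-1) (edeg e) (cmat e) := (enum_cpx en).1.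
have hs : homog 1 (edeg e) (mstar (cmat e)) := mstar_homog hc.
have Ec n x : @restrict (n - 1) (Lam (cmat e) x) = Lam (c n (n - 1)) (restrict x).
  by rewrite (restrict_Lam x hc (erefl (n - 1))) cmat_d.
have Es n x : @restrict (n + 1) (Lam (mstar (cmat e)) x) = Lam (mstar (c (n + 1) n)) (restrict x).
  by rewrite (restrict_Lam x hs (erefl (n + 1))) -cmat_d.
have r0 n : @restrict n (fun _ => 0) = fun _ => 0 by [].
have l0 (I J : finType) (a : mat I J) : Lam a (fun _ => 0) = fun _ => 0.
  by apply: funext => p; rewrite Lam_zero.
split=> [h x Lx cx sx|h n x Lx cx sx].
  apply: restrict_inj => n; apply: h; first exact: L2_restrict.
    by rewrite -Ec cx.
  by rewrite -Es sx.
have Le := L2_extend Lx; rewrite -[x]extendK.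
suff -> : extend x = fun _ => 0 by [].
apply: (h _ Le); apply: restrict_inj => m.
  have [->|mn] := eqVneq m (n - 1); first by rewrite Ec extendK.
  have -> : m = (m + 1) - 1 by rewrite addrK.
  rewrite Ec restrict_out ?l0 //; apply: contra mn => /eqP <-.
  by rewrite addrK.
have [->|mn] := eqVneq m (n + 1); first by rewrite Es extendK.
have -> : m = (m - 1) + 1 by rewrite subrK.
rewrite Es restrict_out ?l0 //; apply: contra mn => /eqP <-.
by rewrite subrK.
Qed.

End Total.

Lemma l2acyclic_sqcontr (B : finType) (e : B -> Tot C) : bijective e ->
  l2acyclic R C <-> sqcontr (@weak R G) (edeg e) (cmat e).
Proof.
move=> /bij_isEnum[ei en]; rewrite l2acyclic_harmonic (harmonic_total en).
exact: harmonic_sqcontr (enum_cpx en).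
Qed.

End Acyclic.

Lemma invertible_weak (R : realType) (G : groupType) (I J : finType) (a : mat (groupRing G) I J)
  (b : mat (groupRing G) J I) : a ** b = mone I -> b ** a = mone J -> weak R a.
Proof.
move=> ab ba; split; first exact: invertible_card R _ _ _ _ _ ab ba.
by apply: (@injL_factor R G I J I a b); rewrite ab => x _; rewrite Lam_one.
Qed.

Lemma toQuot_rel0 (V : zmodType) (S : set V) v : S v -> toQuot S v = 0.
Proof. by move=> h; rewrite -(toQuot0 S); apply: toQuot_rel; rewrite subr0. Qed.

(** * Weak contractions and the forgetful maps *)

Section Contraction.
Variable R : nzRingType.
Variable Pm : forall I J : finType, mat R I J -> Prop.
Hypothesis gc : good_class Pm.
Variable P : forall M N : basedMod R, (M -> N) -> Prop.
Hypothesis PE : forall (M N : basedMod R) (f : {linear M -> N}), P f <-> Pm (lmx f).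
Variable Q : chainCpx R -> Prop.
Hypothesis QE : forall (C : chainCpx R) (B : finType) (e : B -> Tot C), bijective e ->
  (Q C <-> sqcontr Pm (edeg e) (cmat e)).
Variable C : chainCpx R.
Hypothesis qC : Q C.
Local Notation e := (@pe R C).

(** The square-zero contraction of [sqcontr] is cut into its components between chain modules;
    [Pm_blocks] turns the condition on the total [v] into one in each degree. *)
Lemma htpy_ex : exists (h : forall i j, {linear C i -> C j}) (u : forall n, {linear C n -> C n}),
  [/\ isChainMap u, forall n, P (u n), isNullHtpy h u & forall i j x, h i j (u i x) = u j (h i j x)].
Proof.
have be := pe_bij C; have [ei en] := bij_isEnum be.
have [hc [d [v [hk dd]]]] := (sqcontr_wcontr _ _ _).1 ((QE be).1 qC).
have v0 := wcontr_homog hc hk; have vc := wcontr_comm hc hk; have [hd dv vd Pv] := hk.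
pose u n : {linear C n -> C n} := fam ei v n n.
have UE n (x y : bm_idx (C n)) : v (ei (tot x)) (ei (tot y)) = lmx (u n) x y by rewrite lmx_fam.
exists (fam ei d), u; split.
- move=> i j x; apply/esym; have := (comm_U en v0 UE (cc_d C)).2; apply.
  exact: vc.
- move=> n; apply: (PE (u n)).2; rewrite (_ : lmx _ = mre (fun x : bm_idx (C n) => ei (tot x)) (fun x => ei (tot x)) v).
    exact: (Pm_blocks gc v0 Pv (tot_deg_enum en n)).
  by apply: matP => x y; rewrite -UE.
- apply/(nullHtpy_mat en (fam ei d) u); rewrite fmat_fam //; split=> // n x y.
  by rewrite -UE -dv.
- have := (comm_U en v0 UE (fam ei d)).2; apply.
  by rewrite fmat_fam.
Qed.

(** A contraction is a weak contraction with $u=\mathrm{id}$, and the correction term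
    $[\mathrm{id}]$ vanishes. *)
Lemma contraction_value (h : forall i j, {linear C i -> C j}) : isContraction h ->
  k1_value P (oddToEv (fun i j x => cc_d C i j x + h i j x)) = [set torsion PE (edeg e) (cmat e)].
Proof.
move=> hh; have P1 (M : basedMod R) : P (idfun : {linear M -> M}).
  by apply: (PE _).2; rewrite lmx_id; exact: gc_one.
have [|n|t1 [t2 [e1 e2 <-]]] := @htpy_value _ _ gc _ PE _ QE C h (fun n => idfun) hh qC.
- by [].
- exact: P1.
rewrite e1; suff -> : t2 = 0 by rewrite subr0.
have : [set t2] = [set (0 : K1t P)].
  rewrite -e2 (_ : oddToOdd _ = (idfun : {linear oddPart C -> oddPart C})).
    by rewrite (k1_valueP gc PE (P1 _)) lmx_id (mxclass_one gc).
  by apply: funext => x; apply/ffunP => i; rewrite ffunE.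
by move=> s12; have : [set t2] t2 by []; rewrite s12.
Qed.

End Contraction.

(** * The forgetful homomorphisms *)

Section Forget.
Variable R : nzRingType.
Variables Pm1 Pm2 : forall I J : finType, mat R I J -> Prop.
Hypothesis gc1 : good_class Pm1.
Hypothesis gc2 : good_class Pm2.
Variables P1 P2 : forall M N : basedMod R, (M -> N) -> Prop.
Hypothesis PE1 : forall (M N : basedMod R) (f : {linear M -> N}), P1 f <-> Pm1 (lmx f).
Hypothesis PE2 : forall (M N : basedMod R) (f : {linear M -> N}), P2 f <-> Pm2 (lmx f).
Variables Q1 Q2 : chainCpx R -> Prop.
Hypothesis QE1 : forall (C : chainCpx R) (B : finType) (e : B -> Tot C), bijective e ->
  (Q1 C <-> sqcontr Pm1 (edeg e) (cmat e)).
Hypothesis QE2 : forall (C : chainCpx R) (B : finType) (e : B -> Tot C), bijective e ->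
  (Q2 C <-> sqcontr Pm2 (edeg e) (cmat e)).
Hypothesis sub : forall (I J : finType) (a : mat R I J), Pm1 a -> Pm2 a.

Lemma forget_map (M N : basedMod R) (f : {linear M -> N}) : P1 f -> P2 f.
Proof. by move=> /PE1/sub/PE2. Qed.

Lemma wcontr_sub (B : finType) (deg : B -> int) (c g u : mat R B B) :
  wcontr Pm1 deg c g u -> wcontr Pm2 deg c g u.
Proof. by case=> h1 h2 h3 /sub h4. Qed.

Lemma sqcontr_sub (B : finType) (deg : B -> int) (c : mat R B B) : sqcontr Pm1 deg c -> sqcontr Pm2 deg c.
Proof. by move=> [hc [d [hd dd /sub h]]]; split=> //; exists d. Qed.

Lemma forget_cpx (C : chainCpx R) : Q1 C -> Q2 C.
Proof. by have be := pe_bij C => /(QE1 be)/sqcontr_sub/(QE2 be). Qed.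

Lemma zeta_ex : exists zeta : {additive K1t P1 -> K1t P2},
  forall (I J : finType) (a : mat R I J), Pm1 a -> zeta (mxclass PE1 a) = mxclass PE2 a.
Proof.
have [phi phiE] := free_lift (fun g : k1_gen P1 => k1t_class (K1Gen (forget_map (k1_mapP g)))).
have z (v : freeAb (k1_gen P2)) : (k1_comp_rel (P:=P2) `|` k1_block_rel (P:=P2)) v ->
    toQuot (@k1_minus_id R P2) (toQuot _ v) = 0.
  by move=> h; rewrite (toQuot_rel0 h) toQuot0.
have [s|psi psiE] := @quot_lift _ _ (k1_comp_rel (P:=P1) `|` k1_block_rel (P:=P1)) phi.
  case=> [[n [f1 [f2 [f [h1 [h2 [h [e ->]]]]]]]]|].
    rewrite raddfB raddfD !phiE /k1t_class /k1_class -!toQuotD -!toQuotB; apply: z; left.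
    by exists n, f1, f2, f; do 3!eexists.
  move=> [m [n [f0 [f1 [f2 [f [h0 [h2 [h [e ->]]]]]]]]]].
  rewrite raddfB raddfD !phiE /k1t_class /k1_class -!toQuotD -!toQuotB; apply: z; right.
  by exists m, n, f0, f1, f2, f; do 3!eexists.
have [s|zeta zetaE] := @quot_lift _ _ (k1_minus_id (P:=P1)) psi.
  move=> [f [h [e ->]]]; rewrite /k1_class psiE phiE /k1t_class.
  by apply: toQuot_rel0; exists f; eexists.
exists zeta => I J a ha; have ha2 := sub ha.
have [k bk] := bij_ord (gc_card gc1 ha); have [h bh] := @bij_ord I I erefl.
have Pa1 := P_mx PE1 (gc_re gc1 bh bk ha).
rewrite (mxclass_eq gc1 PE1 ha bh bk) (mxclass_eq gc2 PE2 ha2 bh bk) (ordclassE PE1 Pa1).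
by rewrite (ordclassE PE2 (forget_map Pa1)) /k1t_class zetaE /k1_class psiE phiE.
Qed.

Lemma zeta_ch_ex : exists zeta : {additive KCh Q1 -> KCh Q2},
  forall (B : finType) (deg : B -> int) (c : mat R B B), sqcontr Pm1 deg c ->
    zeta (@cpxclass R Q1 B deg c) = @cpxclass R Q2 B deg c.
Proof.
have [phi phiE] := free_lift (fun S : kch_gen Q1 => kch_class (KChGen (forget_cpx (kch_cpxP S)))).
have [s|zeta zetaE] := @quot_lift _ _ (kch_iso_rel (Q:=Q1) `|` kch_exact_rel (Q:=Q1) `|` kch_elem_rel (Q:=Q1)) phi.
  case=> [[[S [S' [iso ->]]]|[S1 [S [S2 [ex ->]]]]]|[n [S [el ->]]]].
  - rewrite raddfB !phiE /kch_class -toQuotB; apply: toQuot_rel0.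
    by left; left; do 2!eexists; split; last reflexivity.
  - rewrite raddfB raddfD !phiE /kch_class -toQuotD -toQuotB.
    apply: toQuot_rel0; left; right.
    by do 3!eexists; split; last reflexivity.
  rewrite phiE /kch_class; apply: toQuot_rel0; right.
  by exists n; eexists; split; last reflexivity.
exists zeta => B deg c /(cpxclass_ex QE1)[S [e [be ed ec ->]]].
rewrite /kch_class zetaE phiE; apply/esym.
exact: (cpxclass_class (S := KChGen (forget_cpx (kch_cpxP S))) be ed ec).
Qed.

(** A contraction for the smaller class is one for the larger, so both torsions are computed from
    the same matrices. *)
Lemma zeta_torsion (zeta : {additive K1t P1 -> K1t P2}) (B : finType) (deg : B -> int) (c : mat R B B) :
  (forall (I J : finType) (a : mat R I J), Pm1 a -> zeta (mxclass PE1 a) = mxclass PE2 a) ->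
  sqcontr Pm1 deg c -> zeta (torsion PE1 deg c) = torsion PE2 deg c.
Proof.
move=> zE /sqcontr_wcontr[hc [d [v [hk dd]]]]; have [B1 [B2 [s [bs par]]]] := parity_split deg.
rewrite (torsion_sq gc1 PE1 hc hk dd bs par) (torsion_sq gc2 PE2 hc (wcontr_sub hk) dd bs par).
have [PT Po _ _] := wcontr_facts gc1 PE1 par (cpx_re bs hc) (wcontr_re gc1 bs hk).
by rewrite /torsionval raddfB !zE.
Qed.

End Forget.

(** Torsions and classes are sets of values over all choices; an equation with a singleton says that
    a value exists and that it is independent of the choices. *)
Theorem theorem1p12 (R : realType) (G : groupType) :
  exists (rho : {additive K1chZ G -> K1tZ G})
    (rho_inv : {additive K1tZ G -> K1chZ G})
    (rho2 : {additive K1wchZ R G -> K1wtZ R G})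
    (rho2_inv : {additive K1wtZ R G -> K1wchZ R G})
    (zeta_ch : {additive K1chZ G -> K1wchZ R G})
    (zeta : {additive K1tZ G -> K1wtZ R G}),
  (* the torsion invariants are well defined and induce rho and rho2 *)
  (forall C : chainCpx (groupRing G), contractible C ->
     exists x : K1chZ G,
       kch_value (@contractible _) C = [set x] /\ rho_value C = [set rho x]) /\
  (forall C : chainCpx (groupRing G), l2acyclic R C ->
     exists x : K1wchZ R G,
       kch_value (l2acyclic R) C = [set x] /\ rho2_value C = [set rho2 x]) /\
  (* rho and rho2 are isomorphisms *)
  (cancel rho rho_inv /\ cancel rho_inv rho) /\
  (cancel rho2 rho2_inv /\ cancel rho2_inv rho2) /\
  (* the maps zeta are the forgetful homomorphisms *)
  (forall C : chainCpx (groupRing G), contractible C ->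
     exists x : K1chZ G,
       kch_value (@contractible _) C = [set x] /\
       kch_value (l2acyclic R) C = [set zeta_ch x]) /\
  (forall (M N : basedMod (groupRing G)) (f : {linear M -> N}), isIso f ->
     exists t : K1tZ G,
       k1_value (@isIso _) f = [set t] /\
       k1_value (@weakIso R G) f = [set zeta t]) /\
  (* the square commutes *)
  (forall x : K1chZ G, rho2 (zeta_ch x) = zeta (rho x)) /\
  (* the inverses are given by 1-dimensional complexes *)
  (forall (M N : basedMod (groupRing G)) (f : {linear M -> N}), isIso f ->
     exists t : K1tZ G,
       k1_value (@isIso _) f = [set t] /\
       kch_onedim (@contractible _) f = [set rho_inv t]) /\
  (forall (M N : basedMod (groupRing G)) (f : {linear M -> N}), weakIso R f ->
     exists t : K1wtZ R G,
       k1_value (@weakIso R G) f = [set t] /\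
       kch_onedim (l2acyclic R) f = [set rho2_inv t]).
Proof.
pose Z := groupRing G.
have ibn (I J : finType) (a : mat Z I J) (b : mat Z J I) :
    a ** b = mone I -> b ** a = mone J -> #|I| = #|J| by exact: (@invertible_card R G).
have gc1 := invertible_good ibn; have gc2 := @weak_good R G.
have PE1 (M N : basedMod Z) (f : {linear M -> N}) := isIso_mx f.
have PE2 (M N : basedMod Z) (f : {linear M -> N}) := weakIso_mx R f.
have QE1 (C : chainCpx Z) (B : finType) (e : B -> Tot C) := contractible_sqcontr ibn (e := e).
have QE2 (C : chainCpx Z) (B : finType) (e : B -> Tot C) := @l2acyclic_sqcontr R G C B e.
have sub (I J : finType) (a : mat Z I J) : invertible a -> weak R a.
  by move=> [b [ab ba]]; exact: invertible_weak ab ba.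
have [rho [rho_inv [rhoE rho_invE k1 k2]]] := abstract_iso gc1 PE1 QE1.
have [rho2 [rho2_inv [rho2E rho2_invE k3 k4]]] := abstract_iso gc2 PE2 QE2.
have [zeta zetaE] := zeta_ex gc1 gc2 PE1 PE2 sub.
have [zch zchE] := zeta_ch_ex QE1 QE2 sub.
exists rho, rho_inv, rho2, rho2_inv, zch, zeta.
split=> [C qC|].
  have be := pe_bij C; exists (cpxclass _ (edeg (@pe _ C)) (cmat (@pe _ C))).
  split; first exact: (kch_valueP QE1 be qC).
  rewrite (rhoE _ _ _ ((QE1 _ _ _ be).1 qC)); apply/seteqP; split=> t.
    by move=> [h [hh]]; rewrite (contraction_value gc1 PE1 QE1 qC hh).
  by move=> ->; have [h hh] := qC; exists h; split=> //; rewrite (contraction_value gc1 PE1 QE1 qC hh).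
split=> [C qC|].
  have be := pe_bij C; exists (cpxclass _ (edeg (@pe _ C)) (cmat (@pe _ C))).
  split; first exact: (kch_valueP QE2 be qC).
  rewrite (rho2E _ _ _ ((QE2 _ _ _ be).1 qC)); apply/seteqP; split=> t.
    move=> [h [u [t1 [t2 [[_ hP hu comm] v1 v2 ->]]]]].
    have [t1' [t2' [e1 e2 <-]]] := htpy_value gc2 PE2 QE2 hu qC comm hP.
    by rewrite e1 in v1; rewrite e2 in v2; rewrite v1 v2.
  move=> ->; have [h [u [hc hP hu comm]]] := htpy_ex gc2 PE2 QE2 qC.
  have [t1 [t2 [e1 e2 <-]]] := htpy_value gc2 PE2 QE2 hu qC comm hP.
  by exists h, u, t1, t2; split=> //; rewrite ?e1 ?e2.
split; first by [].
split; first by [].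
split=> [C qC|].
  have be := pe_bij C; have h := (QE1 _ _ _ be).1 qC.
  exists (cpxclass _ (edeg (@pe _ C)) (cmat (@pe _ C))).
  split; first exact: (kch_valueP QE1 be qC).
  by rewrite (zchE _ _ _ h); apply: (kch_valueP QE2 be); exact: (forget_cpx QE1 QE2 sub qC).
split=> [M N f hf|].
  exists (mxclass PE1 (lmx f)); split; first exact: (k1_valueP gc1 PE1 hf).
  rewrite zetaE; first exact: (k1_valueP gc2 PE2 (forget_map PE1 PE2 sub hf)).
  exact: ((PE1 _ _ f).1 hf).
split.
  (* All maps are additive, so the square is checked on classes of complexes, where both ways give
     the torsion of the same total differential. *)
  apply: (kch_ind QE1) => [|x y hx hy|B deg c h].
  - by rewrite !raddf0.
  - by rewrite !raddfB hx hy.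
  rewrite (zchE _ _ _ h) (rhoE _ _ _ h) (zeta_torsion gc1 gc2 sub zetaE h).
  exact: (rho2E _ _ _ (sqcontr_sub sub h)).
split=> M N f hf.
  have h := (PE1 _ _ f).1 hf; exists (mxclass PE1 (lmx f)); split; first exact: (k1_valueP gc1 PE1 hf).
  by rewrite (rho_invE _ _ _ h); exact: (kch_onedimP gc1 QE1 0 h).
have h := (PE2 _ _ f).1 hf; exists (mxclass PE2 (lmx f)); split; first exact: (k1_valueP gc2 PE2 hf).
by rewrite (rho2_invE _ _ _ h); exact: (kch_onedimP gc2 QE2 0 h).
Qed.
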